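(* Let $t$ be a transcendental real number with $0<t<1$, and consider a weighted model of walks in the quarter plane arising from one of the five step sets (S) described in the context. Then the functions $x\mapsto Q(x,0,t)$ and $y\mapsto Q(0,y,t)$ are differentially transcendental over $\mathbb{C}(x)$ and $\mathbb{C}(y)$ respectively.
   Context: Weighted walks. Let $(d_{i,j})_{(i,j)\in\{-1,0,1\}^2}$ be a family of elements of $\mathbb{Q}\cap[0,1]$ with $\sum_{i,j}d_{i,j}=1$. A walk with $k$ steps in the quarter plane is a sequence $w_0=(0,0),w_1,\dots,w_k$ of points of $\mathbb{Z}_{\ge 0}^2$ with $w_{r}-w_{r-1}\in\{-1,0,1\}^2$ for all $r$; its weight is $\prod_{r=1}^k d_{w_r-w_{r-1}}$. Let $q_{i,j,k}$ be the sum of the weights of all walks with $k$ steps ending at $(i,j)$, and $Q(x,y,t)=\sum_{i,j,k\ge 0}q_{i,j,k}x^iy^jt^k$. For $|x|<1$, $|y|<1$, $0<t<1$ this series converges; $t$ is a fixed number. Models arising from (S). The model of the walk is the set $\{(i,j)\in\{-1,0,1\}^2\setminus\{(0,0)\} : d_{i,j}\ne 0\}$. The weighted model arises from (S) if this set is one of the following five sets: $\{(-1,1),(0,1),(1,-1)\}$; $\{(-1,1),(1,1),(1,-1)\}$; $\{(-1,1),(0,1),(1,1),(1,-1)\}$; $\{(-1,1),(0,1),(1,1),(1,0),(1,-1)\}$; $\{(-1,1),(0,1),(1,0),(1,-1)\}$. ($d_{0,0}$ may be zero or nonzero.) Differential transcendence. For differential fields $(E,\delta)\subset(F,\delta)$,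 $f\in F$ is differentially algebraic over $E$ if there are $m$ and a nonzero polynomial $P\in E[y_0,\dots,y_m]$ with $P(f,\delta(f),\dots,\delta^m(f))=0$; otherwise $f$ is differentially transcendental over $E$. Here $\mathbb{C}(x)$ carries $\delta=\frac{d}{dx}$ and $\mathbb{C}(y)$ carries $\delta=\frac{d}{dy}$. *)

(* Defs.v *)
From HB Require Import structures.
From mathcomp Require Import all_boot all_order all_algebra.
From mathcomp Require Import generic_quotient.
(* The notations of mpoly clash with those of the analysis library. *)
From mathcomp Require Import -(notations) mpoly.
From mathcomp Require Import all_classical all_reals all_analysis.
From mathcomp Require Import complex.

Set Implicit Arguments.
Unset Strict Implicit.
Unset Printing Implicit Defensive.

Import Order.TTheory GRing.Theory Num.Theory.
Import numFieldNormedType.Exports.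

Local Open Scope classical_set_scope.
Local Open Scope ring_scope.

Definition axis_steps : seq int := [:: -1; 0; 1].

Definition small_step (s : int * int) : bool :=
  (s.1 \in axis_steps) && (s.2 \in axis_steps).

(* The values of [d] outside {-1,0,1}^2 play no role: a family indexed by
   {-1,0,1}^2 is represented by any extension to Z^2. *)
Definition is_weight (d : int * int -> rat) : Prop :=
  (forall s, small_step s -> 0 <= d s <= 1) /\
  \sum_(i <- axis_steps) \sum_(j <- axis_steps) d (i, j) = 1.

Definition step (p q : nat * nat) : int * int :=
  (q.1%:Z - p.1%:Z, q.2%:Z - p.2%:Z).

Definition walks (k i j : nat) : set (k.+1.-tuple (nat * nat)) :=
  [set w | let p := nth (0%N, 0%N) w in
     [/\ p 0%N = (0%N, 0%N),
         forall r, (r < k)%N -> small_step (step (p r) (p r.+1)) &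
         p k = (i, j)]].

Arguments walks : clear implicits.

Definition walk_weight (d : int * int -> rat) (k : nat)
    (w : k.+1.-tuple (nat * nat)) : rat :=
  let p := nth (0%N, 0%N) w in \prod_(r < k) d (step (p r) (p r.+1)).

(* [walks k i j] is a finite set, so this finitely supported sum is the sum of
   the weights of all its elements. *)
Definition walk_coef (d : int * int -> rat) (i j k : nat) : rat :=
  \sum_(w \in walks k i j) walk_weight d w.

(* The triple series is summed along the cubes i, j, k < n.  For a weight [d]
   and [C] the complex numbers, it converges absolutely when |x|, |y| <= 1 and
   |t| < 1, so that the order of summation is irrelevant there. *)
Definition walk_gf (C : numFieldType) (d : int * int -> rat) (x y t : C) : C :=
  lim ((fun n : nat => \sum_(i < n) \sum_(j < n) \sum_(k < n)
          ratr (walk_coef d i j k) * x ^+ i * y ^+ j * t ^+ k) @ \oo).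

Definition step_sets_S : seq (seq (int * int)) :=
  [:: [:: (-1, 1); (0, 1); (1, -1)];
      [:: (-1, 1); (1, 1); (1, -1)];
      [:: (-1, 1); (0, 1); (1, 1); (1, -1)];
      [:: (-1, 1); (0, 1); (1, 1); (1, 0); (1, -1)];
      [:: (-1, 1); (0, 1); (1, 0); (1, -1)]].

Definition model (d : int * int -> rat) : set (int * int) :=
  [set s | [/\ small_step s, s <> (0, 0) & d s <> 0]].

Definition arises_from_S (d : int * int -> rat) : Prop :=
  exists2 S, S \in step_sets_S & model d = [set` S].

Section DifferentialTranscendence.
Variable C : numFieldType.

(* The chosen fraction representing [r] need not be in lowest terms, so
   [ratfun_defined r] may fail at finitely many points that are not poles. *)
Definition ratfun_defined (r : {fraction {poly C}}) (x : C) : Prop :=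
  (frac (repr r)).2.[x] <> 0.

Definition ratfun_eval (x : C) (r : {fraction {poly C}}) : C :=
  (frac (repr r)).1.[x] / (frac (repr r)).2.[x].

(* Differential algebraicity over C(x), with the derivation d/dx, of a function
   that is analytic on the open unit disc D.  The ambient differential field is
   the field of meromorphic functions on D, in which P(f, f', ..., f^(m)) = 0
   means that this identity holds at every point of D outside the (finitely
   many) points where some coefficient of P is not defined.  [mmap]
   evaluates the coefficients of P at [x] and substitutes the successive
   derivatives of [f] at [x] for the variables. *)
Definition diff_algebraic (f : C -> C) : Prop :=
  exists (m : nat) (P : mpoly m.+1 {fraction {poly C}}),
    P <> 0 /\
    forall x : C, `|x| < 1 ->
      (forall u, u \in msupp P -> ratfun_defined (mcoeff u P) x) ->
      mmap (ratfun_eval x) (fun i : 'I_m.+1 => derive1n i f x) P = 0.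

Definition diff_transcendental (f : C -> C) : Prop := ~ diff_algebraic f.

End DifferentialTranscendence.

(* Main.v *)
Require Import Defs.
From HB Require Import structures.
From mathcomp Require Import all_boot all_order all_algebra.
From mathcomp Require Import generic_quotient.
From mathcomp Require Import -(notations) mpoly.
From mathcomp Require Import all_classical all_reals all_analysis.
From mathcomp Require Import complex.
From mathcomp Require Import ring zify.

Set Implicit Arguments.
Unset Strict Implicit.
Unset Printing Implicit Defensive.
Import Order.TTheory GRing.Theory Num.Theory.
Import numFieldNormedType.Exports.
Local Open Scope classical_set_scope.
Local Open Scope ring_scope.

(** Let a, b be the weights of the steps (1,-1) and (-1,1).  As all steps
    have i + j >= 0, the recursion on the length of walks gives, on the
    part |x|, |y| <= 1 of the kernel curve t S(x,y) = x y (with S the step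
    polynomial multiplied by x y),
      t a x^2 Q(x,0,t) + t b y^2 Q(0,y,t) = x y            ([functional_equation]).
    In the coordinates 1/x, 1/y this curve is a conic.  It has a rational
    parametrization (x(s), y(s)) with x(0) = y(0) = 0, such that (x(s), y(q s))
    lies on it too, where q is the ratio of the roots of a m^2 - (1/t - d(0,0)) m + b.
    Subtracting the two instances of the functional equation, the germ
    g(s) = t b y(s)^2 Q(0,y(s),t) satisfies, near s = 0,
      g(q s) - g(s) = x(s) (y(q s) - y(s)),
    whose right-hand side c(s) is a rational function ([telescoped_curve]).

    The derivation s d/ds commutes with the dilation s -> q s.  So if g is
    differentially algebraic over C(s), its iterated derivatives satisfy a
    polynomial relation, each of them being changed by a rational function under
    the dilation.  Ostrowski's argument ([ostrowski], [germ_telescoper]) makes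
    such a relation linear: there are constants l_i, not all zero, and a rational
    function h with
      sum_i l_i (s d/ds)^i c (s) = h(q s) - h(s).
    But c has a pole p whose order is greater than its order at every other
    point of the orbit of p under the dilation.  The left-hand side inherits this
    property, while a difference h(q s) - h(s) cannot have it, since h has finitely
    many poles ([no_linear_telescoper]).

    The existence of p is where the transcendence of t enters.  A coincidence
    between the orbits of the poles of x and of y would be a polynomial relation
    over the rationals satisfied by 1/t - d(0,0), and degrees show that this
    relation is not trivial ([x_poles_not_dilated], [xy_poles_not_dilated]).  The
    only coincidence that does occur, when (1,1) is not a step, is a
    common pole of x and y; it increases the order of c at p.

    Lastly, Q(0,y,t) and Q(x,0,t) are differentially algebraic only if g is: by
    the chain rule the derivatives of W(y(s)) and the values W^(i)(y(s)) determine
    each other by an invertible triangular system over C(s) ([tower_relation]).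
    All functions are handled as germs at the punctured origin, where rational
    functions have no poles; no meromorphic continuation is used. *)

(** * Rational functions and the derivation s d/ds *)

Local Notation "a %:F" := (@FracField.tofrac _ a) : ring_scope.

Section FractionLift.
Variables (A : idomainType).

Lemma fracE (r : {fraction A}) :
  r = (frac (repr r)).1%:F / (frac (repr r)).2%:F.
Proof.
have dp : (frac (repr r)).2 != 0 by exact: denom_ratioP.
apply: (canRL (mulfK _)); first by rewrite tofrac_eq0.
rewrite -{1}[r]reprK; move: (repr r) dp => p dp.
unlock FracField.tofrac; rewrite -[LHS]FracField.pi_mul; apply/eqmodP.
rewrite /= FracField.equivfE /FracField.mulf.
by rewrite !numden_Ratio ?(oner_neq0, mulf_neq0, mulr1) // mulrC.
Qed.

End FractionLift.

(** A field of fractions of C[s], through chosen numerators and denominators.  The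
    arguments below depend on nothing else about the construction of C(s). *)
Record ratField (C : fieldType) := RatField {
  ratField_sort :> fieldType;
  rpoly : {rmorphism {poly C} -> ratField_sort};
  rnum : ratField_sort -> {poly C};
  rden : ratField_sort -> {poly C};
  rpoly_eq0 : forall p, (rpoly p == 0) = (p == 0);
  rden_neq0 : forall r, rden r != 0;
  rnumdenE : forall r, r = rpoly (rnum r) / rpoly (rden r)
}.
Arguments rpoly {C K} : rename.
Arguments rnum {C K} : rename.
Arguments rden {C K} : rename.

Section RationalFunctions.
Variables (C : fieldType) (K : ratField C).
Local Notation "p %:K" := (@rpoly C K p) (at level 1, format "p %:K").

Lemma ratP (r : K) : exists a b : {poly C}, b != 0 /\ r = a%:K / b%:K.
Proof. by exists (rnum r), (rden r); split; [exact: rden_neq0|exact: rnumdenE]. Qed.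

Lemma eq_rat (a b c d : {poly C}) : b != 0 -> d != 0 ->
  a%:K / b%:K = c%:K / d%:K -> a * d = c * b.
Proof.
move=> b0 d0 /eqP; rewrite eqr_div ?rpoly_eq0 // -!rmorphM -subr_eq0 -rmorphB.
by rewrite rpoly_eq0 subr_eq0 => /eqP.
Qed.

(** The universal property of a field of fractions. *)
Lemma rat_lift (L : fieldType) (f : {rmorphism {poly C} -> L}) :
  (forall a, a != 0 -> f a != 0) ->
  exists phi : {rmorphism K -> L}, forall a, phi a%:K = f a.
Proof.
move=> finj.
pose phi (r : K) := f (rnum r) / f (rden r).
have phiE a b : b != 0 -> phi (a%:K / b%:K) = f a / f b.
  move=> b0; rewrite /phi.
  have d0 := rden_neq0 (a%:K / b%:K).
  apply/eqP; rewrite eqr_div ?finj // -!rmorphM; apply/eqP; congr (f _).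
  by apply: eq_rat => //; rewrite -rnumdenE.
have phi1 a : phi a%:K = f a.
  have -> : a%:K = a%:K / 1%:K by rewrite rmorph1 divr1.
  by rewrite phiE ?oner_neq0 // rmorph1 divr1.
have phi_zmod : zmod_morphism phi.
  move=> r s; have [a [b [b0 ->]]] := ratP r; have [c [d [d0 ->]]] := ratP s.
  rewrite -mulNr -rmorphN addf_div ?rpoly_eq0 // -!rmorphM -rmorphD.
  rewrite !phiE ?mulf_neq0 // -mulNr addf_div ?finj //.
  by rewrite rmorphD !rmorphM rmorphN.
have phi_mon : monoid_morphism phi.
  split=> [|r s]; first by rewrite -(rmorph1 rpoly) phi1 rmorph1.
  have [a [b [b0 ->]]] := ratP r; have [c [d [d0 ->]]] := ratP s.
  by rewrite mulf_div -!rmorphM !phiE ?mulf_neq0 // !rmorphM mulf_div.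
pose M1 := GRing.isZmodMorphism.Build _ _ phi phi_zmod.
pose M2 := GRing.isMonoidMorphism.Build _ _ phi phi_mon.
pose phi' : {rmorphism K -> L} := HB.pack phi M1 M2.
by exists phi' => a; exact: phi1.
Qed.

Definition rcst (c : C) : K := (c%:P)%:K.
Definition rX : K := 'X%:K.

Lemma rcst_is_zmod_morphism : zmod_morphism rcst.
Proof. by move=> a b; rewrite /rcst polyCB rmorphB. Qed.

Lemma rcst_is_monoid_morphism : monoid_morphism rcst.
Proof. by split=> [|a b]; rewrite /rcst ?rmorph1 // polyCM rmorphM. Qed.

HB.instance Definition _ :=
  GRing.isZmodMorphism.Build C K rcst rcst_is_zmod_morphism.
HB.instance Definition _ :=
  GRing.isMonoidMorphism.Build C K rcst rcst_is_monoid_morphism.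

Lemma rcst_eq0 c : (rcst c == 0) = (c == 0).
Proof. by rewrite rpoly_eq0 polyC_eq0. Qed.

Definition rhorner (p : {poly C}) (rho : K) : K := (map_poly rcst p).[rho].

(** Substitution of rho for the variable, for rho transcendental over C. *)
Lemma rat_subst (rho : K) : (forall p, p != 0 -> rhorner p rho != 0) ->
  exists phi : {rmorphism K -> K}, forall p, phi p%:K = rhorner p rho.
Proof.
move=> rho_tr.
have comm : commr_rmorph rcst rho by move=> c; exact: mulrC.
by have [|phi phiE] := @rat_lift _ (horner_morph comm); [|exists phi].
Qed.

(** The derivation s d/ds, preferred to d/ds because it commutes with s -> q s. *)
Definition delta (r : K) : K :=
  let: (n, d) := (rnum r, rden r) in
  ('X * (n^`() * d - n * d^`()))%:K / (d ^+ 2)%:K.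

(** The quotient rule does not depend on the fraction chosen to represent r. *)
Lemma deltaE (a b : {poly C}) : b != 0 ->
  delta (a%:K / b%:K) = ('X * (a^`() * b - a * b^`()))%:K / (b ^+ 2)%:K.
Proof.
move=> b0; rewrite /delta; set r := a%:K / b%:K.
have := rden_neq0 r; have := rnumdenE r.
move: (rnum r) (rden r) => n d E d0.
apply/eqP; rewrite eqr_div ?rpoly_eq0 ?expf_neq0 // -!rmorphM.
have Eab : a * d = n * b by exact: eq_rat.
have Eab' : a^`() * d + a * d^`() = n^`() * b + n * b^`() by rewrite -!derivM Eab.
apply/eqP; congr (rpoly _).
have -> : 'X * (n^`() * d - n * d^`()) * b ^+ 2 =
  'X * ((n^`() * b + n * b^`()) * d * b - (n * b) * b^`() * d - (n * b) * d^`() * b).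
  ring.
rewrite -Eab -Eab'; ring.
Qed.

Lemma deltaD r s : delta (r + s) = delta r + delta s.
Proof.
have [a [b [b0 ->]]] := ratP r; have [c [d [d0 ->]]] := ratP s.
rewrite addf_div ?rpoly_eq0 // -!rmorphM -rmorphD !deltaE ?mulf_neq0 //.
rewrite addf_div ?rpoly_eq0 ?expf_neq0 // -!rmorphM -rmorphD.
rewrite derivD !derivM exprMn; congr (rpoly _ / _); ring.
Qed.

End RationalFunctions.
Arguments rX {C K}.
Arguments rcst {C K}.
Arguments delta {C K}.

(** * Evaluation of rational functions near the origin *)

Section Germs.
Variables (C : numFieldType) (K : ratField C).
Local Notation "p %:K" := (@rpoly C K p) (at level 1, format "p %:K").

(** The chosen fraction may have a common factor vanishing at s, so evaluation is
    compatible with the field operations only outside a finite set; hence the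
    statements on a punctured neighbourhood of the origin. *)
Definition reval (s : C) (r : K) : C := (rnum r).[s] / (rden r).[s].

Lemma is_derive_horner (p : {poly C}) (x : C) :
  is_derive x 1 (horner p) p^`().[x].
Proof.
elim/poly_ind: p => [|p c IH].
  rewrite deriv0 horner0.
  have -> : horner (0 : {poly C}) = cst 0 by apply/funext => z; rewrite horner0.
  exact: is_derive_cst.
have -> : horner (p * 'X + c%:P) = (horner p * id) + cst c.
  by apply/funext => z; rewrite hornerMXaddC.
apply: is_derive_eq; rewrite derivD derivM derivC derivX !hornerE.
by rewrite /GRing.scale /= mulr1 addrC (mulrC x).
Qed.

Lemma horner_continuous (p : {poly C}) : continuous (horner p).
Proof.
move=> x; apply/differentiable_continuous/derivable1_diffP.
by have [] := is_derive_horner p x.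
Qed.

Lemma near_horner_neq0 (p : {poly C}) : p != 0 -> \forall s \near 0^', p.[s] != 0.
Proof.
move=> p0; have [m [q q0 Ep]] := multiplicity_XsubC p 0.
move: q0; rewrite p0 /= /root => q0.
have : \forall s \near 0^', q.[s] != 0.
  exact/nbhs_dnbhs/(cvgr_neq0 _ (@horner_continuous q 0)).
apply: filterS2 (nbhs_dnbhs_neq 0) => s s0 qs.
rewrite Ep hornerM horner_exp hornerXsubC subr0.
by rewrite mulf_neq0 // expf_neq0.
Qed.

Lemma reval_frac (a b : {poly C}) : b != 0 ->
  \forall s \near 0^', reval s (a%:K / b%:K) = a.[s] / b.[s].
Proof.
move=> b0; rewrite /reval; set r := a%:K / b%:K.
have E := eq_rat (rden_neq0 r) b0 (esym (rnumdenE r)).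
have := near_horner_neq0 (rden_neq0 r).
apply: filterS2 (near_horner_neq0 b0) => s bs ds.
by apply/eqP; rewrite eqr_div // -!hornerM E.
Qed.

Lemma reval_poly (a : {poly C}) : \forall s \near 0^', reval s a%:K = a.[s].
Proof.
have := reval_frac a (oner_neq0 _); apply: filterS => s.
by rewrite rmorph1 hornerC !divr1.
Qed.

Lemma reval_cst c : \forall s \near 0^', reval s (rcst c) = c.
Proof. by have := reval_poly c%:P; apply: filterS => s ->; rewrite hornerC. Qed.

Lemma reval_neq0 r : r != 0 -> \forall s \near 0^', reval s r != 0.
Proof.
move=> r0; rewrite /reval; have n0 : rnum r != 0.
  by apply: contra_neq r0 => E; rewrite (rnumdenE r) E rmorph0 mul0r.
have := near_horner_neq0 n0; apply: filterS2 (near_horner_neq0 (rden_neq0 r)).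
by move=> s ds ns; rewrite mulf_neq0 // invr_eq0.
Qed.

Lemma revalD r1 r2 : \forall s \near 0^', reval s (r1 + r2) = reval s r1 + reval s r2.
Proof.
have d1 := rden_neq0 r1; have d2 := rden_neq0 r2.
have := reval_frac (rnum r1 * rden r2 + rnum r2 * rden r1) (mulf_neq0 d1 d2).
have -> : (rnum r1 * rden r2 + rnum r2 * rden r1)%:K / (rden r1 * rden r2)%:K
    = r1 + r2.
  by rewrite [in RHS](rnumdenE r1) [in RHS](rnumdenE r2) addf_div ?rpoly_eq0 //
     !(rmorphM, rmorphD).
apply: filter_app; have := near_horner_neq0 d2.
apply: filterS2 (near_horner_neq0 d1) => s s1 s2 ->.
by rewrite /reval addf_div // !(hornerM, hornerD).
Qed.

Lemma revalM r1 r2 : \forall s \near 0^', reval s (r1 * r2) = reval s r1 * reval s r2.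
Proof.
have d1 := rden_neq0 r1; have d2 := rden_neq0 r2.
have := reval_frac (rnum r1 * rnum r2) (mulf_neq0 d1 d2).
have -> : (rnum r1 * rnum r2)%:K / (rden r1 * rden r2)%:K = r1 * r2.
  by rewrite [in RHS](rnumdenE r1) [in RHS](rnumdenE r2) mulf_div !rmorphM.
by apply: filterS => s ->; rewrite /reval mulf_div !hornerM.
Qed.

Lemma reval0 : \forall s \near 0^', reval s 0 = 0.
Proof. by have := reval_cst 0; rewrite rmorph0. Qed.

Lemma reval1 : \forall s \near 0^', reval s 1 = 1.
Proof. by have := reval_cst 1; rewrite rmorph1. Qed.

Lemma revalN r : \forall s \near 0^', reval s (- r) = - reval s r.
Proof.
apply: filterS2 reval0 (revalD r (- r)) => s E0.
by rewrite subrr E0 => /esym/eqP; rewrite addrC addr_eq0 => /eqP.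
Qed.

Lemma reval_div r1 r2 : \forall s \near 0^', reval s (r1 / r2) = reval s r1 / reval s r2.
Proof.
have [->|r20] := eqVneq r2 0.
  by rewrite invr0 mulr0; apply: filterS reval0 => s ->; rewrite invr0 mulr0.
apply: filterS2 (revalM (r1 / r2) r2) (reval_neq0 r20) => s.
by rewrite divfK // => E r2s; rewrite E mulfK.
Qed.

Lemma reval_sum (I : Type) (l : seq I) (F : I -> K) :
  \forall s \near 0^', reval s (\sum_(i <- l) F i) = \sum_(i <- l) reval s (F i).
Proof.
elim: l => [|i l IH]; first by apply: filterS reval0 => s E; rewrite !big_nil.
rewrite big_cons; apply: filterS2 (revalD (F i) (\sum_(j <- l) F j)) IH => s -> ->.
by rewrite big_cons.
Qed.

Lemma reval_rhorner p rho :
  \forall s \near 0^', reval s (rhorner p rho) = p.[reval s rho].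
Proof.
rewrite /rhorner; elim/poly_ind: p => [|p c IH].
  by rewrite map_poly0 horner0; apply: filterS reval0 => s ->; rewrite horner0.
rewrite rmorphD rmorphM /= map_polyX map_polyC /= hornerMXaddC.
have := revalD ((map_poly rcst p).[rho] * rho) (rcst c); apply: filter_app.
have := revalM (map_poly rcst p).[rho] rho; apply: filter_app.
apply: filterS2 IH (reval_cst c) => s E Ec EM ->.
by rewrite EM E Ec hornerMXaddC.
Qed.

(** As rho(s) approaches 0 without reaching it, a nonzero polynomial does not vanish
    along it. *)
Lemma rhorner_neq0 (rho : K) : reval ^~ rho @ 0^' --> 0^' ->
  forall p : {poly C}, p != 0 -> rhorner p rho != 0.
Proof.
move=> rho0 p p0; apply/eqP => E.
have := reval_rhorner p rho; rewrite E => h.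
suff : \forall s \near (0:C)^', False by case/filter_ex.
apply: filterS3 reval0 h (rho0 _ (near_horner_neq0 p0)) => s -> /= E2.
by rewrite -E2 eqxx.
Qed.

Lemma reval_subst (rho : K) (phi : {rmorphism K -> K}) :
  (forall p, phi p%:K = rhorner p rho) ->
  forall r, \forall s \near 0^', reval s (phi r) = reval (reval s rho) r.
Proof.
move=> phiE r; have := reval_div (rhorner (rnum r) rho) (rhorner (rden r) rho).
have -> : rhorner (rnum r) rho / rhorner (rden r) rho = phi r.
  by rewrite [in RHS](rnumdenE r) fmorph_div /= !phiE.
apply: filter_app; have := reval_rhorner (rden r) rho.
by apply: filterS2 (reval_rhorner (rnum r) rho) => s -> -> ->.
Qed.

Lemma reval_delta (r : K) :
  \forall s \near 0^', is_derive (s : C) 1 (reval ^~ r) (reval s (delta r) / s).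
Proof.
have d0 := rden_neq0 r; set n := rnum r; set d := rden r in d0 *.
have := reval_frac ('X * (n^`() * d - n * d^`())) (expf_neq0 2 d0).
rewrite -/(delta r) => h.
have h0 : \forall s \near (0 : C)^', s != 0 by exact: nbhs_dnbhs_neq.
apply: filterS3 h h0 (near_horner_neq0 d0) => s -> s0 ds.
have Hn := is_derive_horner n s; have Hd := is_derive_horner d s.
have HV : is_derive s 1 (fun y => (d.[y])^-1) (- d.[s] ^- 2 *: d^`().[s]).
  apply: DeriveDef; first by apply: derivableV => //; case: Hd.
  by rewrite deriveV //; case: Hd => // ? ->.
have HM : is_derive s 1 (reval ^~ r) _ := is_deriveM Hn HV.
apply: is_derive_eq.
rewrite !(hornerM, hornerD, hornerN, hornerX, horner_exp) /GRing.scale /=.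
by field; rewrite s0 ds.
Qed.

End Germs.

(** * Ostrowski's theorem for additive cocycles *)

Section Ostrowski.
Variables (K : fieldType) (n : nat).
Variables (sigma : {rmorphism K -> K}) (beta : 'I_n -> K).

Local Notation "p @_ m" := (mcoeff m p) (at level 2).
Local Notation "m +% p" := (mnm_add m p) (at level 50).
Local Notation U i := (mnm1 i).
Local Notation mnm0 n := (@mnm0 n).

(** The action of the dilation on polynomial relations between germs h_i such that
    h_i(q s) = h_i(s) + beta_i(s): sigma acts on the coefficients, and the variables are
    translated by beta. *)
Definition twist : mpoly n K -> mpoly n K :=
  mmap (@mpolyC n K \o sigma) (fun i => mpolyX K (U i) + mpolyC n (beta i)).

Lemma mcoeffXM (i : 'I_n) (Q : mpoly n K) m :
  (mpolyX K (U i) * Q)@_m = if (0 < m i)%N then Q@_(mnm_sub m (U i)) else 0.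
Proof.
rewrite mulrC; case: ifPn => [mi|].
  have Em : m = mnm_add (U i) (mnm_sub m (U i)).
    by rewrite addmC submK // lep1mP -lt0n.
  by rewrite {1}Em mcoeffMX.
move=> mi; rewrite mcoeffMr big1 // => -[k l] /=.
move=> /eqP Ekl; rewrite mcoeffX; case: eqP => [El|]; last by rewrite mulr0.
by case/negP: mi; move/mnmP/(_ i): Ekl => ->; rewrite -El mnmDE mnm1E eqxx.
Qed.

Lemma mcoeff_twist_monomial v m : (mdeg v <= (mdeg m).+1)%N ->
  (twist (mpolyX K v))@_m =
    (m == v)%:R + \sum_j (m +% U j == v)%:R * (m j).+1%:R * beta j.
Proof.
have E0 : twist (mpolyX K (mnm0 n)) = 1.
  by rewrite /twist mpolyX0 mmap_is_multiplicative.
move: m; elim: {v}(mdeg v) {-2}v (erefl (mdeg v)) => [|k IH] v Ev m vm.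
  move/eqP: Ev; rewrite mdeg_eq0 => /eqP ->; rewrite E0 mcoeff1.
  rewrite big1 ?addr0 // => j _; case: eqP => [/(congr1 (fun u => mdeg u))|].
    by rewrite mdegD mdeg1 mdeg0 addn1.
  by rewrite !mul0r.
have [l vl] : exists l, (0 < v l)%N.
  apply/existsP; apply: contra_eqT Ev => /existsPn v0.
  rewrite mdegE big1 // => i _; apply/eqP; rewrite -leqn0 leqNgt; exact: v0.
pose w := mnm_sub v (U l).
have Evw : v = w +% U l by rewrite /w submK // lep1mP -lt0n.
have dw : mdeg w = k by move: Ev; rewrite Evw mdegD mdeg1 addn1 => -[].
have -> : twist (mpolyX K v) =
    (mpolyX K (U l) + mpolyC n (beta l)) * twist (mpolyX K w).
  rewrite Evw mpolyXD mulrC /twist (mmap_is_multiplicative _ _).1 mmapX.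
  by rewrite mmap1U.
rewrite mulrDl mcoeffD mcoeffXM mcoeffCM.
have dvm : (mdeg w <= mdeg m)%N by rewrite dw -ltnS -Ev.
rewrite (IH w dw m (leqW dvm)) [X in _ + _ * (_ + X)]big1 ?addr0; last first.
  move=> j _; case: eqP => [E|]; last by rewrite !mul0r.
  by move: dvm; rewrite -E mdegD mdeg1 addn1 ltnn.
case: ifPn => [ml|].
  pose m' := mnm_sub m (U l).
  have Em : m = m' +% U l by rewrite /m' submK // lep1mP -lt0n.
  have dm' : (mdeg w <= (mdeg m').+1)%N by rewrite -addn1 -(mdeg1 l) -mdegD -Em.
  rewrite -/m' (IH w dw m' dm') Evw {2}Em eqm_add2r -addrA; congr (_ + _).
  have -> : beta l * (m == w)%:R =
      \sum_j (m +% U j == w +% U l)%:R * (j == l)%:R * beta j.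
    rewrite (bigD1 l) //= big1 ?addr0; last first.
      by move=> j /negPf->; rewrite mulr0 mul0r.
    by rewrite eqm_add2r eqxx mulr1 mulrC.
  rewrite -big_split; apply: eq_bigr => j _ /=.
  have -> : (m +% U j == w +% U l) = (m' +% U j == w).
    by rewrite Em -addmA (addmC (U l)) addmA eqm_add2r.
  rewrite -mulrDl -mulrDr; congr (_ * _ * _).
  by rewrite Em mnmDE mnm1E eq_sym -natrD addSn.
move=> ml0.
rewrite Evw; have -> : (m == w +% U l) = false.
  by apply/negP => /eqP E; case/negP: ml0; rewrite E mnmDE mnm1E eqxx addn1.
rewrite (bigD1 l) //= big1 ?addr0; last first.
  move=> j jl; case: eqP => [/mnmP/(_ l)|]; last by rewrite !mul0r.
  rewrite !mnmDE !mnm1E eqxx (negPf jl) addn0 addn1 => E.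
  by case/negP: ml0; rewrite E.
rewrite eqm_add2r; move: ml0; rewrite -leqNgt leqn0 => /eqP ->.
by rewrite mulr1 mulrC !add0r.
Qed.

(** Up to one degree below the top, only the first-order Taylor terms of the
    translation by beta contribute. *)
Lemma mcoeff_twist P m : (msize P <= (mdeg m).+2)%N ->
  (twist P)@_m =
    sigma P@_m + \sum_j sigma P@_(m +% U j) * (m j).+1%:R * beta j.
Proof.
move=> szP.
have collapse u : \sum_(v <- msupp P) sigma P@_v * (u == v)%:R = sigma P@_u.
  have [uP|uP] := boolP (u \in msupp P).
    rewrite (bigD1_seq u) ?msupp_uniq //= eqxx mulr1 big1 ?addr0 // => v.
    by rewrite eq_sym => /negPf ->; rewrite mulr0.
  rewrite memN_msupp_eq0 // rmorph0 big_seq big1 // => v vP.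
  by case: eqP => [E|]; rewrite ?mulr0 //; case/negP: uP; rewrite E.
have -> : twist P = \sum_(v <- msupp P) (sigma P@_v) *: twist (mpolyX K v).
  rewrite [X in twist X]mpolyE /twist raddf_sum; apply: eq_bigr => v _ /=.
  by rewrite mmapZ /= mul_mpolyC.
rewrite raddf_sum /= (eq_big_seq (fun v => sigma P@_v * (m == v)%:R
   + \sum_j sigma P@_v * (m +% U j == v)%:R * (m j).+1%:R * beta j)); last first.
  move=> v vP; rewrite mcoeffZ mcoeff_twist_monomial; last first.
    by rewrite -ltnS (leq_trans _ szP) // msize_mdeg_lt.
  rewrite mulrDr mulr_sumr; congr (_ + _); apply: eq_bigr => j _.
  by rewrite !mulrA.
rewrite big_split collapse /=; congr (_ + _); rewrite exchange_big.
apply: eq_bigr => j _; rewrite -(collapse (m +% U j)) !mulr_suml.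
by apply: eq_bigr.
Qed.

(** The nonzero element of V with the least leading monomial, made monic, is fixed by
    the twist, because their difference has a smaller leading monomial.  Comparing
    the coefficients of total degree one less than the top yields the linear relation
    between the beta_i; the top coefficients, fixed by sigma, are its constants. *)
Theorem ostrowski (V : mpoly n K -> Prop) :
  (forall i, (i.+1)%:R != 0 :> K) ->
  ~ V 1 -> (forall P Q, V P -> V Q -> V (P - Q)) ->
  (forall c P, V P -> V (c *: P)) -> (forall P, V P -> V (twist P)) ->
  (exists2 P, P != 0 & V P) ->
  exists (c : 'I_n -> K) (h : K),
    [/\ exists i, c i != 0, forall i, sigma (c i) = c i &
        \sum_i c i * beta i = sigma h - h].
Proof.
move=> char0 V1 VB VZ Vtw [P0 P0nz VP0].
have [P [Pnz VP Pmin]] : exists P, [/\ P != 0, V P &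
    forall Q, (mlead Q < mlead P)%O -> V Q -> Q = 0].
  elim/mleadrect: P0 P0nz VP0 => P IH Pnz VP.
  have [[Q [QP Qnz VQ]]|noQ] := pselect (exists Q,
      [/\ (mlead Q < mlead P)%O, Q != 0 & V Q]); first exact: (IH Q).
  exists P; split=> // Q QP VQ; apply/eqP; apply: contra_notT noQ => Qnz.
  by exists Q.
pose lc := P@_(mlead P); pose v := mlead P.
have lcnz : lc != 0 by rewrite mleadc_eq0.
pose S := lc^-1 *: P.
have Sv : S@_v = 1 by rewrite mcoeffZ mulVf.
have lcVnz : lc^-1 != 0 by rewrite invr_eq0.
have leadS : mlead S = v by rewrite mleadZ_proper // mulf_neq0.
have VS : V S by exact: VZ.
have Snz : S != 0 by rewrite -mleadc_eq0 leadS Sv oner_eq0.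
have szS : msize S = (mdeg v).+1 by rewrite -leadS mlead_deg.
(* In top degree the twist is just sigma, applied coefficientwise. *)
have top u : (mdeg v <= mdeg u)%N -> (twist S)@_u = sigma S@_u.
  move=> vu; rewrite mcoeff_twist ?szS ?ltnS ?(leqW vu) // big1 ?addr0 // => j _.
  rewrite memN_msupp_eq0 ?rmorph0 ?mul0r //; apply/negP => /msize_mdeg_lt.
  by rewrite szS mdegD mdeg1 addn1 !ltnS leqNgt ltnS vu.
have twS : twist S = S.
  apply/eqP; rewrite -subr_eq0; apply/eqP/Pmin; last by apply: VB => //; exact: Vtw.
  have [->|Dnz] := eqVneq (twist S - S) 0.
    rewrite mlead0 lt_def le0x andbT; apply/eqP => v0; apply: V1.
    suff -> : 1 = S by [].
    have : (msize S <= 1)%N by rewrite szS /v v0 mdeg0.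
    by move/msize1_polyC => ->; rewrite -v0 -/v Sv.
  rewrite ltNge; apply/negP => vle; have := mlead_supp Dnz.
  rewrite mcoeff_msupp mcoeffB top ?lemc_mdeg //.
  move: vle; rewrite le_eqVlt => /orP[/eqP<-|vlt]; first by rewrite Sv rmorph1 subrr eqxx.
  by rewrite (@mcoeff_gt_mlead _ _ S) ?leadS // rmorph0 subrr eqxx.
have [i vi] : exists i, (0 < v i)%N.
  apply/existsP; apply: contra_notT V1 => /existsPn v0.
  have Ev : v = mnm0 n.
    by apply/mnmP => i; rewrite mnm0E; apply/eqP; rewrite -leqn0 leqNgt; exact: v0.
  suff -> : 1 = S by exact: VS.
  have : (msize S <= 1)%N by rewrite szS Ev mdeg0.
  by move/msize1_polyC => ->; rewrite -Ev Sv.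
(* The coefficient at M is the one in which the translation of Y_i is visible. *)
pose M := mnm_sub v (U i).
have Ev : v = M +% U i by rewrite /M submK // lep1mP -lt0n.
have dv j : mdeg (M +% U j) = mdeg v by rewrite Ev !mdegD !mdeg1.
exists (fun j => S@_(M +% U j) * (M j).+1%:R), (- S@_M); split.
- by exists i; rewrite -Ev Sv mul1r.
- by move=> j; rewrite rmorphM rmorph_nat -top ?dv // twS.
- have := @mcoeff_twist S M; rewrite szS Ev mdegD mdeg1 addn1 => /(_ (leqnn _)).
  rewrite twS => E; rewrite rmorphN opprK addrC.
  apply/eqP; rewrite eq_sym subr_eq addrC; apply/eqP; rewrite {1}E.
  congr (_ + _); apply: eq_bigr => j _; congr (_ * _ * _).
  by rewrite -top ?dv // twS.
Qed.

End Ostrowski.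

(** * Poles and the dilation s -> q s *)

Fact delta_pole_ring1 (R : comRingType) (x y z b b' : R) :
  (y * z * b + x * y * b') * x = x * y * (b * z + b' * x).
Proof. ring. Qed.

Fact delta_pole_ring2 (R : comRingType) (s x y a b B a' B' : R) :
  s * (a' * B - a * B') * (x * y * b ^+ 2) =
  y * b ^+ 2 * (s * (a' * B * x - a * (B' * x))).
Proof. ring. Qed.

Fact delta_pole_ring3 (R : comRingType) (s x y a b a' e : R) :
  y * b ^+ 2 * (s * (a' * (y * b) * x - a * (y * e))) =
  s * (a' * b * x - a * e) * (y * b) ^+ 2.
Proof. ring. Qed.

Section Poles.
Variables (C : numFieldType) (K : ratField C).
Local Notation "p %:K" := (@rpoly C K p) (at level 1, format "p %:K").

(** Orders of poles are expressed by clearing denominators, so that no expansion at c is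
    needed. *)
Definition pole_le (n : nat) (c : C) (r : K) : Prop :=
  exists a b : {poly C}, b.[c] != 0 /\
    r * (('X - c%:P) ^+ n)%:K * b%:K = a%:K.

Definition pole_eq (n : nat) (c : C) (r : K) : Prop :=
  exists a b : {poly C}, [/\ a.[c] != 0, b.[c] != 0 &
    r * (('X - c%:P) ^+ n)%:K * b%:K = a%:K].

Lemma pole_eq_le n c r : pole_eq n c r -> pole_le n c r.
Proof. by move=> [a [b [_ b0 E]]]; exists a, b. Qed.

Lemma pole_leD n c r s : pole_le n c r -> pole_le n c s -> pole_le n c (r + s).
Proof.
move=> [a [b [b0 E]]] [a' [b' [b0' E']]]; exists (a * b' + a' * b), (b * b').
split; first by rewrite hornerM mulf_neq0.
by rewrite rmorphD !rmorphM /= -E -E'; ring.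
Qed.

Lemma pole_leZ n c x r : pole_le n c r -> pole_le n c (rcst x * r).
Proof.
move=> [a [b [b0 E]]]; exists (x%:P * a), b; split=> //.
by rewrite rmorphM -E !mulrA.
Qed.

Lemma pole_leN n c r : pole_le n c r -> pole_le n c (- r).
Proof. by move/(pole_leZ (-1)); rewrite rmorphN1 mulN1r. Qed.

Lemma pole_le0 n c : pole_le n c 0.
Proof. by exists 0, 1; rewrite hornerC oner_neq0 !mul0r rmorph0. Qed.

Lemma pole_le_sum n c (I : finType) (P : pred I) (F : I -> K) :
  (forall i, P i -> pole_le n c (F i)) -> pole_le n c (\sum_(i | P i) F i).
Proof.
by move=> h; elim/big_ind: _ => //; [exact: pole_le0|exact: pole_leD].
Qed.

Lemma pole_leW n m c r : (n <= m)%N -> pole_le n c r -> pole_le m c r.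
Proof.
move=> /subnK <- [a [b [b0 E]]]; exists (('X - c%:P) ^+ (m - n) * a), b.
by split=> //; rewrite exprD !rmorphM -E /=; ring.
Qed.

Lemma pole_eq_gt n c r : pole_eq n.+1 c r -> ~ pole_le n c r.
Proof.
move=> [a [b [a0 b0 E]]] [a' [b' [b0' E']]].
have : a * b' = a' * b * ('X - c%:P).
  apply/eqP; rewrite -subr_eq0 -(rpoly_eq0 K) rmorphB !rmorphM -E -E' exprS.
  by rewrite rmorphM subr_eq0; apply/eqP => /=; ring.
move=> /(congr1 (horner ^~ c)); rewrite !hornerM hornerXsubC subrr mulr0.
by move/eqP; rewrite mulf_eq0 (negPf a0) (negPf b0').
Qed.

Lemma pole_le_frac n c (a b : {poly C}) : b.[c] != 0 ->
  pole_le n c (a%:K / (('X - c%:P) ^+ n * b)%:K).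
Proof.
move=> b0; exists a, b; split=> //.
rewrite -mulrA -rmorphM divfK // rpoly_eq0 mulf_neq0 //.
  by rewrite expf_neq0 // polyXsubC_eq0.
by apply: contra_neq b0 => ->; rewrite horner0.
Qed.

Lemma pole_eq_frac n c (a b : {poly C}) : a.[c] != 0 -> b.[c] != 0 ->
  pole_eq n c (a%:K / (('X - c%:P) ^+ n * b)%:K).
Proof.
move=> a0 b0; exists a, b; split=> //.
rewrite -mulrA -rmorphM divfK // rpoly_eq0 mulf_neq0 //.
  by rewrite expf_neq0 // polyXsubC_eq0.
by apply: contra_neq b0 => ->; rewrite horner0.
Qed.

Lemma horner_neq0_poly (b : {poly C}) c : b.[c] != 0 -> b != 0.
Proof. by apply: contra_neq => ->; rewrite horner0. Qed.

(** The powers of s - c in the quotient rule cancel up to one, so that the order of the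
    pole grows by one instead of doubling. *)
Lemma delta_pole n c r (a b : {poly C}) : b != 0 ->
  r * (('X - c%:P) ^+ n)%:K * b%:K = a%:K ->
  delta r * (('X - c%:P) ^+ n.+1)%:K * (b ^+ 2)%:K =
  ('X * (a^`() * b * ('X - c%:P) - a * (b *+ n + b^`() * ('X - c%:P))))%:K.
Proof.
move=> b0; set X := 'X - c%:P => E.
have X0 : X != 0 by rewrite polyXsubC_eq0.
have B0 : X ^+ n * b != 0 by rewrite mulf_neq0 // expf_neq0.
have -> : r = a%:K / (X ^+ n * b)%:K.
  apply: (canRL (mulfK _)); first by rewrite rpoly_eq0.
  by rewrite rmorphM mulrA E.
rewrite deltaE //; set B := X ^+ n * b.
have B20 : (B ^+ 2)%:K != 0 by rewrite rpoly_eq0 expf_neq0.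
apply: (mulIf B20); rewrite -[_ * (b ^+ 2)%:K]mulrA -rmorphM mulrAC divfK //.
rewrite -!rmorphM; congr (rpoly _).
have dB : B^`() * X = X ^+ n * (b *+ n + b^`() * X).
  rewrite /B derivM deriv_exp derivXsubC mul1r.
  case: (n) => [|m]; first by rewrite expr0 mulr0n mul0r add0r !mulr0n; ring.
  by rewrite succnK exprS -(mulr_natr (X ^+ m)) -(mulr_natr b); exact: delta_pole_ring1.
have -> : 'X * (a^`() * B - a * B^`()) * (X ^+ n.+1 * b ^+ 2) =
   X ^+ n * b ^+ 2 * ('X * (a^`() * B * X - a * (B^`() * X))).
  by rewrite exprS; exact: delta_pole_ring2.
by rewrite dB /B; exact: delta_pole_ring3.
Qed.

Lemma pole_le_delta n c r : pole_le n c r -> pole_le n.+1 c (delta r).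
Proof.
move=> [a [b [b0 E]]]; have := delta_pole (horner_neq0_poly b0) E.
set A := (X in _ = X%:K) => E'; exists A, (b ^+ 2); split=> //.
by rewrite horner_exp expf_neq0.
Qed.

(** In characteristic 0 and away from the origin the derivation raises the order of a
    pole by exactly one: the leading term gets multiplied by - n c. *)
Lemma pole_eq_delta n c r : c != 0 ->
  pole_eq n.+1 c r -> pole_eq n.+2 c (delta r).
Proof.
move=> c0 [a [b [a0 b0 E]]]; have := delta_pole (horner_neq0_poly b0) E.
set A := (X in _ = X%:K) => E'; exists A, (b ^+ 2); split=> //; last first.
  by rewrite horner_exp expf_neq0.
rewrite /A !(hornerE, hornerMn) subrr !mulr0 addr0 sub0r.
by rewrite mulf_neq0 // oppr_eq0 mulf_neq0 // mulrn_eq0 negb_or.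
Qed.

Lemma pole_le_iter_delta n c r i :
  pole_le n c r -> pole_le (n + i) c (iter i delta r).
Proof. by move=> h; elim: i => [|i IH]; rewrite ?addn0 ?addnS //=; exact: pole_le_delta. Qed.

Lemma pole_eq_iter_delta n c r i : c != 0 ->
  pole_eq n.+1 c r -> pole_eq (n.+1 + i) c (iter i delta r).
Proof.
move=> c0 h; elim: i => [|i IH]; rewrite ?addn0 ?addnS //=.
by apply: pole_eq_delta => //; rewrite -addSn.
Qed.

Section Dilation.
Variables (q : C) (sigma : {rmorphism K -> K}).
Hypothesis q_torsionfree : forall n : nat, q ^+ n.+1 != 1.
Hypothesis q_neq0 : q != 0.
Hypothesis sigmaE : forall p, sigma p%:K = (p \Po (q *: 'X))%:K.

Lemma q_inj : injective (fun n : nat => q ^+ n).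
Proof.
have aux m n : (m < n)%N -> q ^+ m != q ^+ n.
  move=> mn; rewrite -(subnK mn) addnS -addSn exprD.
  rewrite -[X in X != _]mul1r (inj_eq (mulIf _)) ?expf_neq0 //.
  by rewrite eq_sym q_torsionfree.
by move=> m n E; case: (ltngtP m n) => // /aux; rewrite E eqxx.
Qed.

Lemma comp_dilate_inj : injective (fun p : {poly C} => p \Po (q *: 'X)).
Proof.
move=> p p' E; have := congr1 (fun u => u \Po (q^-1 *: 'X)) E.
rewrite -!comp_polyA comp_polyZ comp_polyX scalerA mulfV // scale1r.
by rewrite !comp_polyXr.
Qed.

(** If n/d is invariant, the leading coefficients give q^(deg n) = q^(deg d). *)
Lemma size_dilation_invariant (n d : {poly C}) : n != 0 -> d != 0 ->
  (n \Po (q *: 'X)) * d = n * (d \Po (q *: 'X)) -> size n = size d.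
Proof.
have lc (p : {poly C}) : lead_coef (p \Po (q *: 'X)) = lead_coef p * q ^+ (size p).-1.
  by rewrite lead_coef_comp ?size_scale ?size_polyX // lead_coefZ lead_coefX mulr1.
move=> n0 d0 /(congr1 lead_coef); rewrite !lead_coefM !lc -mulrA.
move/(mulfI (_ : lead_coef n != 0)); rewrite lead_coef_eq0 => /(_ n0).
rewrite mulrC => /(mulfI (_ : lead_coef d != 0)); rewrite lead_coef_eq0 => /(_ d0).
move/q_inj => E; have := prednK (_ : 0 < size n)%N; rewrite size_poly_gt0 => /(_ n0) <-.
by rewrite E prednK // size_poly_gt0.
Qed.

(** With x the quotient of the leading coefficients of r = n/d, the function
    r - x = (n - x d)/d is invariant too, but its numerator has a lower degree than
    its denominator. *)
Lemma dilation_invariant_cst r : sigma r = r -> exists x, r = rcst x.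
Proof.
move=> Er; have := rden_neq0 r; have := rnumdenE r.
move: (rnum r) (rden r) => n d E d0.
have [n0|n0] := eqVneq n 0; first by exists 0; rewrite E n0 !rmorph0 mul0r.
have Dd0 (p : {poly C}) : p != 0 -> p \Po (q *: 'X) != 0.
  by apply: contra_neq => Ep; apply: comp_dilate_inj; rewrite Ep comp_poly0.
have inv (m : {poly C}) : sigma (m%:K / d%:K) = m%:K / d%:K ->
    (m \Po (q *: 'X)) * d = m * (d \Po (q *: 'X)).
  by rewrite fmorph_div /= !sigmaE => /(eq_rat (Dd0 _ d0) d0).
have szn : size n = size d by apply: size_dilation_invariant; rewrite ?inv // -E.
exists (lead_coef n / lead_coef d); set x := (X in rcst X).
have Ex : n%:K / d%:K - rcst x = (n - x *: d)%:K / d%:K.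
  rewrite rmorphB mulrBl; congr (_ - _); rewrite -mul_polyC [in RHS]rmorphM mulfK //.
  by rewrite rpoly_eq0.
have sx : sigma (rcst x) = rcst x by rewrite /rcst sigmaE comp_polyC.
have [/eqP m0|m0] := eqVneq (n - x *: d) 0.
  apply/eqP; rewrite -subr_eq0 E Ex.
  by move/eqP: m0 => ->; rewrite rmorph0 mul0r.
have : size (n - x *: d) = size d.
  by apply: size_dilation_invariant; rewrite ?inv // -Ex rmorphB sx -E Er.
have dgt : (0 < size d)%N by rewrite size_poly_gt0.
set w := n - x *: d; suff : (size w < size d)%N by move=> + Es; rewrite Es ltnn.
rewrite -(prednK dgt) ltnS; apply/leq_sizeP => j; rewrite leq_eqVlt => /orP[/eqP<-|].
  have -> : w`_(size d).-1 = lead_coef n - x * lead_coef d.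
    by rewrite coefB coefZ /lead_coef szn.
  by rewrite /x divfK ?subrr // lead_coef_eq0.
rewrite prednK // => sj; rewrite coefB coefZ !nth_default ?szn //.
by rewrite mulr0 subrr.
Qed.

Lemma comp_dilate_XsubC c (p : {poly C}) : (('X - (q * c)%:P) \Po (q *: 'X)) = q *: ('X - c%:P).
Proof. by rewrite comp_polyB comp_polyX comp_polyC scalerBr -!mul_polyC -polyCM. Qed.

Lemma pole_le_dilate n c h : pole_le n (q * c) h -> pole_le n c (sigma h).
Proof.
move=> [a [b [b0 /(congr1 sigma)]]]; rewrite !(rmorphM sigma) /= !sigmaE rmorphXn /=.
rewrite comp_dilate_XsubC // => E.
exists (a \Po (q *: 'X)), (q ^+ n *: (b \Po (q *: 'X))); split.
  by rewrite hornerZ horner_comp !hornerE mulf_neq0 // expf_neq0.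
by rewrite -E exprZn -!mul_polyC !rmorphM /=; ring.
Qed.

Lemma pole_le_undilate n c h : pole_le n c (sigma h) -> pole_le n (q * c) h.
Proof.
move=> [a [b [b0]]]; rewrite {1}(rnumdenE h) fmorph_div /= !sigmaE => E.
have := rden_neq0 h; set N := rnum h in E *; set D := rden h in E * => D0.
have DD0 : D \Po (q *: 'X) != 0.
  by apply: contra_neq D0 => Ep; apply: comp_dilate_inj; rewrite Ep comp_poly0.
have E1 : (N \Po (q *: 'X)) * ('X - c%:P) ^+ n * b = a * (D \Po (q *: 'X)).
  apply/eqP; rewrite -subr_eq0 -(rpoly_eq0 K) rmorphB !rmorphM -E subr_eq0.
  apply/eqP => /=; field; by rewrite rpoly_eq0.
have Xc : ('X - c%:P) \Po (q^-1 *: 'X) = q^-1 *: ('X - (q * c)%:P).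
  by rewrite comp_polyB comp_polyX comp_polyC scalerBr -!mul_polyC -polyCM mulKf.
have := congr1 (fun u => u \Po (q^-1 *: 'X)) E1.
rewrite !comp_polyM -!comp_polyA comp_polyZ comp_polyX scalerA mulfV // scale1r.
rewrite !comp_polyXr rmorphXn /= Xc => E2.
exists (a \Po (q^-1 *: 'X)), ((q^-1) ^+ n *: (b \Po (q^-1 *: 'X))); split.
  rewrite hornerZ horner_comp hornerZ hornerX mulKf //.
  by rewrite mulf_neq0 // expf_neq0 // invr_eq0.
rewrite (rnumdenE h) -/N -/D; have DK0 : D%:K != 0 by rewrite rpoly_eq0.
move: E2; rewrite exprZn; move: (a \Po _) (b \Po _) (_ ^+ n) (_ ^+ n) => a' b' x w.
rewrite -!mul_polyC => /(congr1 (@rpoly C K)); rewrite !rmorphM /= => E2.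
by apply: (mulIf DK0); rewrite -E2; field.
Qed.

(** The function h has finitely many poles, hence order at most T somewhere on both ends
    of the orbit of p.  The bound propagates along the orbit through h(q s) = h(s) + L(s),
    from one end down to q p and from the other up to p, because L has order at most T
    there; then it holds for L at p as well. *)
Lemma not_telescoper T p (h L : K) : p != 0 ->
  (forall k : nat, pole_le T (q ^+ k.+1 * p) L) ->
  (forall k : nat, pole_le T (q ^- k.+1 * p) L) ->
  ~ pole_le T p L -> L = sigma h - h -> False.
Proof.
move=> p0 Lpos Lneg Lp EL.
have regular c : (rden h).[c] != 0 -> pole_le T c h.
  move=> d0; apply: (@pole_leW 0) => //; exists (rnum h), (rden h); split=> //.
  rewrite expr0 rmorph1 mulr1 {1}(rnumdenE h) divfK // rpoly_eq0.
  exact: horner_neq0_poly d0.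
have finite (f : nat -> C) : injective f -> exists k, pole_le T (f k) h.
  move=> finj; apply: contrapT => nh.
  have rootf k : root (rden h) (f k).
    by apply/negPn/negP => /regular hk; apply: nh; exists k.
  have := max_poly_roots (rden_neq0 h) (_ : all (root (rden h)) (map f (iota 0 (size (rden h))))).
  rewrite size_map size_iota ltnn map_inj_uniq // iota_uniq => H.
  have : false; last by []. apply: H => //.
  by apply/allP => _ /mapP[k _ ->].
have [k hk] : exists k, pole_le T (q ^+ k.+1 * p) h.
  by apply: finite => i j /(mulIf p0) /q_inj [].
have [l hl] : exists l, pole_le T (q ^- l * p) h.
  by apply: finite => i j /(mulIf p0) /invr_inj /q_inj.
have h1 : pole_le T (q * p) h.
  elim: k hk => [|k IH]; rewrite ?expr1 // => hk; apply: IH.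
  have -> : h = sigma h - L by rewrite EL opprB addrC subrK.
  apply: pole_leD; last exact/pole_leN/Lpos.
  by apply: pole_le_dilate; rewrite mulrA -exprS.
have h0 : pole_le T p h.
  elim: l hl => [|l IH]; rewrite ?expr0 ?invr1 ?mul1r // => hl; apply: IH.
  have -> : q ^- l * p = q * (q ^- l.+1 * p).
    by rewrite exprS invfM !mulrA mulfV // mul1r.
  apply: pole_le_undilate.
  have -> : sigma h = L + h by rewrite EL subrK.
  by apply: pole_leD.
apply: Lp; rewrite EL; apply: pole_leD; last exact: pole_leN.
exact: pole_le_dilate.
Qed.

(** With N the largest index such that c_N != 0, the sum has a pole of order M + 1 + N at
    p, and of order at most M + N at the other points of the orbit. *)
Lemma no_linear_telescoper m M p (b h : K) (c : 'I_m -> K) : p != 0 ->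
  pole_eq M.+1 p b ->
  (forall k : nat, pole_le M (q ^+ k.+1 * p) b) ->
  (forall k : nat, pole_le M (q ^- k.+1 * p) b) ->
  (exists i, c i != 0) -> (forall i, sigma (c i) = c i) ->
  \sum_i c i * iter i delta b = sigma h - h -> False.
Proof.
move=> p0 bp bpos bneg [i0 ci0] csig.
have /choice[x Ex] : forall i, exists y : C, c i = rcst y.
  by move=> i; exact: dilation_invariant_cst.
pose N := [arg max_(i > i0 | x i != 0) val i].
have xi0 : x i0 != 0 by apply: contra_neq ci0 => E; rewrite Ex E rmorph0.
rewrite (eq_bigr (fun i => rcst (x i) * iter i delta b)); last by move=> i _; rewrite Ex.
have [xN Nmax] : x N != 0 /\ forall i : 'I_m, x i != 0 -> (i <= N)%N.
  by rewrite /N; case: arg_maxnP.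
have le_sum y : pole_le M y b -> pole_le (M + N) y (\sum_i rcst (x i) * iter i delta b).
  move=> by_; apply: pole_le_sum => i _.
  have [->|xi] := eqVneq (x i) 0; first by rewrite rmorph0 mul0r; exact: pole_le0.
  apply/pole_leZ/(@pole_leW (M + i)); first by rewrite leq_add2l Nmax.
  exact: pole_le_iter_delta.
apply: (@not_telescoper (M + N) p) => //.
- by move=> k; exact: le_sum.
- by move=> k; exact: le_sum.
rewrite (bigD1 N) //= => hsum.
have : pole_le (M + N) p (rcst (x N) * iter N delta b).
  rewrite -[X in pole_le _ _ X](addrK (\sum_(i | i != N) rcst (x i) * iter i delta b)).
  apply: pole_leD => //; apply/pole_leN/pole_le_sum => i iN.
  have [->|xi] := eqVneq (x i) 0; first by rewrite rmorph0 mul0r; exact: pole_le0.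
  apply/pole_leZ/(@pole_leW (M.+1 + i)).
    by rewrite addSn -addnS leq_add2l ltn_neqAle Nmax // andbT -val_eqE in iN *.
  exact/pole_le_iter_delta/pole_eq_le.
move/(pole_leZ (x N)^-1); rewrite mulrA -rmorphM mulVf // rmorph1 mul1r.
by apply: pole_eq_gt; rewrite -addSn; exact: pole_eq_iter_delta.
Qed.

End Dilation.
End Poles.

(** * Germs satisfying polynomial relations *)

Section GermEvaluation.
Variables (C : numFieldType) (K : ratField C).
Local Notation "p @_ m" := (mcoeff m p) (at level 2).
Local Notation U i := (mnm1 i).

Lemma near_all_seq (T : eqType) (X : Type) (F : set_system X) {FF : Filter F}
    (l : seq T) (P : T -> X -> Prop) :
  (forall x, \forall s \near F, P x s) ->
  \forall s \near F, forall x, x \in l -> P x s.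
Proof.
move=> h; elim: l => [|x l IH]; first by apply: filterE => s y; rewrite in_nil.
apply: filterS2 (h x) IH => s Px Pl y; rewrite inE => /orP[/eqP->//|].
exact: Pl.
Qed.

Definition peval n (h : 'I_n -> C -> C) (P : mpoly n K) (s : C) : C :=
  mmap (reval s) (fun i => h i s) P.

Section Fixed.
Variables (n : nat) (h : 'I_n -> C -> C).

Let mon (m : multinom n) (s : C) := mmap1 (fun i => h i s) m.

(** Sums over a fixed list of monomials make supports comparable. *)
Lemma peval_wide (l : seq (multinom n)) P : uniq l -> {subset msupp P <= l} ->
  \forall s \near 0^', peval h P s = \sum_(m <- l) reval s P@_m * mon m s.
Proof.
move=> ul sub; apply: filterS (reval0 K) => s E0; rewrite /peval /mmap.
rewrite [RHS](bigID (mem (msupp P))) /= [X in _ + X]big1 ?addr0; last first.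
  by move=> m; rewrite mcoeff_msupp negbK => /eqP ->; rewrite E0 mul0r.
rewrite -[RHS]big_filter; apply: perm_big; apply: uniq_perm.
- exact: msupp_uniq.
- exact: filter_uniq.
- by move=> m; rewrite mem_filter andb_idr //; exact: sub.
Qed.

Lemma pevalD P Q : \forall s \near 0^', peval h (P + Q) s = peval h P s + peval h Q s.
Proof.
pose l := undup (msupp (P + Q) ++ msupp P ++ msupp Q).
have ul : uniq l by exact: undup_uniq.
have w1 := @peval_wide l (P + Q) ul; have w2 := @peval_wide l P ul.
have w3 := @peval_wide l Q ul.
have : \forall s \near 0^', forall m, m \in l ->
    reval s (P + Q)@_m = reval s P@_m + reval s Q@_m.
  by apply: near_all_seq => m; rewrite mcoeffD; exact: revalD.
apply: filter_app; apply: filterS3 (w1 _) (w2 _) (w3 _).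
- move=> s -> -> -> El; rewrite -big_split /=; apply: eq_big_seq => m ml.
  by rewrite El // mulrDl.
- by move=> m; rewrite mem_undup !mem_cat => ->; rewrite ?orbT.
- by move=> m; rewrite mem_undup !mem_cat => ->; rewrite ?orbT.
- by move=> m; rewrite mem_undup !mem_cat => ->; rewrite ?orbT.
Qed.

Lemma pevalMX c m : \forall s \near 0^',
  peval h (c *: mpolyX K m) s = reval s c * mon m s.
Proof.
have := @peval_wide [:: m] (c *: mpolyX K m) isT.
have H : {subset msupp (c *: mpolyX K m) <= [:: m]}.
  by move=> k /msuppZ_le; rewrite msuppX.
move/(_ H); apply: filterS => s ->.
by rewrite big_seq1 mcoeffZ mcoeffX eqxx mulr1.
Qed.

Lemma peval0 : \forall s \near 0^', peval h 0 s = 0.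
Proof. by apply: filterE => s; rewrite /peval /mmap msupp0 big_nil. Qed.

Lemma peval_sum (I : Type) (l : seq I) (F : I -> mpoly n K) :
  \forall s \near 0^', peval h (\sum_(i <- l) F i) s = \sum_(i <- l) peval h (F i) s.
Proof.
elim: l => [|i l IH]; first by apply: filterS peval0 => s E; rewrite !big_nil.
rewrite big_cons; apply: filterS2 (pevalD (F i) (\sum_(j <- l) F j)) IH => s -> ->.
by rewrite big_cons.
Qed.

Lemma pevalM P Q : \forall s \near 0^', peval h (P * Q) s = peval h P s * peval h Q s.
Proof.
have -> : P * Q = \sum_(m <- [seq (u, v) | u <- msupp P, v <- msupp Q])
    (P@_m.1 * Q@_m.2) *: mpolyX K (mnm_add m.1 m.2).
  rewrite big_allpairs_dep /= {1}[P]mpolyE {1}[Q]mpolyE big_distrlr /=.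
  apply: eq_bigr => u _; apply: eq_bigr => v _.
  by rewrite -scalerAl -scalerAr scalerA -mpolyXD.
set l := [seq _ | u <- _, v <- _].
pose F (m : multinom n * multinom n) :=
  (P@_m.1 * Q@_m.2) *: mpolyX K (mnm_add m.1 m.2).
have : \forall s \near 0^', forall m, m \in l -> peval h (F m) s =
    reval s P@_m.1 * reval s Q@_m.2 * mon (mnm_add m.1 m.2) s.
  apply: near_all_seq => m; have := pevalMX (P@_m.1 * Q@_m.2) (mnm_add m.1 m.2).
  by apply: filterS2 (revalM P@_m.1 Q@_m.2) => s <-.
apply: filterS2 (peval_sum l F) => s -> El.
rewrite (eq_big_seq _ El) big_allpairs_dep /= /peval /mmap big_distrlr /=.
apply: eq_bigr => u _; apply: eq_bigr => v _.
rewrite /mon commr_mmap1_M; last by move=> i x; exact: mulrC.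
by rewrite mulrACA.
Qed.

Lemma pevalC c : \forall s \near 0^', peval h (mpolyC n c) s = reval s c.
Proof.
have := pevalMX c mnm0; apply: filterS => s; rewrite mpolyX0 alg_mpolyC => ->.
by rewrite /mon mmap11 mulr1.
Qed.

Lemma pevalX i : \forall s \near 0^', peval h (mpolyX K (U i)) s = h i s.
Proof.
have := pevalMX 1 (U i); apply: filterS2 (reval1 K) => s E1; rewrite scale1r => ->.
by rewrite /mon mmap1U E1 mul1r.
Qed.

Lemma pevalZ c P : \forall s \near 0^', peval h (c *: P) s = reval s c * peval h P s.
Proof.
rewrite -mul_mpolyC; apply: filterS2 (pevalM (mpolyC n c) P) (pevalC c).
by move=> s -> ->.
Qed.

Lemma peval1 : \forall s \near 0^', peval h 1 s = 1.
Proof. by have := pevalC 1; apply: filterS2 (reval1 K) => s ->. Qed.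

Lemma pevalB P Q : \forall s \near 0^', peval h (P - Q) s = peval h P s - peval h Q s.
Proof.
apply: filterS (pevalD (P - Q) Q) => s.
by rewrite subrK => ->; rewrite addrK.
Qed.

Lemma pevalXn P k : \forall s \near 0^', peval h (P ^+ k) s = peval h P s ^+ k.
Proof.
elim: k => [|k IH]; first by apply: filterS peval1 => s E; rewrite !expr0.
by rewrite exprS; apply: filterS2 (pevalM P (P ^+ k)) IH => s -> ->; rewrite exprS.
Qed.

Lemma peval_prod (I : Type) (l : seq I) (F : I -> mpoly n K) :
  \forall s \near 0^', peval h (\prod_(i <- l) F i) s = \prod_(i <- l) peval h (F i) s.
Proof.
elim: l => [|i l IH]; first by apply: filterS peval1 => s E; rewrite !big_nil.
rewrite big_cons; apply: filterS2 (pevalM (F i) (\prod_(j <- l) F j)) IH => s -> ->.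
by rewrite big_cons.
Qed.

End Fixed.

(** It serves both for the twist, e being the dilation, and for a change of variable,
    e being composition with rho. *)
Lemma peval_subst n k (sigma : {rmorphism K -> K}) (e : C -> C)
    (L : 'I_n -> mpoly k K) (h : 'I_k -> C -> C) (P : mpoly n K) :
  (forall r, \forall s \near 0^', reval s (sigma r) = reval (e s) r) ->
  \forall s \near 0^', peval h (mmap (@mpolyC k K \o sigma) L P) s =
    mmap (reval (e s)) (fun i => peval h (L i) s) P.
Proof.
move=> sE; rewrite {1}/mmap.
pose F m := (@mpolyC k K \o sigma) P@_m * mmap1 L m.
have : \forall s \near 0^', forall m, m \in msupp P -> peval h (F m) s =
    reval (e s) P@_m * mmap1 (fun i => peval h (L i) s) m.
  apply: near_all_seq => m; have := pevalM h (mpolyC k (sigma P@_m)) (mmap1 L m).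
  apply: filter_app; have := peval_prod h (enum 'I_n) (fun i => L i ^+ m i).
  apply: filter_app; apply: filter_app (pevalC h (sigma P@_m)).
  have : \forall s \near 0^', forall i, i \in enum 'I_n ->
      peval h (L i ^+ m i) s = peval h (L i) s ^+ m i.
    by apply: near_all_seq => i; exact: pevalXn.
  apply: filterS2 (sE P@_m) => s Es EX EC EP EM.
  rewrite EM EC Es; congr (_ * _); rewrite /mmap1 -big_enum /= EP.
  rewrite -[RHS]big_enum /=; apply: eq_big_seq => i; exact: EX.
apply: filterS2 (peval_sum h (msupp P) F) => s -> El.
by rewrite /mmap; exact: eq_big_seq.
Qed.

End GermEvaluation.

Section Dilation.
Variables (C : numFieldType) (K : ratField C) (q : C).
Local Notation "p %:K" := (@rpoly C K p) (at level 1, format "p %:K").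
Hypothesis q_neq0 : q != 0.

Lemma dilation_exists : exists sigma : {rmorphism K -> K},
  forall p, sigma p%:K = (p \Po (q *: 'X))%:K.
Proof.
have E p : rhorner p (rcst q * rX) = (p \Po (q *: 'X))%:K.
  rewrite /rhorner; elim/poly_ind: p => [|p c IH].
    by rewrite map_poly0 horner0 comp_poly0 rmorph0.
  rewrite rmorphD rmorphM /= map_polyX map_polyC /= hornerMXaddC IH.
  rewrite comp_polyD comp_polyM comp_polyX comp_polyC -mul_polyC.
  by rewrite !(rmorphD (@rpoly C K)) !(rmorphM (@rpoly C K)).
have [|phi phiE] := @rat_subst C K (rcst q * rX); last first.
  by exists phi => p; rewrite phiE E.
move=> p; apply: contra_neq; rewrite E => /eqP; rewrite rpoly_eq0 => /eqP Ep.
by apply: (comp_dilate_inj q_neq0); rewrite Ep comp_poly0.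
Qed.

Lemma reval_dilation (sigma : {rmorphism K -> K}) :
  (forall p, sigma p%:K = (p \Po (q *: 'X))%:K) ->
  forall r, \forall s \near 0^', reval s (sigma r) = reval (q * s) r.
Proof.
move=> sE r.
have := reval_div (rnum r \Po (q *: 'X))%:K (rden r \Po (q *: 'X))%:K.
have <- : sigma r = (rnum r \Po (q *: 'X))%:K / (rden r \Po (q *: 'X))%:K.
  by rewrite {1}(rnumdenE r) fmorph_div /= !sE.
apply: filter_app; apply: filterS2 (reval_poly K (rnum r \Po (q *: 'X)))
  (reval_poly K (rden r \Po (q *: 'X))) => s -> -> ->.
by rewrite !horner_comp !hornerZ !hornerX.
Qed.

End Dilation.

Section PuncturedNeighbourhoods.
Variable C : numFieldType.

Lemma dnbhs0P (P : C -> Prop) : (\forall s \near 0^', P s) <->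
  exists2 e : C, 0 < e & forall s, s != 0 -> `|s| < e -> P s.
Proof.
split.
  rewrite near_withinE => /nbhs_ballP[e /= e0 H]; exists e => // s s0 se.
  by apply: H => //; rewrite -ball_normE /= sub0r normrN.
move=> [e e0 H]; have h0 : \forall s \near (0 : C)^', s != 0.
  exact: nbhs_dnbhs_neq.
by apply: filterS2 (dnbhs0_lt e0) h0 => s se s0; exact: H.
Qed.

Lemma near_dnbhs_near (P : C -> Prop) :
  (\forall s \near 0^', P s) ->
  \forall s \near (0 : C)^', \forall z \near s, P z.
Proof.
rewrite near_withinE => /nbhs_interior H.
have h0 : \forall s \near (0 : C)^', s != 0 by exact: nbhs_dnbhs_neq.
apply: filterS2 (nbhs_dnbhs H) h0 => s Hs s0.
have hc : z @[z --> (s : C)] --> (s : C) by exact: cvg_id.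
have := @cvgr_neq0 _ _ _ (nbhs s) (nbhs_filter s) _ _ hc s0.
by apply: filterS2 Hs => z; apply.
Qed.

Lemma cvg_dnbhs0 (f : C -> C) : f @ 0^' --> (0 : C) ->
  (\forall s \near 0^', f s != 0) -> f @ 0^' --> 0^'.
Proof.
move=> f0 fn0 P /=; rewrite nbhs_simpl /= => HP.
by apply: filterS2 (f0 _ HP) fn0 => s; apply.
Qed.

Lemma near_dilation (q : C) (P : C -> Prop) : q != 0 ->
  (\forall s \near 0^', P s) -> \forall s \near 0^', P (q * s).
Proof.
move=> q0 /dnbhs0P[e e0 H]; apply/dnbhs0P; exists (e / `|q|).
  by rewrite divr_gt0 // normr_gt0.
move=> s s0; rewrite ltr_pdivlMr ?normr_gt0 // mulrC -normrM => se.
by apply: H => //; rewrite mulf_neq0.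
Qed.

End PuncturedNeighbourhoods.

Section GermTelescoper.
Variables (C : numFieldType) (K : ratField C).
Local Notation "p %:K" := (@rpoly C K p) (at level 1, format "p %:K").

(** [ostrowski] for the polynomials that vanish at the germs h_i; they are stable under
    the twist because the dilation maps h_i to h_i + delta^i beta. *)
Theorem germ_telescoper (q : C) (sigma : {rmorphism K -> K}) (beta : K)
    (h : nat -> C -> C) m (P : mpoly m K) :
  q != 0 -> (forall p, sigma p%:K = (p \Po (q *: 'X))%:K) ->
  (forall i, \forall s \near 0^',
     h i (q * s) - h i s = reval s (iter i delta beta)) ->
  P != 0 -> (\forall s \near 0^', peval (fun i : 'I_m => h i) P s = 0) ->
  exists (c : 'I_m -> K) (r : K),
    [/\ exists i, c i != 0, forall i, sigma (c i) = c i &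
        \sum_i c i * iter i delta beta = sigma r - r].
Proof.
move=> q0 sE hE P0 VP.
pose V (Q : mpoly m K) := \forall s \near 0^', peval (fun i : 'I_m => h i) Q s = 0.
apply: (@ostrowski K m sigma (fun i : 'I_m => iter i delta beta) V).
- move=> i; rewrite -(rmorph_nat (@rpoly C K)) rpoly_eq0.
  by rewrite -polyC_natr polyC_eq0 pnatr_eq0.
- move=> V1; have := @peval1 C K m (fun i : 'I_m => h i).
  move=> V1'; suff : \forall s \near (0:C)^', False by case/filter_ex.
  apply: filterS2 V1 V1' => s -> /eqP.
  by rewrite eq_sym oner_eq0.
- move=> Q R VQ VR; have := pevalB (fun i : 'I_m => h i) Q R; apply: filter_app.
  by apply: filterS2 VQ VR => s -> -> ->; rewrite subrr.
- move=> c Q VQ; have := pevalZ (fun i : 'I_m => h i) c Q; apply: filter_app.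
  by apply: filterS VQ => s -> ->; rewrite mulr0.
- move=> Q VQ; have := @peval_subst C K m m sigma (fun s => q * s)
    (fun i => mpolyX K (mnm1 i) + mpolyC m (iter i delta beta))
    (fun i : 'I_m => h i) Q (reval_dilation sE).
  apply: filter_app; have := near_dilation q0 VQ; apply: filter_app.
  have : \forall s \near 0^', forall i, i \in enum 'I_m ->
      peval (fun i : 'I_m => h i)
        (mpolyX K (mnm1 i) + mpolyC m (iter i delta beta)) s = h i (q * s).
    apply: near_all_seq => i.
    have := pevalD (fun i : 'I_m => h i) (mpolyX K (mnm1 i)) (mpolyC m (iter i delta beta)).
    apply: filter_app; have := pevalX K (fun i : 'I_m => h i) i; apply: filter_app.
    have := pevalC (fun i : 'I_m => h i) (iter i delta beta); apply: filter_app.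
    by apply: filterS (hE i) => s <- -> -> ->; rewrite addrC subrK.
  apply: filterS => s Es VQs ->; rewrite -VQs /peval /mmap.
  apply: eq_bigr => u _; congr (_ * _); apply: mmap1_eq => i.
  by apply: (Es i); rewrite mem_enum.
- by exists P.
Qed.

End GermTelescoper.

(** * Differential relations under a change of variable *)

Section AffineSubstitution.
Variables (K : fieldType) (n : nat).
Variables (S : 'M[K]_n) (zeta : 'I_n -> K).
Local Notation Y i := (mpolyX K (mnm1 i)).

Definition affine_form (i : 'I_n) : mpoly n K :=
  \sum_j S i j *: Y j + mpolyC n (zeta i).

Lemma rmorph_mmap_id (Phi : {rmorphism mpoly n K -> mpoly n K}) L P :
  (forall c, Phi (mpolyC n c) = mpolyC n c) -> (forall i, Phi (L i) = Y i) ->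
  Phi (mmap (@mpolyC n K \o idfun) L P) = P.
Proof.
move=> PhiC PhiL; rewrite /mmap rmorph_sum [RHS]mpolyE; apply: eq_bigr => m _.
rewrite rmorphM /= PhiC mul_mpolyC; congr (_ *: _).
rewrite -mmap1_id /mmap1 rmorph_prod; apply: eq_bigr => i _.
by rewrite rmorphXn PhiL.
Qed.

(** An invertible affine change of variables has an inverse substitution. *)
Lemma affine_subst_neq0 (P : mpoly n K) : S \in unitmx -> P != 0 ->
  mmap (@mpolyC n K \o idfun) affine_form P != 0.
Proof.
move=> Su; pose T L : {rmorphism mpoly n K -> mpoly n K} :=
  mmap (@mpolyC n K \o idfun) L.
pose L' (i : 'I_n) : mpoly n K :=
  \sum_j invmx S i j *: (Y j - mpolyC n (zeta j)).
have TC L c : T L (mpolyC n c) = mpolyC n c by rewrite /= mmapC.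
have TX L i : T L (Y i) = L i by rewrite /= mmapX mmap1U.
have TZ L c Q : T L (c *: Q) = c *: T L Q.
  by rewrite -mul_mpolyC rmorphM /= TC mul_mpolyC.
have TL' i : T L' (affine_form i) = Y i.
  rewrite rmorphD TC rmorph_sum /=.
  under eq_bigr do rewrite TZ TX scaler_sumr.
  rewrite exchange_big /= (bigD1 i) //= [X in _ + X + _]big1.
    under eq_bigr do rewrite scalerA.
    rewrite -scaler_suml; have := mulmxV Su.
    move/matrixP/(_ i i); rewrite !mxE eqxx => ->.
    by rewrite scale1r addr0 subrK.
  move=> k ki; under eq_bigr do rewrite scalerA.
  rewrite -scaler_suml; have := mulmxV Su.
  move/matrixP/(_ i k); rewrite !mxE eq_sym (negPf ki) => ->.
  by rewrite scale0r.
apply: contra_neq => E; suff : T L' (T affine_form P) = P.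
  by rewrite /T /= E raddf0 => <-.
exact: rmorph_mmap_id.
Qed.

End AffineSubstitution.

Fact tower_step_ring (F : fieldType) (w w' u v z s : F) :
  w * (u / s) + v * (w' * (z / s)) = (u * w + v * z * w') / s.
Proof. by ring. Qed.

Section Tower.
Variables (C : numFieldType) (K : ratField C).
Local Notation "p %:K" := (@rpoly C K p) (at level 1, format "p %:K").

Lemma is_derive_comp (f g : C -> C) (x df dg : C) :
  is_derive x 1 f df -> is_derive (f x) 1 g dg ->
  is_derive x 1 (g \o f) (dg * df).
Proof.
move=> [fx dfE] [gx dgE].
have Df : differentiable f x by exact/derivable1_diffP.
have Dg : differentiable g (f x) by exact/derivable1_diffP.
have Dgf : differentiable (g \o f) x by exact: differentiable_comp.
have Ef : 'd f x 1 = df by rewrite -deriveE.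
have Eg : 'd g (f x) 1 = dg by rewrite -deriveE.
apply: DeriveDef; first exact/derivable1_diffP.
rewrite (deriveE _ Dgf) (diff_comp Df Dg).
apply: etrans (congr1 ('d g (f x)) Ef) _.
rewrite -[in LHS](mulr1 df) -[df * 1]/(df *: (1 : C^o)) linearZ.
by apply: etrans (congr1 (fun z => df * z) Eg) _; rewrite mulrC.
Qed.

Variables (W : C -> C) (rho r0 : K).
Hypothesis W_smooth : forall j, \forall x \near (0 : C), derivable (derive1n j W) x 1.
Hypothesis rho_cvg : (fun s : C => reval s rho) @ (0 : C)^' --> (0 : C)^'.

(** The coefficient of W^(j)(rho) in (s d/ds)^i (r0 W(rho)). *)
Fixpoint tower_coef (i j : nat) : K :=
  match i, j with
  | 0, 0 => r0
  | 0, _.+1 => 0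
  | i'.+1, 0 => delta (tower_coef i' 0)
  | i'.+1, j'.+1 => delta (tower_coef i' j) + tower_coef i' j' * delta rho
  end.

Definition tower (i : nat) (s : C) : C :=
  \sum_(j < i.+1) reval s (tower_coef i j) * derive1n j W (reval s rho).

Lemma delta0 : delta (0 : K) = 0.
Proof.
have /eqP := @deltaD C K 0 0.
by rewrite addr0 -subr_eq subrr eq_sym => /eqP.
Qed.

Lemma tower_coef_gt i j : (i < j)%N -> tower_coef i j = 0.
Proof.
elim: i j => [|i IH] [|j] //= ij.
by rewrite !IH ?mul0r ?addr0 ?delta0 // ltnW.
Qed.

Lemma tower_coef_diag i : tower_coef i i = r0 * delta rho ^+ i.
Proof.
elim: i => [|i IH] /=; first by rewrite expr0 mulr1.
by rewrite tower_coef_gt // delta0 add0r IH exprSr mulrA.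
Qed.

Lemma is_derive_tower i :
  \forall s \near 0^', is_derive (s : C) 1 (tower i) (tower i.+1 s / s).
Proof.
have h0 : \forall s \near (0 : C)^', s != 0 by exact: nbhs_dnbhs_neq.
have dW : \forall s \near 0^', forall j, j \in iota 0 i.+1 ->
    derivable (derive1n j W) (reval s rho) 1.
  by apply: near_all_seq => j; have := rho_cvg (nbhs_dnbhs (W_smooth j)).
have dT : \forall s \near 0^', forall j, j \in iota 0 i.+1 ->
    is_derive (s : C) 1 (fun z => reval z (tower_coef i j)) (reval s (delta (tower_coef i j)) / s).
  by apply: near_all_seq => j; exact: reval_delta.
have ET : \forall s \near 0^', forall j, j \in iota 0 i.+1 ->
    reval s (tower_coef i.+1 j.+1) = reval s (delta (tower_coef i j.+1)) +
      reval s (tower_coef i j) * reval s (delta rho).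
  apply: near_all_seq => j /=.
  have := revalD (delta (tower_coef i j.+1)) (tower_coef i j * delta rho).
  by apply: filterS2 (revalM (tower_coef i j) (delta rho)) => s ->.
have E0 : \forall s \near 0^', reval s (delta (tower_coef i i.+1)) = 0.
  by rewrite tower_coef_gt // delta0; exact: reval0.
apply: filter_app h0; apply: filter_app E0; apply: filter_app ET.
apply: filter_app dT; apply: filterS2 dW (reval_delta rho).
move=> s dW drho dT ET E0 s0.
have inI (j : 'I_i.+1) : val j \in iota 0 i.+1 by rewrite mem_iota /= add0n.
have dcomp (j : 'I_i.+1) : is_derive (s : C) 1
    (fun z => reval z (tower_coef i j) * derive1n j W (reval z rho))
    (reval s (tower_coef i j) * (derive1n j.+1 W (reval s rho) * (reval s (delta rho) / s)) +
     derive1n j W (reval s rho) * (reval s (delta (tower_coef i j)) / s)).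
  have dWj : is_derive (reval s rho) 1 (derive1n j W) (derive1n j.+1 W (reval s rho)).
    apply: DeriveDef; first exact: (dW _ (inI j)).
    by rewrite derive1nS derive1E.
  have H1 := is_derive_comp drho dWj; have H2 := dT _ (inI j).
  exact: (is_deriveM H2 H1).
have := is_derive_sum dcomp; set F := (X in is_derive _ _ X _); set D := (X in is_derive _ _ _ X).
have -> : F = tower i.
  by apply/funext => z; rewrite /F /tower fct_sumE.
suff -> : D = tower i.+1 s / s by [].
have -> : tower i.+1 s =
    \sum_(j < i.+2) reval s (delta (tower_coef i j)) * derive1n j W (reval s rho) +
    \sum_(j < i.+1) reval s (tower_coef i j) * reval s (delta rho) *
      derive1n j.+1 W (reval s rho).
  rewrite /tower [in LHS]big_ord_recl [X in _ = X + _]big_ord_recl.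
  rewrite -[RHS]addrA -big_split; congr (_ + _); apply: eq_bigr => j _.
  by rewrite !lift0 (ET _ (inI j)) mulrDl.
have -> : \sum_(j < i.+2) reval s (delta (tower_coef i j)) * derive1n j W (reval s rho)
  = \sum_(j < i.+1) reval s (delta (tower_coef i j)) * derive1n j W (reval s rho).
  by rewrite [LHS]big_ord_recr /= E0 mul0r addr0.
rewrite -big_split mulr_suml.
apply: eq_bigr => j _; rewrite addrC.
exact: tower_step_ring.
Qed.

(** The matrix tower_coef is lower triangular with diagonal r0 (delta rho)^i.  Inverting
    it expresses the W^(i)(rho) affinely in the h_i, and a relation between the W^(i) at x
    becomes one along x = rho(s), its coefficients being composed with rho. *)
Theorem tower_relation m (P : mpoly m.+1 K) (eta : nat -> K) (eps : K)
    (h : nat -> C -> C) :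
  r0 != 0 -> delta rho != 0 -> eps != 0 -> P != 0 ->
  (\forall x \near 0^', mmap (reval x) (fun i : 'I_m.+1 => derive1n i W x) P = 0) ->
  (forall i, \forall s \near 0^',
     h i s = reval s (eta i) + reval s eps * tower i s) ->
  exists2 Q : mpoly m.+1 K, Q != 0 &
    \forall s \near 0^', peval (fun i : 'I_m.+1 => h i) Q s = 0.
Proof.
move=> r00 drho0 eps0 P0 VP hE.
have [phi phiE] := rat_subst (rhorner_neq0 rho_cvg).
have phis := reval_subst phiE.
pose R : 'M[K]_m.+1 := \matrix_(i, j) tower_coef i j.
have Ru : R \in unitmx.
  rewrite unitmxE det_trig; last first.
    by apply/is_trig_mxP => i j ij; rewrite mxE tower_coef_gt.
  rewrite unitfE; apply/prodf_neq0 => i _.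
  by rewrite mxE tower_coef_diag mulf_neq0 // expf_neq0.
pose S : 'M[K]_m.+1 := eps^-1 *: invmx R.
have Su : S \in unitmx by rewrite unitmxZ ?unitmx_inv // unitfE invr_eq0.
pose zeta i := - \sum_j S i j * eta j.
pose P1 := map_mpoly phi P.
have P10 : P1 != 0.
  apply: contra_neq P0 => E; apply/mpolyP => u.
  apply: (fmorph_inj phi); rewrite -mcoeff_map_mpoly -/P1 E !mcoeff0.
  by rewrite rmorph0.
(* The relation P = 0 composed with rho. *)
have VP1 : \forall s \near 0^',
    peval (fun (i : 'I_m.+1) z => derive1n i W (reval z rho)) P1 s = 0.
  have := @peval_subst C K m.+1 m.+1 phi (fun s => reval s rho)
    (fun i => mpolyX K (mnm1 i))
    (fun (i : 'I_m.+1) z => derive1n i W (reval z rho)) P phis.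
  have VPr : \forall s \near 0^', mmap (reval (reval s rho))
      (fun i : 'I_m.+1 => derive1n i W (reval s rho)) P = 0.
    exact: (rho_cvg VP).
  apply: filter_app; apply: filter_app VPr.
  have : \forall s \near 0^', forall i, i \in enum 'I_m.+1 ->
      peval (fun (i : 'I_m.+1) z => derive1n i W (reval z rho))
        (mpolyX K (mnm1 i)) s = derive1n i W (reval s rho).
    by apply: near_all_seq => i; exact: pevalX.
  apply: filterS => s Es VPs; rewrite /P1 => ->; rewrite -[RHS]VPs /mmap.
  apply: eq_bigr => u _; congr (_ * _); apply: mmap1_eq => i.
  by apply: (Es i); rewrite mem_enum.
exists (mmap (@mpolyC m.+1 K \o idfun) (affine_form S zeta) P1).
  exact: affine_subst_neq0.
have idE (r : K) : \forall s \near (0 : C)^', reval s (idfun r) = reval (id s) r.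
  by apply: filterE.
have := @peval_subst C K m.+1 m.+1 idfun id (affine_form S zeta)
  (fun i : 'I_m.+1 => h i) P1 idE.
apply: filter_app; apply: filter_app VP1.
have : \forall s \near 0^', forall i, i \in enum 'I_m.+1 ->
    peval (fun i : 'I_m.+1 => h i) (affine_form S zeta i) s =
      derive1n i W (reval s rho).
  apply: near_all_seq => i.
  pose hh (i : 'I_m.+1) := h i.
  have H1 : \forall s \near 0^', forall j, j \in enum 'I_m.+1 ->
      peval hh (S i j *: mpolyX K (mnm1 j)) s = reval s (S i j) * h j s.
    apply: near_all_seq => j; have := pevalZ hh (S i j) (mpolyX K (mnm1 j)).
    by apply: filterS2 (pevalX K hh j) => s ->.
  have H2 : \forall s \near 0^', forall j : 'I_m.+1, j \in enum 'I_m.+1 ->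
      h j s = reval s (eta j) + reval s eps * tower j s.
    by apply: near_all_seq => j; exact: hE.
  have H3 : \forall s \near 0^', reval s (zeta i) =
      - \sum_j reval s (S i j) * reval s (eta j).
    have := revalN (\sum_j S i j * eta j); apply: filter_app.
    have := reval_sum (enum 'I_m.+1) (fun j => S i j * eta j); rewrite big_enum.
    apply: filter_app.
    have : \forall s \near 0^', forall j, j \in enum 'I_m.+1 ->
        reval s (S i j * eta j) = reval s (S i j) * reval s (eta j).
      by apply: near_all_seq => j; exact: revalM.
    apply: filterS => s E -> ->; congr (- _); rewrite big_enum /=.
    by apply: eq_bigr => j _; rewrite E ?mem_enum.
  have H4 : \forall s \near 0^', forall l, l \in enum 'I_m.+1 ->
      \sum_j reval s (S i j) * reval s eps * reval s (tower_coef j l) = (i == l)%:R.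
    apply: near_all_seq => l.
    have := reval_sum (enum 'I_m.+1) (fun j : 'I_m.+1 => S i j * eps * tower_coef j l).
    rewrite big_enum /=.
    have -> : \sum_j S i j * eps * tower_coef j l = rcst (i == l)%:R.
      have /matrixP/(_ i l) := mulVmx Ru; rewrite !mxE rmorph_nat => <-.
      apply: eq_bigr => j _; by rewrite !mxE [eps^-1 * _]mulrC divfK.
    apply: filter_app.
    have : \forall s \near 0^', forall j : 'I_m.+1, j \in enum 'I_m.+1 ->
        reval s (S i j * eps * tower_coef j l) =
        reval s (S i j) * reval s eps * reval s (tower_coef j l).
      apply: near_all_seq => j; have := revalM (S i j * eps) (tower_coef j l).
      by apply: filterS2 (revalM (S i j) eps) => s ->.
    apply: filterS2 (reval_cst K (i == l)%:R) => s -> E ->; rewrite big_enum /=.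
    by apply: eq_bigr => j _; rewrite E ?mem_enum.
  have := pevalD hh (\sum_j S i j *: mpolyX K (mnm1 j)) (mpolyC m.+1 (zeta i)).
  rewrite -/(affine_form S zeta i); apply: filter_app.
  have := peval_sum hh (enum 'I_m.+1) (fun j => S i j *: mpolyX K (mnm1 j)).
  rewrite big_enum; apply: filter_app; have := pevalC hh (zeta i).
  apply: filter_app; apply: filter_app H4; apply: filter_app H3.
  apply: filter_app H2; apply: filterS2 (reval0 K) H1 => s E0 E1 E2 E3 E4 E5 E6 E7.
  have toT (F : 'I_m.+1 -> C) : \sum_(j <- enum 'I_m.+1) F j = \sum_j F j.
    by rewrite big_enum; exact: eq_bigl.
  rewrite E7 E6 E5 E3 toT.
  have towerE (j : 'I_m.+1) : tower j s =
      \sum_(l < m.+1) reval s (tower_coef j l) * derive1n l W (reval s rho).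
    rewrite /tower (big_ord_widen m.+1
      (fun l => reval s (tower_coef j l) * derive1n l W (reval s rho))) //.
    rewrite big_mkcond; apply: eq_bigr => l _; case: ifPn => //.
    by rewrite -leqNgt => jl; rewrite tower_coef_gt // E0 mul0r.
  under eq_bigr => j _.
    rewrite (E1 j) ?mem_enum // (E2 j) ?mem_enum // mulrDr towerE mulrA mulr_sumr.
    under eq_bigr do rewrite mulrA.
    over.
  rewrite big_split /= addrAC subrr add0r exchange_big /= (bigD1 i) //= [X in _ + X]big1 ?addr0.
    by rewrite -mulr_suml E4 ?mem_enum // eqxx mul1r.
  by move=> l li; rewrite -mulr_suml E4 ?mem_enum // eq_sym (negPf li) mul0r.
apply: filterS => s Es VPs ->; rewrite -[RHS]VPs /peval /mmap.
apply: eq_bigr => u _; congr (_ * _); apply: mmap1_eq => i.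
by apply: (Es i); rewrite mem_enum.
Qed.
End Tower.

(** * A criterion of differential transcendence *)

Section DerivedGerms.
Variables (C : numFieldType) (K : ratField C).

(** The sequence A_0, s d/ds A_0, (s d/ds)^2 A_0 and so on, as germs. *)
Definition euler_tower (A : nat -> C -> C) : Prop :=
  forall i, \forall s \near 0^', is_derive (s : C) 1 (A i) (A i.+1 s / s).

Lemma euler_tower_reval (r : K) :
  euler_tower (fun i s => reval s (iter i delta r)).
Proof. by move=> i; exact: reval_delta. Qed.

Lemma euler_towerB A B : euler_tower A -> euler_tower B ->
  euler_tower (fun i s => A i s - B i s).
Proof.
move=> hA hB i; apply: filterS2 (hA i) (hB i) => s dA dB.
by rewrite mulrBl; exact: is_deriveB.
Qed.

Lemma euler_tower_dilate (q : C) A : q != 0 -> euler_tower A ->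
  euler_tower (fun i s => A i (q * s)).
Proof.
move=> q0 hA i; have h0 : \forall s \near (0 : C)^', s != 0.
  exact: nbhs_dnbhs_neq.
apply: filterS2 (near_dilation q0 (hA i)) h0 => s dA s0.
have dq : is_derive s 1 (fun z : C => q * z) q.
  have := is_deriveZ q (is_derive_id s (1 : C)).
  by rewrite [_ *: _]mulr1.
have := is_derive_comp dq dA.
by have -> : A i.+1 (q * s) / (q * s) * q = A i.+1 (q * s) / s by field; rewrite q0 s0.
Qed.

(** Each germ of a tower determines the next one, by derivation. *)
Lemma euler_tower_eq A B : euler_tower A -> euler_tower B ->
  (\forall s \near 0^', A 0 s = B 0 s) ->
  forall i, \forall s \near 0^', A i s = B i s.
Proof.
move=> hA hB E0; elim=> [//|i IH].
have h0 : \forall s \near (0 : C)^', s != 0 by exact: nbhs_dnbhs_neq.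
apply: filter_app h0; apply: filter_app (hB i).
apply: filterS2 (near_dnbhs_near IH) (hA i) => s Es dA dB s0.
have dA' := near_eq_is_derive Es dA.
have : A i.+1 s / s = B i.+1 s / s.
  by case: dA' => _ <-; case: dB => _ <-.
by move/(mulIf (_ : s^-1 != 0)); apply; rewrite invr_eq0.
Qed.

End DerivedGerms.

Section Criterion.
Variables (C : numFieldType) (K : ratField C).

(** All derivatives of the germ g = beta y^2 Wy(y) under s d/ds satisfy the derived forms
    of g(q s) - g(s) = b(s), so g satisfies no differential relation by
    [germ_telescoper] and [no_linear_telescoper].  A relation for Wy is one for g, and
    a relation for Wx is one for x y - g = alpha x^2 Wx(x). *)
Theorem hypertranscendence_criterion (q p : C) (M : nat) (x y b : K)
    (alpha beta : C) (Wx Wy : C -> C) :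
  q != 0 -> (forall n, q ^+ n.+1 != 1) -> p != 0 ->
  alpha != 0 -> beta != 0 -> x != 0 -> y != 0 ->
  delta x != 0 -> delta y != 0 ->
  (fun s : C => reval s x) @ (0 : C)^' --> (0 : C)^' ->
  (fun s : C => reval s y) @ (0 : C)^' --> (0 : C)^' ->
  (forall j, \forall z \near (0 : C), derivable (derive1n j Wx) z 1) ->
  (forall j, \forall z \near (0 : C), derivable (derive1n j Wy) z 1) ->
  (\forall s \near 0^', alpha * reval s x ^+ 2 * Wx (reval s x) +
     beta * reval s y ^+ 2 * Wy (reval s y) = reval s x * reval s y) ->
  (\forall s \near 0^',
     beta * reval (q * s) y ^+ 2 * Wy (reval (q * s) y) -
     beta * reval s y ^+ 2 * Wy (reval s y) = reval s b) ->
  pole_eq M.+1 p b ->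
  (forall k : nat, pole_le M (q ^+ k.+1 * p) b) ->
  (forall k : nat, pole_le M (q ^- k.+1 * p) b) ->
  forall (m : nat) (P : mpoly m.+1 K), P != 0 ->
    ~ (\forall z \near 0^',
         mmap (reval z) (fun i : 'I_m.+1 => derive1n i Wx z) P = 0) /\
    ~ (\forall z \near 0^',
         mmap (reval z) (fun i : 'I_m.+1 => derive1n i Wy z) P = 0).
Proof.
move=> q0 qtf p0 al0 be0 x0 y0 dx0 dy0 xc yc sx sy Exy Eq bp bpos bneg m P P0.
have [sigma sE] := @dilation_exists C K q q0.
pose rx := rcst alpha * x ^+ 2; pose ry := rcst beta * y ^+ 2.
have rx0 : rx != 0 by rewrite mulf_neq0 ?rcst_eq0 ?expf_neq0.
have ry0 : ry != 0 by rewrite mulf_neq0 ?rcst_eq0 ?expf_neq0.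
pose hx := tower Wx x rx; pose hy := tower Wy y ry.
have thx : euler_tower hx by move=> i; exact: is_derive_tower.
have thy : euler_tower hy by move=> i; exact: is_derive_tower.
have reval_r0 c (z : K) : \forall s \near 0^',
    reval s (rcst c * z ^+ 2) = c * reval s z ^+ 2.
  have := revalM (rcst c) (z ^+ 2); apply: filter_app.
  by apply: filterS2 (reval_cst K c) (revalM z z) => s Ec Ez ->; rewrite Ec Ez.
have h0x : \forall s \near 0^', hx 0 s = alpha * reval s x ^+ 2 * Wx (reval s x).
  apply: filterS (reval_r0 alpha x) => s E.
  by rewrite /hx /tower big_ord_recl big_ord0 addr0 /= E.
have h0y : \forall s \near 0^', hy 0 s = beta * reval s y ^+ 2 * Wy (reval s y).
  apply: filterS (reval_r0 beta y) => s E.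
  by rewrite /hy /tower big_ord_recl big_ord0 addr0 /= E.
have hyq i : \forall s \near 0^', hy i (q * s) - hy i s = reval s (iter i delta b).
  apply: (@euler_tower_eq C (fun i s => hy i (q * s) - hy i s)
    (fun i s => reval s (iter i delta b))).
  - by apply: euler_towerB => //; exact: euler_tower_dilate.
  - exact: euler_tower_reval.
  - apply: filter_app Eq; apply: filterS2 (near_dilation q0 h0y) h0y.
    by move=> s -> -> ->.
have hyx i : \forall s \near 0^',
    hy i s = reval s (iter i delta (x * y)) - hx i s.
  apply: (@euler_tower_eq C hy
    (fun i s => reval s (iter i delta (x * y)) - hx i s)) => //.
  - by apply: euler_towerB => //; exact: euler_tower_reval.
  - apply: filter_app Exy; apply: filter_app h0x.
    by apply: filterS2 h0y (revalM x y) => s -> /= -> -> <-; rewrite addrAC subrr add0r.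
have no_relation (Q : mpoly m.+1 K) : Q != 0 ->
    ~ \forall s \near 0^', peval (fun i : 'I_m.+1 => hy i) Q s = 0.
  move=> Q0 VQ; have [c [r [c0 sc E]]] := germ_telescoper q0 sE hyq Q0 VQ.
  exact: (no_linear_telescoper qtf q0 sE p0 bp bpos bneg c0 sc E).
have m10 : -1 != 0 :> K by rewrite oppr_eq0 oner_eq0.
split=> VP.
- have [|Q Q0 VQ] := @tower_relation C K Wx x rx xc m P
    (fun i => iter i delta (x * y)) (-1) hy rx0 dx0 m10 P0 VP; last first.
    exact: no_relation VQ.
  move=> i; apply: filterS3 (hyx i) (revalN (1 : K)) (reval1 K) => s -> -> ->.
  by rewrite mulN1r.
- have [|Q Q0 VQ] := @tower_relation C K Wy y ry yc m P
    (fun i => 0) 1 hy ry0 dy0 (oner_neq0 _) P0 VP; last first.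
    exact: no_relation VQ.
  move=> i; apply: filterS2 (reval0 K) (reval1 K) => s -> ->.
  by rewrite add0r mul1r.
Qed.

End Criterion.

(** * Power series over the complex numbers *)

Section ComplexSeries.
Variable R : realType.
Local Notation C := (R[i] : numFieldType).
Local Open Scope complex_scope.
Local Notation Re := (@complex.Re R).
Local Notation Im := (@complex.Im R).

Lemma normr_real_complex (a : R) : `|a%:C| = `|a|%:C.
Proof. by rewrite normc_def /= expr0n /= addr0 sqrtr_sqr. Qed.

Lemma normr_complex_le (z : C) : `|z| <= (`|Re z| + `|Im z|)%:C.
Proof.
rewrite {1}[z]complexE (le_trans (ler_normD _ _)) // rmorphD /= normrM.
rewrite !normr_real_complex lerD2l.
suff -> : `|'i%C : C| = 1 by rewrite mul1r.
by rewrite normc_def /= expr0n /= expr1n add0r sqrtr1.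
Qed.

Lemma normr_Re_le (z : C) (a : R) : `|z| <= a%:C -> `|Re z| <= a.
Proof.
rewrite normc_def lecR; apply: le_trans.
by rewrite -sqrtr_sqr ler_sqrt ?addr_ge0 ?sqr_ge0 // lerDl sqr_ge0.
Qed.

Lemma normr_Im_le (z : C) (a : R) : `|z| <= a%:C -> `|Im z| <= a.
Proof.
rewrite normc_def lecR; apply: le_trans.
by rewrite -sqrtr_sqr ler_sqrt ?addr_ge0 ?sqr_ge0 // lerDr sqr_ge0.
Qed.

Lemma gt0_complexP (e : C) : 0 < e -> exists2 a : R, 0 < a & e = a%:C.
Proof.
by rewrite ltcE => /andP[/eqP /= Ie Re0]; exists (Re e) => //; case: e Ie Re0 => a b /= ->.
Qed.

Lemma ge0_complexP (e : C) : 0 <= e -> exists2 a : R, 0 <= a & e = a%:C.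
Proof.
by rewrite lecE => /andP[/eqP /= Ie Re0]; exists (Re e) => //; case: e Ie Re0 => a b /= ->.
Qed.

Lemma cvg_complex (u : nat -> C) (a b : R) :
  (fun n => Re (u n)) @ \oo --> a -> (fun n => Im (u n)) @ \oo --> b ->
  u @ \oo --> (a +i* b : C).
Proof.
move=> ua ub; apply/cvgrPdist_lt => _ /gt0_complexP[e e0 ->].
have e20 : 0 < e / 2 by rewrite divr_gt0.
move/cvgrPdist_lt/(_ _ e20) : ua => ua; move/cvgrPdist_lt/(_ _ e20) : ub => ub.
apply: filterS2 ua ub => n an bn.
apply: le_lt_trans (normr_complex_le _) _; rewrite ltcR.
rewrite [e]splitr; move: an bn; case: (u n) => x y /=; exact: ltrD.
Qed.

Definition psum (u : nat -> C) (n : nat) : C := \sum_(k < n) u k.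

Lemma real_geometric_cvg (a : nat -> R) (B rho : R) : 0 <= rho < 1 ->
  (forall k, `|a k| <= B * rho ^+ k) -> cvgn (fun n => \sum_(k < n) a k).
Proof.
move=> /andP[rho0 rho1] ab.
have -> : (fun n => \sum_(k < n) a k) = series a.
  by apply/funext => n; rewrite /series /= big_mkord.
apply: normed_cvg; apply: (@series_le_cvg _ _ (geometric B rho)) => //.
- by move=> n /=.
- by move=> n /=; exact: le_trans (normr_ge0 _) (ab n).
- by apply: is_cvg_geometric_series; rewrite ger0_norm.
Qed.

Lemma geometric_cvg (u : nat -> C) (B rho : C) : 0 <= rho < 1 ->
  (forall k, `|u k| <= B * rho ^+ k) -> cvgn (psum u).
Proof.
move=> /andP[/ge0_complexP[r r0 ->] r1] ub.
have /ge0_complexP[b b0 EB] : 0 <= B.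
  by have := ub 0%N; rewrite expr0 mulr1; apply: le_trans.
have r01 : 0 <= r < 1 by rewrite r0 -(ltcR r 1).
have ub' k : `|u k| <= (b * r ^+ k)%:C.
  by rewrite (le_trans (ub k)) // EB rmorphM rmorphXn.
have cr := @real_geometric_cvg (fun k => Re (u k)) b r r01 (fun k => normr_Re_le (ub' k)).
have ci := @real_geometric_cvg (fun k => Im (u k)) b r r01 (fun k => normr_Im_le (ub' k)).
apply/cvg_ex; exists (lim ((fun n => \sum_(k < n) Re (u k)) @ \oo) +i*
  lim ((fun n => \sum_(k < n) Im (u k)) @ \oo)).
apply: cvg_complex.
  have -> : (fun n => Re (psum u n)) = (fun n => \sum_(k < n) Re (u k)).
    by apply/funext => n; rewrite /psum (raddf_sum Re).
  exact: cr.
have -> : (fun n => Im (psum u n)) = (fun n => \sum_(k < n) Im (u k)).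
  by apply/funext => n; rewrite /psum (raddf_sum Im).
exact: ci.
Qed.

Lemma geometric_sum_le (u : nat -> C) (B rho : C) : 0 <= rho < 1 ->
  (forall k, `|u k| <= B * rho ^+ k) ->
  forall n, `|psum u n| <= B / (1 - rho).
Proof.
move=> /andP[r0 r1] ub n; have B0 : 0 <= B.
  by have := ub 0%N; rewrite expr0 mulr1; apply: le_trans.
apply: le_trans (ler_norm_sum _ _ _) _.
apply: (@le_trans _ _ (\sum_(k < n) B * rho ^+ k)); first exact: ler_sum.
have r10 : 0 < 1 - rho by rewrite subr_gt0.
rewrite -mulr_sumr ler_wpM2l // -[leRHS]mul1r ler_pdivlMr // mulrC.
rewrite -opprB mulNr -subrX1 opprB gerBl; exact: exprn_ge0.
Qed.

Lemma norm_lim_le (u : nat -> C) (l M : C) :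
  u @ \oo --> l -> (forall n, `|u n| <= M) -> `|l| <= M.
Proof.
move=> ul uM; have MR : M \is Num.real.
  by rewrite ger0_real // (le_trans (normr_ge0 (u 0%N))).
rewrite real_leNgt ?normr_real //; apply/negP => Ml.
move/cvgrPdist_lt/(_ (`|l| - M)) : ul; rewrite subr_gt0 => /(_ Ml) [n _ /(_ n)].
move=> /(_ (leqnn n)) /= ln.
have := ltr_leD ln (uM n); rewrite subrK.
by move/(le_lt_trans (ler_normD _ _)); rewrite subrK ltxx.
Qed.

End ComplexSeries.

Section TaylorRemainder.
Variable C : numFieldType.

(** The bound is uniform on the closed unit disc and polynomial in n, so that it can be
    summed against geometrically decaying coefficients. *)
Lemma expr_taylor_le (x y : C) n : `|x| <= 1 -> `|y| <= 1 ->
  `|y ^+ n - x ^+ n - (y - x) * (x ^+ n.-1 *+ n)| <= (n ^ 2)%:R * `|y - x| ^+ 2.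
Proof.
move=> x1 y1; elim: n => [|n IH].
  by rewrite !expr0 mulr0n mulr0 subrr subr0 normr0 mul0r.
have -> : y ^+ n.+1 - x ^+ n.+1 - (y - x) * (x ^+ n.+1.-1 *+ n.+1) =
    y * (y ^+ n - x ^+ n - (y - x) * (x ^+ n.-1 *+ n))
    + n%:R * x ^+ n.-1 * (y - x) ^+ 2.
  case: n {IH} => [|n] /=; first by rewrite !expr0 !expr1 mulr1n mulr0n; ring.
  rewrite -(mulr_natr (x ^+ n.+1)) -(mulr_natr (x ^+ n)) -[n.+2%:R]natr1.
  rewrite !(exprS _ n.+1) !(exprS _ n); move: (n.+1%:R) (x ^+ n) (y ^+ n).
  by move=> z p p'; ring.
apply: le_trans (ler_normD _ _) _; rewrite !normrM normr_nat !normrX.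
have b1 : `|y| * `|y ^+ n - x ^+ n - (y - x) * (x ^+ n.-1 *+ n)| <=
    (n ^ 2)%:R * `|y - x| ^+ 2.
  by rewrite -[leRHS]mul1r ler_pM.
have b2 : n%:R * `|x| ^+ n.-1 * `|y - x| ^+ 2 <= n%:R * `|y - x| ^+ 2.
  rewrite ler_wpM2r ?exprn_ge0 // -[leRHS]mulr1 ler_wpM2l ?ler0n //.
  by rewrite exprn_ile1.
apply: le_trans (lerD b1 b2) _; rewrite -mulrDl ler_wpM2r ?exprn_ge0 //.
rewrite -natrD ler_nat -[n.+1]addn1 sqrnD -addnA leq_add2l.
by rewrite muln1 mul2n -addnn addnA leq_addl.
Qed.

Lemma horner_taylor_le (p : {poly C}) (x y b : C) n : `|x| <= 1 -> `|y| <= 1 ->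
  (size p <= n)%N -> (forall i, `|p`_i| <= b) ->
  `|p.[y] - p.[x] - (y - x) * p^`().[x]| <= b * (n ^ 3)%:R * `|y - x| ^+ 2.
Proof.
move=> x1 y1 pn pb; have b0 : 0 <= b := le_trans (normr_ge0 _) (pb 0%N).
have Ed : p^`().[x] = \sum_(i < n) p`_i * (x ^+ i.-1 *+ i).
  have {1}-> : p = \sum_(i < n) p`_i *: 'X^i.
    rewrite -[LHS](take_poly_id pn) /take_poly poly_def; apply: eq_bigr => i _.
    by [].
  rewrite raddf_sum horner_sum; apply: eq_bigr => i _.
  by rewrite /= derivZ derivXn hornerZ hornerMn hornerXn.
rewrite Ed !(horner_coef_wide _ pn) -sumrB mulr_sumr -sumrB.
apply: le_trans (ler_norm_sum _ _ _) _.
apply: (@le_trans _ _ (\sum_(i < n) b * (n ^ 2)%:R * `|y - x| ^+ 2)).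
  apply: ler_sum => i _.
  have -> : p`_i * y ^+ i - p`_i * x ^+ i - (y - x) * (p`_i * (x ^+ i.-1 *+ i)) =
      p`_i * (y ^+ i - x ^+ i - (y - x) * (x ^+ i.-1 *+ i)) by ring.
  rewrite normrM -mulrA ler_pM //; apply: le_trans (expr_taylor_le i x1 y1) _.
  rewrite ler_wpM2r ?exprn_ge0 // ler_nat leq_sqr; exact: ltnW.
rewrite sumr_const card_ord -[_ *+ n]mulr_natr [in leRHS]expnSr [in leRHS]natrM.
by rewrite mulrA mulrAC.
Qed.

Lemma horner_norm_le (p : {poly C}) (x b : C) n : `|x| <= 1 ->
  (size p <= n)%N -> (forall i, `|p`_i| <= b) -> `|p.[x]| <= b * n%:R.
Proof.
move=> x1 pn pb; rewrite (horner_coef_wide _ pn).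
apply: le_trans (ler_norm_sum _ _ _) _.
rewrite -[n in n%:R]card_ord mulr_natr -sumr_const; apply: ler_sum => i _.
by rewrite normrM -[leRHS]mulr1 ler_pM // normrX exprn_ile1.
Qed.

(** One takes rho' halfway between rho and 1; then (k+1) (rho/rho')^k is bounded by the
    sum of the geometric series of ratio rho/rho'. *)
Lemma geometric_absorb (B rho : C) : 0 <= B -> 0 <= rho < 1 ->
  exists B' rho', 0 <= rho' < 1 /\
    forall k, (k.+1)%:R * (B * rho ^+ k) <= B' * rho' ^+ k.
Proof.
move=> B0 /andP[r0 r1]; pose s := (1 + rho) / 2.
have s0 : 0 < s by rewrite divr_gt0 // ltr_pwDl.
have s1 : s < 1 by rewrite ltr_pdivrMr // mul1r -[2]/(1 + 1) ltrD2l.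
have rs : rho < s by rewrite ltr_pdivlMr // mulr_natr mulr2n ltrD2r.
pose z := rho / s; have z0 : 0 <= z by rewrite divr_ge0 // ltW.
have z1 : z < 1 by rewrite ltr_pdivrMr // mul1r.
have Er : rho = z * s by rewrite divfK // gt_eqF.
exists (B / (1 - z)), s; split=> [|k]; first by rewrite ltW.
rewrite Er exprMn !mulrA ler_wpM2r ?exprn_ge0 ?(ltW s0) //.
rewrite ler_pdivlMr ?subr_gt0 // -!mulrA mulrCA -[leRHS]mulr1 ler_wpM2l //.
apply: (@le_trans _ _ ((\sum_(i < k.+1) z ^+ i) * (1 - z))).
  rewrite mulrA ler_wpM2r ?subr_ge0 ?(ltW z1) //.
  rewrite -[k.+1 in leLHS]card_ord mulr_natl -sumr_const; apply: ler_sum => i _.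
  by rewrite ler_wiXn2l // ?(ltW z1) // -ltnS.
rewrite mulrC -opprB mulNr -subrX1 opprB gerBl; exact: exprn_ge0.
Qed.

End TaylorRemainder.

Section PolynomialSeries.
Variable R : realType.
Local Notation C := (R[i] : numFieldType).

(** Derivation loses a factor polynomial in k, which a larger ratio rho < 1 absorbs; so the
    condition passes to derivatives, and the sum of the series is smooth on the unit disc. *)
Definition geometric_polys (r : nat -> {poly C}) : Prop :=
  (forall k, (size (r k) <= k.+1)%N) /\
  exists B rho : C, [/\ 0 <= B, 0 <= rho < 1 &
    forall k i, `|(r k)`_i| <= B * rho ^+ k].

Definition polysum (r : nat -> {poly C}) (x : C) : C :=
  lim (psum (fun k => (r k).[x]) @ \oo).

Lemma geometric_absorb3 (B rho : C) : 0 <= B -> 0 <= rho < 1 ->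
  exists B' rho' : C, [/\ 0 <= B', 0 <= rho' < 1 &
    forall k, B * rho ^+ k * (k.+1 ^ 3)%:R <= B' * rho' ^+ k].
Proof.
move=> B0 r01.
have step (B1 r1 : C) : 0 <= B1 -> 0 <= r1 < 1 -> exists B' rho' : C,
    [/\ 0 <= B', 0 <= rho' < 1 &
     forall k, (k.+1)%:R * (B1 * r1 ^+ k) <= B' * rho' ^+ k].
  move=> B10 r1P; have [B' [r' [r'P h]]] := geometric_absorb B10 r1P.
  exists B', r'; split=> //.
  by have := h 0%N; rewrite !expr0 !mulr1 mul1r; exact: le_trans.
have [B1 [r1 [B10 r1P h1]]] := step _ _ B0 r01.
have [B2 [r2 [B20 r2P h2]]] := step _ _ B10 r1P.
have [B3 [r3 [B30 r3P h3]]] := step _ _ B20 r2P.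
exists B3, r3; split=> // k; apply: le_trans (h3 k).
rewrite mulrC natrX exprS -mulrA ler_wpM2l ?ler0n //.
apply: le_trans (h2 k); rewrite exprS -mulrA ler_wpM2l ?ler0n //.
by rewrite expr1; exact: h1.
Qed.

Lemma geometric_polys_deriv r : geometric_polys r ->
  geometric_polys (fun k => (r k)^`()).
Proof.
move=> [rs [B [rho [B0 r01 rb]]]]; split.
  by move=> k; exact: leq_trans (leq_trans (size_poly _ _) (leq_pred _)) (rs k).
have [B' [rho' [B0' r01' h]]] := geometric_absorb3 B0 r01.
exists B', rho'; split=> // k i; apply: le_trans (h k).
rewrite coef_deriv normrMn.
have [ik|ik] := leqP i.+1 k; last first.
  rewrite nth_default ?normr0 ?mul0rn; last by rewrite (leq_trans (rs k)).
  rewrite mulr_ge0 ?ler0n // mulr_ge0 // exprn_ge0 //; by case/andP: r01.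
rewrite -[_ *+ i.+1]mulr_natr ler_pM ?ler0n // ler_nat.
by rewrite (leq_trans (leqW ik)) // -[leqLHS]expn1 leq_pexp2l.
Qed.

Lemma polysum_cvg r (x : C) : geometric_polys r -> `|x| <= 1 ->
  psum (fun k => (r k).[x]) @ \oo --> polysum r x.
Proof.
move=> [rs [B [rho [B0 r01 rb]]]] x1.
have [B' [rho' [B0' r01' h]]] := geometric_absorb3 B0 r01.
apply: (@geometric_cvg R _ B' rho' r01') => k; apply: le_trans (h k).
apply: le_trans (horner_norm_le x1 (rs k) (rb k)) _.
apply: ler_wpM2l; last by rewrite ler_nat -[leqLHS]expn1 leq_pexp2l.
by rewrite mulr_ge0 // exprn_ge0 //; case/andP: r01.
Qed.

(** A quadratic Taylor bound summed termwise, from which termwise derivation follows at once. *)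
Lemma polysum_taylor r : geometric_polys r -> exists2 M : C, 0 <= M &
  forall x y : C, `|x| <= 1 -> `|y| <= 1 ->
  `|polysum r y - polysum r x - (y - x) * polysum (fun k => (r k)^`()) x|
    <= M * `|y - x| ^+ 2.
Proof.
move=> gr; have gr' := geometric_polys_deriv gr.
case: (gr) => [rs [B [rho [B0 r01 rb]]]].
have [B' [rho' [B0' r01' h]]] := geometric_absorb3 B0 r01.
have [r0' r1'] := andP r01'.
exists (B' / (1 - rho')); first by rewrite divr_ge0 // subr_ge0 ltW.
move=> x y x1 y1.
pose u k := (r k).[y] - (r k).[x] - (y - x) * (r k)^`().[x].
apply: (@norm_lim_le R (psum u)); last first.
  move=> n; rewrite mulrAC.
  apply: (@geometric_sum_le R u (B' * `|y - x| ^+ 2) rho' r01') => k.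
  apply: le_trans (horner_taylor_le x1 y1 (rs k) (rb k)) _.
  by rewrite [leRHS]mulrAC ler_wpM2r ?exprn_ge0 ?h.
have -> : psum u = (fun n => psum (fun k => (r k).[y]) n
    - psum (fun k => (r k).[x]) n - (y - x) * psum (fun k => (r k)^`().[x]) n).
  by apply/funext => n; rewrite /psum mulr_sumr -!sumrB.
apply: cvgB; first by apply: cvgB; exact: polysum_cvg.
by apply: cvgM; [exact: cvg_cst|exact: polysum_cvg].
Qed.

Lemma is_derive_polysum r (x : C) : geometric_polys r -> `|x| < 1 ->
  is_derive x 1 (polysum r) (polysum (fun k => (r k)^`()) x).
Proof.
move=> gr x1; have [M M0 HM] := polysum_taylor gr.
set D := polysum _ x.
suff H : h^-1 *: (((polysum r) \o shift x) (h *: (1 : C)) - polysum r x) @[h --> (0 : C)^'] --> D.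
  apply: DeriveDef; first by apply/cvg_ex; exists D.
  by rewrite /derive; apply/cvg_lim.
apply/cvgrPdist_lt => e e0.
have e1 : 0 < e / (M + 1) by rewrite divr_gt0 // ltr_wpDl.
have x10 : 0 < 1 - `|x| by rewrite subr_gt0.
have h0 : \forall h \near (0 : C)^', h != 0 by exact: nbhs_dnbhs_neq.
apply: filterS3 (dnbhs0_lt e1) (dnbhs0_lt x10) h0 => h he hx hn0.
rewrite /= [h *: 1]mulr1 -normrN opprB.
have y1 : `|h + x| <= 1.
  by rewrite (le_trans (ler_normD _ _)) // -lerBrDr ltW.
have := HM x (h + x) (ltW x1) y1; rewrite addrK -/D => H.
have -> : h^-1 *: (polysum r (h + x) - polysum r x) - D =
    h^-1 * (polysum r (h + x) - polysum r x - h * D).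
  by rewrite mulrBr mulKf.
rewrite normrM normfV mulrC ltr_pdivrMr ?normr_gt0 //.
apply: le_lt_trans H _; rewrite expr2 mulrA ltr_pM2r ?normr_gt0 //.
apply: (@le_lt_trans _ _ ((M + 1) * `|h|)).
  by rewrite ler_wpM2r // lerDl.
by rewrite mulrC -ltr_pdivlMr // ltr_wpDl.
Qed.

Lemma iter_deriv_geometric r j : geometric_polys r ->
  geometric_polys (fun k => (r k)^`(j)).
Proof.
move=> gr; elim: j => [|j IH]; first exact: gr.
have -> : (fun k => (r k)^`(j.+1)) = (fun k => ((r k)^`(j))^`()).
  by apply/funext => k; rewrite derivnS.
exact: geometric_polys_deriv.
Qed.

Lemma near_norm_lt1 (x : C) : `|x| < 1 -> \forall z \near x, `|z| < 1.
Proof.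
move=> x1; have x10 : 0 < 1 - `|x| by rewrite subr_gt0.
have /cvgrPdist_lt/(_ _ x10) : z @[z --> x] --> x by exact: cvg_id.
apply: filterS => z; rewrite ltrBrDl => xz; apply: le_lt_trans xz.
by rewrite -{1}[z](subrK x) addrC (le_trans (ler_normD _ _)) // lerD2l distrC.
Qed.

Lemma derive1n_polysum r j (x : C) : geometric_polys r -> `|x| < 1 ->
  derive1n j (polysum r) x = polysum (fun k => (r k)^`(j)) x.
Proof.
move=> gr; elim: j x => [|j IH] x x1; first by rewrite derive1n0.
rewrite derive1nS derive1E.
have near_eq : \forall z \near x, derive1n j (polysum r) z
    = polysum (fun k => (r k)^`(j)) z.
  by apply: filterS (near_norm_lt1 x1) => z; exact: IH.
rewrite (near_eq_derive _ near_eq).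
have [_ ->] := is_derive_polysum (iter_deriv_geometric j gr) x1.
by congr (polysum _ x); apply/funext => k; rewrite derivnS.
Qed.

Lemma derivable_derive1n_polysum r j (x : C) : geometric_polys r -> `|x| < 1 ->
  derivable (derive1n j (polysum r)) x 1.
Proof.
move=> gr x1.
have near_eq : \forall z \near x, polysum (fun k => (r k)^`(j)) z
    = derive1n j (polysum r) z.
  by apply: filterS (near_norm_lt1 x1) => z z1; rewrite derive1n_polysum.
have [dj _] := is_derive_polysum (iter_deriv_geometric j gr) x1.
exact: near_eq_derivable near_eq dj.
Qed.

End PolynomialSeries.

(** * Weighted walks and their functional equation *)

Section WalkRecursion.
Variable d : int * int -> rat.

(** The point from which the step s leads to p; None when it lies outside the quarter
    plane. *)
Definition pre_step (p : nat * nat) (s : int * int) : option (nat * nat) :=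
  match (p.1%:Z - s.1)%R, (p.2%:Z - s.2)%R with
  | Posz a, Posz b => Some (a, b)
  | _, _ => None
  end.

Definition steps : seq (int * int) := [seq (a, b) | a <- axis_steps, b <- axis_steps].

Definition preds (p : nat * nat) : seq (nat * nat) := pmap (pre_step p) steps.

Arguments preds : simpl never.

Lemma pre_stepE p q s : (pre_step p s == Some q) = (step q p == s).
Proof.
case: p q s => [p1 p2] [q1 q2] [s1 s2]; rewrite /pre_step /step /=.
apply/eqP/eqP.
  case E1 : (p1%:Z - s1) => [a|a] //; case E2 : (p2%:Z - s2) => [b|b] //.
  by move=> [<- <-]; rewrite -E1 -E2 !opprB !addrA ![_ + s1]addrC ![_ + s2]addrC !addrK.
by move=> [<- <-]; rewrite !opprB ![p1%:Z + _]addrC ![p2%:Z + _]addrC !subrK.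
Qed.

Lemma mem_steps s : (s \in steps) = small_step s.
Proof.
case: s => a b; rewrite /small_step /=; apply/allpairsP/andP => [[[u v] /= [uP vP [-> ->]]] //|[aP bP]].
by exists (a, b).
Qed.

Lemma mem_preds p q : (q \in preds p) = small_step (step q p).
Proof.
rewrite /preds mem_pmap -mem_steps; apply/mapP/idP => [[s sP E]|sP].
  have /eqP := esym E.
  by rewrite pre_stepE => /eqP ->.
by exists (step q p) => //; apply/esym/eqP; rewrite pre_stepE.
Qed.

Lemma preds_uniq p : uniq (preds p).
Proof.
apply: (@pmap_uniq _ _ _ (fun q => step q p)).
  move=> s; case E : (pre_step p s) => [q|] //=.
  by apply/eqP; rewrite -pre_stepE E.
by [].
Qed.

Fixpoint walk_list (k : nat) (p : nat * nat) : seq (k.+1.-tuple (nat * nat)) :=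
  match k with
  | 0 => if p == (0%N, 0%N) then [:: [tuple p]] else [::]
  | k'.+1 => [seq rcons_tuple w p | q <- preds p, w <- walk_list k' q]
  end.

Arguments walk_list : simpl never.

Lemma walk_listS k p : walk_list k.+1 p =
  [seq rcons_tuple w p | q <- preds p, w <- walk_list k q].
Proof. by []. Qed.

Lemma mem_walk_list k p w : (w \in walk_list k p) <-> walks k p.1 p.2 w.
Proof.
elim: k p w => [|k IH] p w.
  rewrite /walks /walk_list /=; split.
    case: eqP => // ->; rewrite inE => /eqP -> /=; by split.
  move=> [w0 _ wp]; have -> : p = (0%N, 0%N) by rewrite -w0 wp; case: p {wp}.
  rewrite eqxx inE; apply/eqP/val_inj => /=.
  by case/tupleP: w w0 {wp} => x w; rewrite tuple0 /= => ->.
have nth_rc (w' : k.+1.-tuple (nat * nat)) x r : (r <= k)%N ->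
    nth (0%N, 0%N) (rcons w' x) r = nth (0%N, 0%N) w' r.
  by move=> rk; rewrite nth_rcons size_tuple ltnS rk.
have nth_last (w' : k.+1.-tuple (nat * nat)) x :
    nth (0%N, 0%N) (rcons w' x) k.+1 = x.
  by rewrite nth_rcons size_tuple ltnn eqxx.
rewrite walk_listS; split.
  move=> /allpairsPdep[q [w' [qp w'q ->]]] /=.
  move: qp; rewrite mem_preds => qp; have [w0 ws wk] := (IH q w').1 w'q.
  split; first by rewrite nth_rc.
    move=> r; rewrite ltnS leq_eqVlt => /orP[/eqP->|rk].
      by rewrite nth_last nth_rc // wk; case: q qp {w'q wk}.
    by rewrite !nth_rc // ?ws // ltnW.
  by rewrite nth_last; case: p {qp}.
move=> [w0 ws wk].
have [w' [x Ew]] : exists (w' : k.+1.-tuple (nat * nat)) x, w = rcons_tuple w' x.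
  have sz : size (belast (thead w) (behead w)) == k.+1.
    by rewrite size_belast size_behead size_tuple.
  exists (Tuple sz), (last (thead w) (behead w)); apply: val_inj => /=.
  by rewrite -lastI; case/tupleP: w {w0 ws wk sz} => y w; rewrite theadE.
move: w0 ws wk; rewrite Ew [tval _]/= nth_last nth_rc // => w0 ws xp.
apply/allpairsPdep; exists (nth (0%N, 0%N) w' k), w'; split.
- rewrite mem_preds; have := ws k (ltnSn _); rewrite nth_last nth_rc // xp.
  by case: (p).
- apply/IH; split=> //.
    by move=> r rk; have := ws r (leqW rk); rewrite !nth_rc // ltnW.
  by case: (nth _ _ k).
- by rewrite xp; case: (p).
Qed.

Lemma walk_list_uniq k p : uniq (walk_list k p).
Proof.
elim: k p => [|k IH] p; first by rewrite /walk_list; case: ifP.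
rewrite walk_listS.
apply: allpairs_uniq_dep => [|q _|]; [exact: preds_uniq|exact: IH|].
move=> [q w] [q' w'] /allpairsPdep[q1 [w1 [_ w1P E1]]] /allpairsPdep[q2 [w2 [_ w2P E2]]] /=.
move=> E; have Eww : w = w'.
  apply: val_inj; have := congr1 val E => /= /eqP.
  by rewrite eqseq_rcons => /andP[/eqP].
have lq q0 (w0 : k.+1.-tuple (nat * nat)) : w0 \in walk_list k q0 ->
    nth (0%N,0%N) w0 k = q0.
  by move=> /mem_walk_list[_ _]; case: q0.
move: E1 E2 w1P w2P => [<- <-] [<- <-] /lq qE /lq qE'.
by move: qE; rewrite Eww qE' => ->.
Qed.

Lemma walk_coefE i j k :
  walk_coef d i j k = \sum_(w <- walk_list k (i, j)) walk_weight d w.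
Proof.
rewrite /walk_coef [RHS]fsbig_seq; last exact: walk_list_uniq.
apply: eq_fsbigl; apply/seteqP; split=> w /=.
  by move=> h; apply/(@mem_walk_list k (i, j)).
by move/(@mem_walk_list k (i, j)).
Qed.

Lemma walk_weight_rcons k (w : k.+1.-tuple (nat * nat)) p :
  walk_weight d (rcons_tuple w p) =
  walk_weight d w * d (step (nth (0%N, 0%N) w k) p).
Proof.
rewrite /walk_weight big_ord_recr /= !nth_rcons !size_tuple ltnSn ltnn eqxx.
congr (_ * _); apply: eq_bigr => r _; rewrite !nth_rcons !size_tuple.
by rewrite !ltnS ltn_ord (ltnW (ltn_ord r)).
Qed.

Lemma walk_coefS_steps i j k : walk_coef d i j k.+1 =
  \sum_(s <- steps)
    oapp (fun q => d s * walk_coef d q.1 q.2 k) 0 (pre_step (i, j) s).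
Proof.
rewrite walk_coefE walk_listS big_allpairs_dep /= /preds big_pmap.
apply: eq_bigr => s _; case E : (pre_step (i, j) s) => [q|] //=.
have /eqP sE : step q (i, j) == s by rewrite -pre_stepE E.
rewrite walk_coefE -surjective_pairing mulr_sumr; apply: eq_big_seq => w.
move=> /mem_walk_list[_ _ wk]; rewrite walk_weight_rcons wk -surjective_pairing.
by rewrite sE mulrC.
Qed.

Lemma walk_coef0 i j : walk_coef d i j 0 = ((i == 0) && (j == 0))%N%:R.
Proof.
rewrite walk_coefE /walk_list; case: eqP => [[-> ->]|ij].
  by rewrite big_seq1 /walk_weight big_ord0.
rewrite big_nil; case: andP => // -[/eqP i0 /eqP j0].
by case: ij; rewrite i0 j0.
Qed.

Hypotheses (dmm : d (-1, -1) = 0) (dm0 : d (-1, 0) = 0) (d0m : d (0, -1) = 0).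

Lemma walk_coefS i j k : walk_coef d i j k.+1 =
  d (0, 0) * walk_coef d i j k
  + (if i is i'.+1 then d (1, 0) * walk_coef d i' j k
       + d (1, -1) * walk_coef d i' j.+1 k
       + (if j is j'.+1 then d (1, 1) * walk_coef d i' j' k else 0) else 0)
  + (if j is j'.+1 then d (0, 1) * walk_coef d i j' k
       + d (-1, 1) * walk_coef d i.+1 j' k else 0).
Proof.
have some p s q : step q p = s -> pre_step p s = Some q.
  by move=> E; apply/eqP; rewrite pre_stepE E.
have none1 b j' : pre_step (0%N, j') (1, b) = None by [].
have none2 i' a : pre_step (i', 0%N) (a, 1) = None.
  by rewrite /pre_step /=; case: (_ - _).
have nul s : d s = 0 ->
    oapp (fun q => d s * walk_coef d q.1 q.2 k) 0 (pre_step (i, j) s) = 0.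
  by move=> ds; case: (pre_step _ _) => //= q; rewrite ds mul0r.
rewrite walk_coefS_steps /steps /axis_steps /= !big_cons big_nil.
rewrite (nul _ dmm) (nul _ dm0) (nul _ d0m) !add0r (some (i, j) (0, 0) (i, j)); last by rewrite /step !subrr.
rewrite [oapp _ _ (Some _)]/=.
by case: i {nul} => [|i]; case: j => [|j]; rewrite ?none1 ?none2 /=
  ?subn1 ?addn1 ?addn0 ?add0n /=; ring.
Qed.

Hypothesis d_ge0 : forall s, small_step s -> 0 <= d s.

Lemma walk_coef_ge0 i j k : 0 <= walk_coef d i j k.
Proof.
elim: k i j => [|k IH] i j; first by rewrite walk_coef0 ler0n.
rewrite walk_coefS_steps big_seq; apply: sumr_ge0 => s; rewrite mem_steps => ss.
by case: (pre_step _ _) => //= q; rewrite mulr_ge0 ?d_ge0.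
Qed.

Lemma walk_coef_support i j k : (k < maxn i j)%N -> walk_coef d i j k = 0.
Proof.
elim: k i j => [|k IH] i j.
  by rewrite walk_coef0; case: i j => [|i] [|j].
rewrite leq_max => ij.
have IH' i' j' : (i <= i'.+1)%N -> (j <= j'.+1)%N -> walk_coef d i' j' k = 0.
  move=> ii jj; apply: IH; rewrite leq_max.
  by case/orP: ij => h; [rewrite -ltnS (leq_trans h ii)|
    rewrite -[(k < j')%N]ltnS (leq_trans h jj) orbT].
rewrite walk_coefS IH' ?leqnSn // mulr0 add0r.
by case: i IH' {ij} => [|i] IH'; case: j IH' => [|j] IH';
  rewrite ?IH' ?mulr0 ?addr0 ?ltnS ?leqnSn // ?(leqW (leqnSn _)).
Qed.

End WalkRecursion.

Section WalkGeneratingFunctions.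
Variables (C : numFieldType) (d : int * int -> rat).
Hypothesis d_weight : is_weight d.
Hypotheses (dmm : d (-1, -1) = 0) (dm0 : d (-1, 0) = 0) (d0m : d (0, -1) = 0).

Local Notation dC s := (@ratr C (d s)).
Definition wc (k i j : nat) : C := ratr (walk_coef d i j k).

Lemma sum_shift (g : nat -> C) M z :
  \sum_(j < M.+1) (if val j is j'.+1 then g j' else 0) * z ^+ j =
  z * \sum_(j < M) g j * z ^+ j.
Proof.
rewrite big_ord_recl /= mul0r add0r mulr_sumr; apply: eq_bigr => j _ /=.
by rewrite add0n exprS mulrCA.
Qed.

Lemma sum_unshift (g : nat -> C) M z :
  z * \sum_(j < M) g j.+1 * z ^+ j = \sum_(j < M.+1) g j * z ^+ j - g 0%N.
Proof.
rewrite [in RHS]big_ord_recl expr0 mulr1 addrAC subrr add0r mulr_sumr.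
by apply: eq_bigr => j _; rewrite lift0 exprS mulrCA.
Qed.

Lemma sum_wide (g : nat -> C) m N : (m <= N)%N ->
  (forall i, (m <= i)%N -> g i = 0) -> \sum_(i < N) g i = \sum_(i < m) g i.
Proof.
move=> mN g0; rewrite (big_ord_widen N g mN) [RHS]big_mkcond.
by apply: eq_bigr => i _; case: ltnP => // /g0.
Qed.

Lemma wc_ge0 k i j : 0 <= wc k i j.
Proof.
rewrite ler0q; apply: walk_coef_ge0 => // s ss.
by case: d_weight => /(_ s ss) /andP[].
Qed.

Lemma wc_support k i j : (k < maxn i j)%N -> wc k i j = 0.
Proof. by move=> h; rewrite /wc walk_coef_support ?rmorph0. Qed.

Lemma wcS k i j : wc k.+1 i j =
  dC (0, 0) * wc k i j
  + (if i is i'.+1 then dC (1, 0) * wc k i' j + dC (1, -1) * wc k i' j.+1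
       + (if j is j'.+1 then dC (1, 1) * wc k i' j' else 0) else 0)
  + (if j is j'.+1 then dC (0, 1) * wc k i j' + dC (-1, 1) * wc k i.+1 j' else 0).
Proof.
rewrite /wc walk_coefS //; case: i => [|i]; case: j => [|j];
  by rewrite !(rmorphD, rmorphM, rmorph0).
Qed.

(** The contribution of walks of length k to Q: wgf sums over all endpoints, wgf_x and
    wgf_y over those on an axis.  The coordinates of an endpoint are at most k, so these
    are polynomials. *)
Definition wrow (y : C) k i : C := \sum_(j < k.+1) wc k i j * y ^+ j.
Definition wgf (x y : C) k : C := \sum_(i < k.+1) wrow y k i * x ^+ i.
Definition wgf_x (x : C) k : C := \sum_(i < k.+1) wc k i 0 * x ^+ i.
Definition wgf_y (y : C) k : C := \sum_(j < k.+1) wc k 0 j * y ^+ j.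

(** The step polynomial multiplied by x y. *)
Definition kernel_S (x y : C) : C :=
  dC (1, -1) * x ^+ 2 + dC (-1, 1) * y ^+ 2 + dC (0, 0) * x * y
  + dC (0, 1) * x * y ^+ 2 + dC (1, 0) * x ^+ 2 * y
  + dC (1, 1) * x ^+ 2 * y ^+ 2.

Lemma wrow_wide y k i M : (k < M)%N -> \sum_(j < M) wc k i j * y ^+ j = wrow y k i.
Proof.
move=> kM; rewrite /wrow (@sum_wide (fun j => wc k i j * y ^+ j) k.+1) // => j kj.
by rewrite wc_support ?mul0r // leq_max kj orbT.
Qed.

Lemma wrow_support y k i : (k < i)%N -> wrow y k i = 0.
Proof.
by move=> ki; rewrite /wrow big1 // => j _; rewrite wc_support ?mul0r // leq_max ki.
Qed.

Lemma wgf_wide x y k M : (k < M)%N -> \sum_(i < M) wrow y k i * x ^+ i = wgf x y k.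
Proof.
move=> kM; rewrite /wgf (@sum_wide (fun i => wrow y k i * x ^+ i) k.+1) // => i ki.
by rewrite wrow_support ?mul0r.
Qed.

Lemma wrowS y k i : y * wrow y k.+1 i =
  y * (dC (0, 0) * wrow y k i)
  + (if i is i'.+1 then (y * dC (1, 0) + y ^+ 2 * dC (1, 1) + dC (1, -1)) * wrow y k i'
       - dC (1, -1) * wc k i' 0 else 0)
  + y ^+ 2 * (dC (0, 1) * wrow y k i + dC (-1, 1) * wrow y k i.+1).
Proof.
pose F1 j := dC (0, 0) * wc k i j.
pose F2 j := if i is i'.+1 then dC (1, 0) * wc k i' j else 0.
pose F3 j := if i is i'.+1 then dC (1, -1) * wc k i' j.+1 else 0.
pose F4 j := if i is i'.+1 then dC (1, 1) * wc k i' j else 0.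
pose F5 j := dC (0, 1) * wc k i j + dC (-1, 1) * wc k i.+1 j.
have E : wrow y k.+1 i = \sum_(j < k.+2) F1 j * y ^+ j + \sum_(j < k.+2) F2 j * y ^+ j
   + \sum_(j < k.+2) F3 j * y ^+ j
   + \sum_(j < k.+2) (if val j is j'.+1 then F4 j' else 0) * y ^+ j
   + \sum_(j < k.+2) (if val j is j'.+1 then F5 j' else 0) * y ^+ j.
  rewrite -!big_split /=; apply: eq_bigr => j _; rewrite wcS -!mulrDl; congr (_ * _).
  rewrite /F1 /F2 /F3 /F4 /F5; case: (i) => [|i']; case: (val j) => [|j'];
    by rewrite ?addr0 ?addrA.
have mulsum (z : C) (h : nat -> C) M :
    \sum_(j < M) z * h j * y ^+ j = z * \sum_(j < M) h j * y ^+ j.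
  by rewrite mulr_sumr; apply: eq_bigr => j _; rewrite mulrA.
rewrite E !sum_shift {E} /F1 mulsum wrow_wide; last exact: leqnSn.
have -> : \sum_(j < k.+1) F5 j * y ^+ j =
    dC (0, 1) * wrow y k i + dC (-1, 1) * wrow y k i.+1.
  rewrite -!mulsum -big_split; apply: eq_bigr => j _ /=.
  by rewrite /F5 mulrDl.
rewrite /F2 /F3 /F4; case: (i) => [|i'] /=.
  have z M : \sum_(j < M) 0 * y ^+ j = 0 :> C by rewrite big1 // => j _; rewrite mul0r.
  by rewrite !z; ring.
rewrite (mulsum _ (fun j => wc k i' j.+1)) !mulsum (wrow_wide _ _ (leqnSn k.+1)).
have U := sum_unshift (fun j => wc k i' j) k.+2 y.
rewrite wrow_wide in U; last by rewrite ltnS leqW.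
rewrite !mulrDr [y * (dC (1, -1) * _)]mulrCA U -/(wrow y k i').
by ring.
Qed.

(** The recursion on the last step, summed over the endpoints; the steps (1,-1) and (-1,1)
    cannot be taken from the axes j = 0 and i = 0 respectively, whence the two
    corrections. *)
Lemma wgfS x y k : x * y * wgf x y k.+1 =
  kernel_S x y * wgf x y k - dC (1, -1) * x ^+ 2 * wgf_x x k
  - dC (-1, 1) * y ^+ 2 * wgf_y y k.
Proof.
pose G i := (y * dC (1, 0) + y ^+ 2 * dC (1, 1) + dC (1, -1)) * wrow y k i
  - dC (1, -1) * wc k i 0.
have mulsum (z : C) (h : nat -> C) M :
    \sum_(j < M) z * h j * x ^+ j = z * \sum_(j < M) h j * x ^+ j.
  by rewrite mulr_sumr; apply: eq_bigr => j _; rewrite mulrA.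
have E : y * wgf x y k.+1 =
    \sum_(i < k.+2) (y * dC (0, 0) + y ^+ 2 * dC (0, 1)) * wrow y k i * x ^+ i
  + \sum_(i < k.+2) (if val i is i'.+1 then G i' else 0) * x ^+ i
  + \sum_(i < k.+2) y ^+ 2 * dC (-1, 1) * wrow y k i.+1 * x ^+ i.
  rewrite /wgf mulr_sumr -!big_split /=; apply: eq_bigr => i _.
  rewrite mulrA wrowS -!mulrDl; congr (_ * _).
  by rewrite /G; case: (val i) => [|i']; ring.
rewrite -mulrA E (mulsum _ (wrow y k)) (mulsum _ (fun i => wrow y k i.+1)).
rewrite sum_shift wgf_wide; last exact: leqnSn.
have U := sum_unshift (fun i => wrow y k i) k.+2 x.
rewrite wgf_wide in U; last by rewrite ltnS leqW.
have -> : \sum_(i < k.+1) G i * x ^+ i =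
    (y * dC (1, 0) + y ^+ 2 * dC (1, 1) + dC (1, -1)) * wgf x y k
    - dC (1, -1) * wgf_x x k.
  rewrite -(mulsum _ (wrow y k)) -(mulsum _ (fun i => wc k i 0)) -sumrB.
  apply: eq_bigr => i _ /=.
  by rewrite /G mulrBl.
rewrite [LHS]mulrDr [X in _ + X]mulrCA U /kernel_S.
by rewrite -[wrow y k 0]/(wgf_y y k); ring.
Qed.

Lemma weight_sum : dC (1, -1) + dC (-1, 1) + dC (0, 0) + dC (0, 1) + dC (1, 0)
  + dC (1, 1) = 1.
Proof.
have [_] := d_weight; rewrite /axis_steps !big_cons !big_nil dmm dm0 d0m.
rewrite !addr0 !add0r => /(congr1 (@ratr C)); rewrite !rmorphD rmorph1 /= => <-.
by ring.
Qed.

Lemma dC_ge0 s : small_step s -> 0 <= dC s.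
Proof. by move=> ss; rewrite ler0q; case: d_weight => /(_ s ss) /andP[]. Qed.

Lemma wgf0 x y : wgf x y 0 = 1.
Proof.
by rewrite /wgf /wrow !big_ord1 !expr0 !mulr1 /wc walk_coef0 /= rmorph1.
Qed.

(** The weights of the walks of length k sum to at most 1: multiplying the total weight by
    the sum of the weights of the steps, which is 1, also counts the walks that leave
    the quarter plane. *)
Lemma wgf11_le1 k : wgf 1 1 k <= 1.
Proof.
elim: k => [|k IH]; first by rewrite wgf0.
have := wgfS 1 1 k; rewrite /kernel_S !expr1n !mulr1 !mul1r weight_sum mul1r => ->.
have s1 : small_step (1, -1) by [].
have s2 : small_step (-1, 1) by [].
apply: le_trans IH; rewrite -addrA gerDl -opprD oppr_le0.
rewrite addr_ge0 // mulr_ge0 ?dC_ge0 // sumr_ge0 // => i _;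
  by rewrite expr1n mulr1 wc_ge0.
Qed.

Lemma wgf_norm_le (x y : C) k : `|x| <= 1 -> `|y| <= 1 -> `|wgf x y k| <= 1.
Proof.
move=> x1 y1; apply: le_trans (wgf11_le1 k).
apply: le_trans (ler_norm_sum _ _ _) _; apply: ler_sum => i _.
rewrite normrM expr1n; apply: ler_pM => //; last by rewrite normrX exprn_ile1.
apply: le_trans (ler_norm_sum _ _ _) _; apply: ler_sum => j _.
rewrite normrM expr1n ger0_norm ?wc_ge0 //; apply: ler_pM => //.
  exact: wc_ge0.
by rewrite normrX exprn_ile1.
Qed.

Lemma wc_le1 k i j : wc k i j <= 1.
Proof.
have [ij|ij] := ltnP k (maxn i j); first by rewrite wc_support.
apply: le_trans (wgf11_le1 k); move: ij; rewrite geq_max => /andP[ik jk].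
rewrite /wgf (bigD1 (Ordinal (ik : (i < k.+1)%N))) //=.
rewrite /wrow (bigD1 (Ordinal (jk : (j < k.+1)%N))) //= !expr1n !mulr1.
rewrite -addrA lerDl addr_ge0 // sumr_ge0 // => l _; rewrite expr1n mulr1 ?wc_ge0 //.
by rewrite sumr_ge0 // => m _; rewrite expr1n mulr1 wc_ge0.
Qed.

End WalkGeneratingFunctions.

Section FunctionalEquation.
Variables (R : realType) (d : int * int -> rat).
Local Notation C := (R[i] : numFieldType).
Variable t : C.
Hypotheses (t_ge0 : 0 <= t) (t_lt1 : t < 1).
Hypothesis d_weight : is_weight d.
Hypotheses (dmm : d (-1, -1) = 0) (dm0 : d (-1, 0) = 0) (d0m : d (0, -1) = 0).
Local Notation dC s := (@ratr C (d s)).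

(** The coefficient of t^k in Q(x,0,t), times t^k. *)
Definition xpoly (k : nat) : {poly C} := t ^+ k *: \poly_(i < k.+1) wc C d k i 0.
Definition ypoly (k : nat) : {poly C} := t ^+ k *: \poly_(i < k.+1) wc C d k 0 i.

Lemma geometric_scaled_polys (c : nat -> nat -> C) :
  (forall k i, 0 <= c k i <= 1) ->
  geometric_polys (fun k => t ^+ k *: \poly_(i < k.+1) c k i).
Proof.
move=> c01; split=> [k|].
  exact: leq_trans (size_scale_leq _ _) (size_poly _ _).
exists 1, t; split=> [||k i]; [exact: ler01|by rewrite t_ge0|].
rewrite mul1r coefZ coef_poly normrM normrX (ger0_norm t_ge0).
rewrite -[leRHS]mulr1 ler_wpM2l ?exprn_ge0 //; case: ifP => _.
  by have /andP[c0 c1] := c01 k i; rewrite ger0_norm.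
by rewrite normr0 ler01.
Qed.

Lemma geometric_xpoly : geometric_polys xpoly.
Proof.
by apply: geometric_scaled_polys => k i; rewrite wc_ge0 //= wc_le1.
Qed.

Lemma geometric_ypoly : geometric_polys ypoly.
Proof.
by apply: geometric_scaled_polys => k i; rewrite wc_ge0 //= wc_le1.
Qed.

Lemma horner_xpoly k (x : C) : (xpoly k).[x] = t ^+ k * wgf_x d x k.
Proof. by rewrite hornerZ horner_poly. Qed.

Lemma horner_ypoly k (y : C) : (ypoly k).[y] = t ^+ k * wgf_y d y k.
Proof. by rewrite hornerZ horner_poly. Qed.

(** Walks of length k < n end in the square i, j <= k, so the sum over a cube is a partial
    sum of the series of the xpoly_k. *)
Lemma walk_gf_x : (fun x : C => walk_gf d x 0 t) = polysum xpoly.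
Proof.
apply/funext => x; rewrite /walk_gf /polysum; congr (lim (_ @ \oo)).
apply/funext => -[|n]; first by rewrite /psum !big_ord0.
rewrite /psum; under eq_bigr => i _.
  rewrite big_ord_recl [X in _ + X]big1 ?addr0; last first.
    by move=> j _; rewrite big1 // => k _; rewrite expr0n /= mulr0 mul0r.
  under eq_bigr do rewrite expr0 mulr1.
  over.
rewrite exchange_big /=; apply: eq_bigr => k _; rewrite horner_xpoly /wgf_x.
rewrite mulr_sumr (@sum_wide C (fun i => ratr (walk_coef d i 0 k) * x ^+ i * t ^+ k) k.+1).
- by apply: eq_bigr => i _; rewrite mulrC.
- exact: ltn_ord.
- move=> i ki; have := @wc_support C d dmm dm0 d0m k i 0.
  by rewrite /wc maxn0 => -> //; rewrite !mul0r.
Qed.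

Lemma walk_gf_y : (fun y : C => walk_gf d 0 y t) = polysum ypoly.
Proof.
apply/funext => x; rewrite /walk_gf /polysum; congr (lim (_ @ \oo)).
apply/funext => -[|n]; first by rewrite /psum !big_ord0.
rewrite /psum big_ord_recl [X in _ + X]big1 ?addr0; last first.
  move=> i _; rewrite big1 // => j _; rewrite big1 // => k _.
  by rewrite expr0n /= mulr0 !mul0r.
rewrite exchange_big /=; apply: eq_bigr => k _; rewrite horner_ypoly /wgf_y.
rewrite mulr_sumr.
rewrite (@sum_wide C (fun i => ratr (walk_coef d 0 i k) * 0 ^+ 0 * x ^+ i * t ^+ k) k.+1).
- by apply: eq_bigr => i _; rewrite expr0 mulr1 mulrC.
- exact: ltn_ord.
- move=> i ki; have := @wc_support C d dmm dm0 d0m k 0 i.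
  by rewrite /wc max0n => -> //; rewrite !mul0r.
Qed.

(** When t S = x y, the recursion on the length telescopes. *)
Lemma psum_functional_equation (x y : C) n : t * kernel_S d x y = x * y ->
  t * dC (1, -1) * x ^+ 2 * psum (fun k => (xpoly k).[x]) n
  + t * dC (-1, 1) * y ^+ 2 * psum (fun k => (ypoly k).[y]) n
  = x * y - x * y * (t ^+ n * wgf d x y n).
Proof.
move=> ker; rewrite /psum; elim: n => [|n IH].
  by rewrite !big_ord0 wgf0 expr0 !mulr1 !mulr0 addr0 subrr.
rewrite !big_ord_recr /= !mulrDr addrACA IH horner_xpoly horner_ypoly.
have E := wgfS dmm dm0 d0m x y n.
have -> : x * y * (t ^+ n.+1 * wgf d x y n.+1) =
    t ^+ n * (t * (x * y * wgf d x y n.+1)) by rewrite exprS; ring.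
rewrite E -ker; ring.
Qed.

Lemma cvg_geometric_bounded (u : nat -> C) : (forall n, `|u n| <= 1) ->
  (fun n => t ^+ n * u n) @ \oo --> (0 : C).
Proof.
move=> u1; pose w n := t ^+ n * u n.
have t01 : 0 <= t < 1 by rewrite t_ge0.
have wb k : `|w k| <= 1 * t ^+ k.
  rewrite mul1r normrM normrX (ger0_norm t_ge0) -[leRHS]mulr1.
  by rewrite ler_wpM2l ?exprn_ge0.
have /cvg_ex[l wl] := geometric_cvg t01 wb.
have wSl : (fun n => psum w n.+1) @ \oo --> l by rewrite (cvg_shiftS (psum w)).
have -> : (fun n => t ^+ n * u n) = (fun n => psum w n.+1 - psum w n).
  by apply/funext => n; rewrite /psum big_ord_recr /= addrAC subrr add0r.
by rewrite -[X in _ --> X](subrr l); exact: cvgB.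
Qed.

Lemma functional_equation (x y : C) : `|x| <= 1 -> `|y| <= 1 ->
  t * kernel_S d x y = x * y ->
  t * dC (1, -1) * x ^+ 2 * polysum xpoly x
  + t * dC (-1, 1) * y ^+ 2 * polysum ypoly y = x * y.
Proof.
move=> x1 y1 ker.
pose v n := t * dC (1, -1) * x ^+ 2 * psum (fun k => (xpoly k).[x]) n
  + t * dC (-1, 1) * y ^+ 2 * psum (fun k => (ypoly k).[y]) n.
have v1 : v @ \oo --> t * dC (1, -1) * x ^+ 2 * polysum xpoly x
    + t * dC (-1, 1) * y ^+ 2 * polysum ypoly y.
  apply: cvgD; apply: cvgM; [exact: cvg_cst| |exact: cvg_cst|].
    exact: polysum_cvg geometric_xpoly x1.
  exact: polysum_cvg geometric_ypoly y1.
have v2 : v @ \oo --> x * y.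
  have -> : v = (fun n => x * y - x * y * (t ^+ n * wgf d x y n)).
    by apply/funext => n; exact: psum_functional_equation.
  rewrite -[X in _ --> X]subr0 -[X in _ --> _ - X](mulr0 (x * y)).
  apply: cvgB; first exact: cvg_cst.
  apply: cvgM; first exact: cvg_cst.
  by apply: cvg_geometric_bounded => n; apply: wgf_norm_le.
exact: (cvg_unique _ v1 v2).
Qed.

End FunctionalEquation.

(** * A transcendental parameter separates the poles *)

Section Transcendence.
Variables (C : numFieldType) (r : C).
Hypothesis r_tr : forall P : {poly rat}, P != 0 -> (map_poly ratr P).[r] != 0.

Local Notation "P .[[r]]" := ((map_poly (@ratr C) P).[r]) (at level 2, format "P .[[r]]").

Implicit Types P Q : {poly rat}.

Lemma evalrD P Q : (P + Q).[[r]] = P.[[r]] + Q.[[r]].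
Proof. by rewrite rmorphD hornerD. Qed.
Lemma evalrN P : (- P).[[r]] = - P.[[r]].
Proof. by rewrite rmorphN hornerN. Qed.
Lemma evalrM P Q : (P * Q).[[r]] = P.[[r]] * Q.[[r]].
Proof. by rewrite rmorphM hornerM. Qed.
Lemma evalrXn P n : (P ^+ n).[[r]] = P.[[r]] ^+ n.
Proof. by rewrite rmorphXn horner_exp. Qed.
Lemma evalrC c : c%:P.[[r]] = ratr c.
Proof. by rewrite map_polyC hornerC. Qed.
Lemma evalrX : 'X.[[r]] = r.
Proof. by rewrite map_polyX hornerX. Qed.
Definition evalrE := (evalrD, evalrN, evalrM, evalrXn, evalrC, evalrX).

Lemma evalr_sub2 P Q : (P - 2%:P * Q).[[r]] = P.[[r]] - 2 * Q.[[r]].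
Proof. by rewrite evalrD evalrN evalrM evalrC rmorph_nat. Qed.

(** Every contradiction below is a polynomial in r whose degree can be computed. *)
Lemma evalr_add_neq0 P Q : (size Q < size P)%N -> P.[[r]] + Q.[[r]] != 0.
Proof.
move=> QP; rewrite -evalrD; apply: r_tr; rewrite -size_poly_gt0 size_polyDl //.
exact: leq_ltn_trans QP.
Qed.

Variables (a b c10 c01 c11 : rat) (q : C).
Hypotheses (a0 : a != 0) (b0 : b != 0) (q0 : q != 0).
Hypothesis qE : q + q^-1 = r ^+ 2 / ratr (a * b) - 2.

Definition rho_poly : {poly rat} := (a * b)^-1 *: 'X^2 - 2%:P.

(** Rescaled Chebyshev polynomials: tau_n(r) = q^n + q^-n.  Being of degree 2 n in r, they
    dominate the other terms of a coincidence between poles. *)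
Fixpoint tau_pair (n : nat) : {poly rat} * {poly rat} :=
  if n is n'.+1 then let: (u, v) := tau_pair n' in (v, rho_poly * v - u)
  else (2%:P, rho_poly).
Definition tau n := (tau_pair n).1.

Lemma ab0 : a * b != 0. Proof. by rewrite mulf_neq0. Qed.

Lemma size_rho : size rho_poly = 3.
Proof.
rewrite /rho_poly size_polyDl size_scale ?size_polyXn ?invr_eq0 ?ab0 //.
by rewrite size_polyN (leq_ltn_trans (size_polyC_leq1 _)).
Qed.

Lemma tau_pairP n : size (tau_pair n).1 = n.*2.+1 /\ size (tau_pair n).2 = n.*2.+3.
Proof.
elim: n => [|n IH] /=; first by rewrite size_rho size_polyC.
case: (tau_pair n) IH => u v /= [su sv]; split=> //.
have v0 : v != 0 by rewrite -size_poly_gt0 sv.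
have rho0 : rho_poly != 0 by rewrite -size_poly_gt0 size_rho.
have s1 : size (rho_poly * v) = n.+1.*2.+3.
  by rewrite size_mul // size_rho sv doubleS.
by rewrite size_polyDl s1 // size_polyN su doubleS !ltnS -addn3 leq_addr.
Qed.

Lemma size_tau n : size (tau n) = n.*2.+1.
Proof. by have [] := tau_pairP n. Qed.

Lemma tau_eval n : (tau n).[[r]] = q ^+ n + q ^- n.
Proof.
have rhoE : rho_poly.[[r]] = q + q^-1.
  by rewrite /rho_poly -mul_polyC !evalrE qE fmorphV /= rmorph_nat mulrC.
suff [] : (tau_pair n).1.[[r]] = q ^+ n + q ^- n /\
   (tau_pair n).2.[[r]] = q ^+ n.+1 + q ^- n.+1 by [].
elim: n => [|n IH] /=; first by rewrite rhoE expr1 !expr0 invr1 evalrC rmorph_nat.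
case: (tau_pair n) IH => u v /= [Eu Ev]; split=> //.
rewrite evalrD evalrN evalrM rhoE Eu Ev !exprS; have qn : q ^+ n != 0 by rewrite expf_neq0.
by field; rewrite q0 qn.
Qed.

Lemma q_not_root_of_unity n : q ^+ n.+1 != 1.
Proof.
apply: contraTneq isT => E; have := tau_eval n.+1; rewrite E invr1.
have : (size (- 2%:P : {poly rat}) < size (tau n.+1))%N.
  by rewrite size_polyN size_tau (leq_ltn_trans (size_polyC_leq1 _)).
move/evalr_add_neq0 => + H; rewrite H !evalrE rmorph_nat => /eqP; case.
by rewrite -[1 + 1]/(2 : C) subrr.
Qed.

(** With p, p' the poles of x and z, z' those of y, the values at r of these three
    polynomials determine the poles up to scaling and exchange:
    (p + p')^2 / (p p') = sumx_poly / (a prod_poly) and (z + z')^2 / (z z') = sumy_poly / (b prod_poly). *)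
Definition prod_poly : {poly rat} :=
  c11 *: 'X^2 + (c01 * c10) *: 'X + (a * c01 ^+ 2 + b * c10 ^+ 2 - 4 * a * b * c11)%:P.
Definition sumx_poly : {poly rat} := (c10 *: 'X + (2 * a * c01)%:P) ^+ 2.
Definition sumy_poly : {poly rat} := (c01 *: 'X + (2 * b * c10)%:P) ^+ 2.

Lemma size_linear_sqr (u v : rat) : (size ((u *: 'X + v%:P) ^+ 2) <= 3)%N.
Proof.
set w := u *: 'X + v%:P; have s : (size w <= 2)%N.
  rewrite /w (leq_trans (size_polyD _ _)) // geq_max (leq_trans (size_scale_leq _ _)) ?size_polyX //=.
  exact: leq_trans (size_polyC_leq1 _) _.
rewrite expr2 (leq_trans (size_mul_leq _ _)) //.
by case: (size w) s => [|[|[|n]]].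
Qed.

Lemma size_prod_poly : (size prod_poly <= 3)%N.
Proof.
rewrite (leq_trans (size_polyD _ _)) // geq_max; apply/andP; split.
  rewrite (leq_trans (size_polyD _ _)) // geq_max; apply/andP; split.
    by rewrite (leq_trans (size_scale_leq _ _)) ?size_polyXn.
  by rewrite (leq_trans (size_scale_leq _ _)) ?size_polyX.
exact: leq_trans (size_polyC_leq1 _) _.
Qed.

Lemma size_prod_poly3 : c11 != 0 -> size prod_poly = 3.
Proof.
move=> c0; rewrite /prod_poly -addrA size_polyDl size_scale // ?size_polyXn //.
rewrite (leq_ltn_trans (size_polyD _ _)) // gtn_max.
rewrite (leq_ltn_trans (size_scale_leq _ _)) ?size_polyX //=.
exact: leq_ltn_trans (size_polyC_leq1 _) _.
Qed.

Lemma size_prod_poly2 : c11 = 0 -> c01 != 0 -> c10 != 0 -> size prod_poly = 2.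
Proof.
move=> c0 c1 c2; rewrite /prod_poly c0 scale0r add0r size_polyDl size_scale ?mulf_neq0 //.
  by rewrite size_polyX.
by rewrite size_polyX (leq_ltn_trans (size_polyC_leq1 _)).
Qed.

(** A coincidence gives p/p' + p'/p = tau_(n+1)(r), where the left-hand side is a fraction in
    r of numerator of degree at most 2.  The product tau_(n+1) prod_poly has a greater
    degree. *)
Lemma x_poles_not_dilated (p p' : C) n : (2 <= size prod_poly)%N ->
  p != 0 -> p' != 0 ->
  (p + p') ^+ 2 * (ratr a * prod_poly.[[r]]) = sumx_poly.[[r]] * (p * p') ->
  p' <> q ^+ n.+1 * p /\ p <> q ^+ n.+1 * p'.
Proof.
move=> ek2 p0 p0' H.
suff key : p / p' + p' / p <> q ^+ n.+1 + q ^- n.+1.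
  have qn : q ^+ n.+1 != 0 by rewrite expf_neq0.
  split=> E; apply: key; rewrite E; field; rewrite ?p0 ?p0' ?qn //.
move=> E; have := tau_eval n.+1; rewrite -E => Et.
have : (tau n.+1).[[r]] * (ratr a * prod_poly.[[r]]) =
    sumx_poly.[[r]] - 2 * (ratr a * prod_poly.[[r]]).
  rewrite Et; have pp0 : p * p' != 0 by rewrite mulf_neq0.
  apply: (mulIf pp0); rewrite [RHS]mulrBl -H; field; by rewrite p0 p0'.
apply/eqP; rewrite -subr_eq0.
have -> : (tau n.+1).[[r]] * (ratr a * prod_poly.[[r]]) -
    (sumx_poly.[[r]] - 2 * (ratr a * prod_poly.[[r]])) =
    (tau n.+1 * (a *: prod_poly)).[[r]] + (- sumx_poly + 2%:P * (a *: prod_poly)).[[r]].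
  by rewrite -mul_polyC !evalrE rmorph_nat; ring.
apply: evalr_add_neq0.
have ek0 : a *: prod_poly != 0.
  by rewrite -size_poly_gt0 size_scale // (leq_trans _ ek2).
have tau0 : tau n.+1 != 0 by rewrite -size_poly_gt0 size_tau.
rewrite size_mul // size_tau size_scale // doubleS addSn /=.
apply: (@leq_ltn_trans 3); last by rewrite !addSn !ltnS (leq_trans ek2) // leq_addl.
rewrite (leq_trans (size_polyD _ _)) // geq_max size_polyN size_linear_sqr /=.
by rewrite mul_polyC (leq_trans (size_scale_leq _ _)) // size_scale // size_prod_poly.
Qed.

(** The relation between the traces of three matrices of determinant 1 with product 1,
    here diagonal. *)
Lemma chebyshev_triple (Q w : C) : Q != 0 -> w != 0 ->
  (Q + Q^-1) ^+ 2 + (Q * w + (Q * w)^-1) ^+ 2 + (w + w^-1) ^+ 2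
  - (Q + Q^-1) * (Q * w + (Q * w)^-1) * (w + w^-1) - 4 = 0.
Proof. by move=> Q0 w0; field; rewrite Q0 w0. Qed.

(** Otherwise the three quantities u + 1/u for u = Q, p/p' and z/z' = Q p/p' satisfy
    [chebyshev_triple].  The last two are fractions in r with denominators of degree
    exactly 2 and numerators of degree at most 2, so that once denominators are cleared
    the square of tau_(j+1)(r) = Q + 1/Q cannot be compensated. *)
Lemma pole_ratios_not_dilated (p p' z z' Q : C) j : c11 != 0 ->
  p != 0 -> p' != 0 -> z != 0 -> z' != 0 -> Q != 0 ->
  (p + p') ^+ 2 * (ratr a * prod_poly.[[r]]) = sumx_poly.[[r]] * (p * p') ->
  (z + z') ^+ 2 * (ratr b * prod_poly.[[r]]) = sumy_poly.[[r]] * (z * z') ->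
  Q + Q^-1 = (tau j.+1).[[r]] -> z * p' <> Q * p * z'.
Proof.
move=> c0 p0 p0' z0 z0' Q0 Hp Hz HQ E.
pose A := a *: prod_poly; pose B := b *: prod_poly.
pose Y := sumx_poly - 2%:P * A; pose X := sumy_poly - 2%:P * B.
have sek := size_prod_poly3 c0.
have sA : size A = 3 by rewrite size_scale.
have sB : size B = 3 by rewrite size_scale.
have sX : (size X <= 3)%N.
  rewrite (leq_trans (size_polyD _ _)) // geq_max size_polyN size_linear_sqr /=.
  by rewrite mul_polyC (leq_trans (size_scale_leq _ _)) // sB.
have sY : (size Y <= 3)%N.
  rewrite (leq_trans (size_polyD _ _)) // geq_max size_polyN size_linear_sqr /=.
  by rewrite mul_polyC (leq_trans (size_scale_leq _ _)) // sA.
pose w := p / p'; have w0 : w != 0 by rewrite mulf_neq0 ?invr_eq0.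
have AE : A.[[r]] = ratr a * prod_poly.[[r]] by rewrite /A -mul_polyC evalrM evalrC.
have BE : B.[[r]] = ratr b * prod_poly.[[r]] by rewrite /B -mul_polyC evalrM evalrC.
have YE : Y.[[r]] = (w + w^-1) * A.[[r]].
  rewrite /Y evalr_sub2 AE.
  have pp0 : p * p' != 0 by rewrite mulf_neq0.
  by apply: (mulIf pp0); rewrite mulrBl -Hp /w; field; rewrite p0 p0'.
have XE : X.[[r]] = (Q * w + (Q * w)^-1) * B.[[r]].
  have -> : Q * w = z / z'.
    rewrite /w mulrA; apply/eqP; rewrite eqr_div // -E; apply/eqP; ring.
  rewrite /X evalr_sub2 BE.
  have zz0 : z * z' != 0 by rewrite mulf_neq0.
  by apply: (mulIf zz0); rewrite mulrBl -Hz; field; rewrite z0 z0'.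
clearbody X Y; clearbody A B.
have := chebyshev_triple Q0 w0; rewrite HQ => F.
pose P1 := (tau j.+1 * (A * B)) ^+ 2.
pose P2 := (X * A) ^+ 2 + (Y * B) ^+ 2 - tau j.+1 * (X * Y * (A * B)) - 4%:P * (A * B) ^+ 2.
have : P1.[[r]] + P2.[[r]] = 0.
  rewrite /P1 /P2 !(evalrD, evalrN, evalrXn, evalrM, evalrC) rmorph_nat XE YE.
  have := congr1 (fun u => u * (A.[[r]] * B.[[r]]) ^+ 2) F; rewrite /= mul0r => <-.
  by ring.
apply/eqP/evalr_add_neq0.
have A0 : A != 0 by rewrite -size_poly_gt0 sA.
have B0 : B != 0 by rewrite -size_poly_gt0 sB.
have tau0 : tau j.+1 != 0 by rewrite -size_poly_gt0 size_tau.
have AB0 : A * B != 0 by rewrite mulf_neq0.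
have sAB : size (A * B) = 5 by rewrite size_mul // sA sB.
have smul (U V : {poly rat}) m n : (size U <= m.+1)%N -> (size V <= n.+1)%N ->
    (size (U * V)%R <= (m + n).+1)%N.
  move=> hU hV; rewrite (leq_trans (size_mul_leq _ _)) //.
  have := leq_add hU hV; rewrite addSn addnS.
  by case: (size U + size V)%N.
have s1 : size P1 = ((j.*2).*2 + 13)%N.
  rewrite /P1 expr2 size_mul ?mulf_neq0 // size_mul // size_tau sAB.
  by clear; lia.
rewrite s1; apply: (@leq_ltn_trans (j.*2 + 11)); last by clear; lia.
have sq8 (U V : {poly rat}) : (size U <= 3)%N -> (size V <= 3)%N ->
    (size ((U * V) ^+ 2)%R <= 9)%N.
  by move=> hU hV; rewrite expr2; apply: (@smul _ _ 4 4); exact: (@smul _ _ 2 2).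
have le9 : (9 <= j.*2 + 11)%N by clear; lia.
rewrite /P2 (leq_trans (size_polyD _ _)) // geq_max size_polyN; apply/andP; split.
  rewrite (leq_trans (size_polyD _ _)) // geq_max size_polyN; apply/andP; split.
    rewrite (leq_trans (size_polyD _ _)) // geq_max.
    by rewrite !(leq_trans (sq8 _ _ _ _)) ?sA ?sB.
  have := @smul (tau j.+1) (X * Y * (A * B)) (j.*2 + 2) 8.
  rewrite size_tau doubleS => H; apply: leq_trans (H _ _) _; try by clear; lia.
  by apply: (@smul _ _ 4 4); [exact: (@smul _ _ 2 2)|rewrite sAB].
rewrite mul_polyC (leq_trans (size_scale_leq _ _)) //.
by rewrite (leq_trans (sq8 _ _ _ _)) ?sA ?sB.
Qed.

(** If z = q^n p or p = q^n z, then the relation z z' = q p p' makes the ratio of z/z' to p/p' an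
    odd power of q, in particular different from 1. *)
Lemma xy_poles_not_dilated (p p' z z' : C) : c11 != 0 ->
  p != 0 -> p' != 0 -> z != 0 -> z' != 0 -> z * z' = q * (p * p') ->
  (p + p') ^+ 2 * (ratr a * prod_poly.[[r]]) = sumx_poly.[[r]] * (p * p') ->
  (z + z') ^+ 2 * (ratr b * prod_poly.[[r]]) = sumy_poly.[[r]] * (z * z') ->
  forall n, z <> q ^+ n * p /\ p <> q ^+ n * z.
Proof.
move=> c0 p0 p0' z0 z0' Ezz Hp Hz n.
have qn m : q ^+ m != 0 by rewrite expf_neq0.
have main (Q : C) j := @pole_ratios_not_dilated p p' z z' Q j c0 p0 p0' z0 z0'.
have Ep' : p' = z * z' / (q * p).
  by rewrite Ezz; field; rewrite q0 p0.
split=> E.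
  case: n E => [|n] E.
    have := @main q^-1 0; rewrite invr_eq0 tau_eval expr1 invrK => /(_ q0 Hp Hz (addrC _ _)).
    apply; rewrite Ep' E expr0 mul1r; field; by rewrite q0 p0.
  have := @main (q ^+ (n.*2.+1)) n.*2; rewrite tau_eval => /(_ (qn _) Hp Hz (erefl _)).
  apply; rewrite Ep' E -addnn !exprS exprD; field; by rewrite q0 p0.
have := @main (q ^- (n.*2.+1)) n.*2; rewrite tau_eval invr_eq0 invrK.
move=> /(_ (qn _) Hp Hz (addrC _ _)); apply.
rewrite Ep' E -addnn !exprS exprD; field; by rewrite q0 z0 qn.
Qed.

End Transcendence.

(** * The rational parametrization of the kernel curve *)

Section LinearFactors.
Variables (C : numFieldType) (K : ratField C).
Local Notation "p %:K" := (@rpoly C K p) (at level 1, format "p %:K").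

Definition lin_prod (L : seq C) : {poly C} := \prod_(l <- L) ('X - l%:P).

Lemma lin_prod_neq0 L : lin_prod L != 0.
Proof. by apply/monic_neq0/monic_prod => l _; exact: monicXsubC. Qed.

Lemma lin_prod_factor L c : exists2 B : {poly C}, B.[c] != 0 &
  lin_prod L = ('X - c%:P) ^+ count_mem c L * B.
Proof.
elim: L => [|l L [B B0 E]].
  by exists 1; rewrite ?hornerC ?oner_neq0 // /lin_prod big_nil expr0 mulr1.
rewrite /lin_prod big_cons -/(lin_prod L) E /=; case: eqP => [->|lc] /=.
  by exists B => //; rewrite add1n exprS mulrA.
exists (('X - l%:P) * B); last by rewrite add0n mulrCA.
by rewrite hornerM hornerXsubC mulf_neq0 // subr_eq0; apply/eqP => /esym.
Qed.

Lemma pole_le_lin_prod (N : {poly C}) L c :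
  pole_le (count_mem c L) c (N%:K / (lin_prod L)%:K).
Proof. by have [B B0 ->] := lin_prod_factor L c; exact: pole_le_frac. Qed.

Lemma pole_eq_lin_prod (N : {poly C}) L c : N.[c] != 0 ->
  pole_eq (count_mem c L) c (N%:K / (lin_prod L)%:K).
Proof. by move=> N0; have [B B0 ->] := lin_prod_factor L c; exact: pole_eq_frac. Qed.

Lemma reval_lin_prod (N : {poly C}) L : \forall s \near 0^',
  reval s (N%:K / (lin_prod L)%:K) = N.[s] / \prod_(l <- L) (s - l).
Proof.
apply: filterS (reval_frac K N (lin_prod_neq0 L)) => s ->; congr (_ / _).
by rewrite horner_prod; apply: eq_bigr => l _; rewrite hornerXsubC.
Qed.

Lemma near_lin_neq0 (c : C) : \forall s \near 0^', s - c != 0.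
Proof.
have := @near_horner_neq0 C ('X - c%:P); rewrite polyXsubC_eq0 => /(_ isT).
by apply: filterS => s; rewrite hornerXsubC.
Qed.

Lemma reval_cvg0 (N D : {poly C}) : N.[0] = 0 -> N != 0 -> D.[0] != 0 ->
  (fun s : C => reval s (N%:K / D%:K)) @ (0 : C)^' --> (0 : C)^'.
Proof.
move=> N0 Nn0 D0; have Dn0 := horner_neq0_poly D0.
apply: cvg_dnbhs0; last first.
  by apply: reval_neq0; rewrite mulf_neq0 ?invr_eq0 ?rpoly_eq0.
have H0 : (fun s : C => N.[s] / D.[s]) @ (0 : C) --> N.[0] / D.[0].
  have hN := @horner_continuous C N 0; have hD := @horner_continuous C D 0.
  exact: (cvgM hN (cvgV D0 hD)).
rewrite N0 mul0r in H0.
have H : (fun s : C => N.[s] / D.[s]) @ (0 : C)^' --> (0 : C).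
  by move=> P /H0; exact: nbhs_dnbhs.
apply: cvg_trans H; apply: near_eq_cvg.
by apply: filterS (reval_frac K N Dn0) => s ->.
Qed.

Lemma delta_frac_neq0 (N D : {poly C}) : N.[0] = 0 -> N^`().[0] != 0 -> D.[0] != 0 ->
  delta (N%:K / D%:K) != 0.
Proof.
move=> N0 N10 D0; have Dn0 := horner_neq0_poly D0.
rewrite deltaE // mulf_neq0 ?invr_eq0 ?rpoly_eq0 ?expf_neq0 //.
rewrite mulf_neq0 ?polyX_eq0 // (@horner_neq0_poly _ _ 0) //.
by rewrite !hornerE N0 mul0r subr0 mulf_neq0.
Qed.

End LinearFactors.

Section DominantPole.
Variables (C : numFieldType) (K : ratField C).
Variables (q kappa p p' z z' : C).
Hypotheses (q0 : q != 0) (qtf : forall n, q ^+ n.+1 != 1) (kappa0 : kappa != 0).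
Hypotheses (p0 : p != 0) (p0' : p' != 0).

(** The function x(s) (y(q s) - y(s)), where x has the poles p, p' and y has the poles z, z'.
    The factor s^2 - p p' is that of y(q s) - y(s). *)
Definition telescoped (s : C) : C :=
  kappa * s ^+ 2 * (s ^+ 2 - p * p') /
  ((s - p) * (s - p') * (s - z) * (s - z') * (s - z / q) * (s - z' / q)).

(** The hypotheses of [no_linear_telescoper] on poles, for a rational function that equals
    [telescoped] near the origin. *)
Definition dominant_pole : Prop := exists M (b : K),
  [/\ \forall s \near 0^', reval s b = telescoped s,
      pole_eq M.+1 p b,
      forall k : nat, pole_le M (q ^+ k.+1 * p) b &
      forall k : nat, pole_le M (q ^- k.+1 * p) b].

Definition orbit_disjoint (x : C) : Prop := forall n, x <> q ^+ n * p /\ p <> q ^+ n * x.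

Lemma qn0 n : q ^+ n != 0. Proof. exact: expf_neq0. Qed.

Lemma orbit_disjoint_posF x k : orbit_disjoint x -> (x == q ^+ k * p) = false.
Proof. by move=> /(_ k)[/eqP /negPf]. Qed.

Lemma orbit_disjoint_negF x k : orbit_disjoint x -> (x == q ^- k * p) = false.
Proof.
move=> /(_ k)[_ h]; apply/eqP => E; apply: h.
by rewrite E mulVKf ?qn0.
Qed.

Lemma orbit_disjoint_div x : orbit_disjoint x -> orbit_disjoint (x / q).
Proof.
move=> h n; split=> E.
  by have [H _] := h n.+1; apply: H; rewrite exprS -mulrA -E mulrC divfK.
case: n E => [|n] E.
  have [H _] := h 1%N; apply: H; rewrite E expr0 expr1 mul1r mulrC divfK //.
have [_ H] := h n; apply: H; rewrite {1}E exprS; field; exact: q0.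
Qed.

Lemma orbit_disjoint_mul x : orbit_disjoint x -> orbit_disjoint (q * x).
Proof.
move=> h n; split=> E; last first.
  by have [_ H] := h n.+1; apply: H; rewrite exprSr -mulrA.
case: n E => [|n] E.
  have [_ H] := h 1%N; apply: H; by rewrite expr1 E expr0 mul1r.
have [H _] := h n; apply: H; apply: (mulfI q0).
by rewrite E exprS mulrA.
Qed.

Lemma orbit_p_posF k : (p == q ^+ k.+1 * p) = false.
Proof.
apply/negbTE; rewrite -{1}[p]mul1r (inj_eq (mulIf p0)) eq_sym.
exact: qtf.
Qed.

Lemma orbit_p_negF k : (p == q ^- k.+1 * p) = false.
Proof.
apply/negbTE; rewrite -{1}[p]mul1r (inj_eq (mulIf p0)) eq_sym.
by rewrite invr_eq1 qtf.
Qed.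

Lemma dominant_pole_of (N : {poly C}) L M :
  (\forall s \near 0^', N.[s] / \prod_(l <- L) (s - l) = telescoped s) ->
  count_mem p L = M.+1 -> N.[p] != 0 ->
  (forall k, (count_mem (q ^+ k.+1 * p)%R L <= M)%N) ->
  (forall k, (count_mem (q ^- k.+1 * p)%R L <= M)%N) -> dominant_pole.
Proof.
move=> NL pM N0 posM negM; exists M, (rpoly N / rpoly (lin_prod L)); split.
- by apply: filterS2 NL (reval_lin_prod K N L) => s <-.
- by rewrite -pM; exact: pole_eq_lin_prod.
- by move=> k; apply: pole_leW (posM k) _; exact: pole_le_lin_prod.
- by move=> k; apply: pole_leW (negM k) _; exact: pole_le_lin_prod.
Qed.

Lemma telescoped_num : \forall s \near 0^',
  (kappa *: ('X^2 * ('X^2 - (p * p')%:P))).[s] /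
    \prod_(l <- [:: p; p'; z; z'; z / q; z' / q]) (s - l) = telescoped s.
Proof.
apply: filterE => s; rewrite !big_cons big_nil.
rewrite hornerZ hornerM hornerD hornerN !hornerXn hornerC /telescoped.
by congr (_ / _); ring.
Qed.

(** If p = p', the numerator s^2 - p p' cancels one of the two factors s - p. *)
Lemma telescoped_num_double : p' = p -> \forall s \near 0^',
  (kappa *: ('X^2 * ('X + p%:P))).[s] /
    \prod_(l <- [:: p; z; z'; z / q; z' / q]) (s - l) = telescoped s.
Proof.
move=> Ep'; apply: filterS (near_lin_neq0 p) => s sp.
rewrite !big_cons big_nil hornerZ hornerM hornerD !hornerXn hornerX hornerC.
rewrite /telescoped Ep' mulr1.
set D := (X in _ / (_ * X)).
have -> : (s - p) * (s - p) * (s - z) * (s - z') * (s - z / q) * (s - z' / q)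
  = (s - p) * ((s - p) * D) by rewrite /D; ring.
have -> : s ^+ 2 - p * p = (s - p) * (s + p) by ring.
have -> : kappa * s ^+ 2 * ((s - p) * (s + p)) =
    (s - p) * (kappa * (s ^+ 2 * (s + p))) by ring.
by rewrite -[RHS]mulf_div mulfV // mul1r.
Qed.

Lemma num_neq0 : p' != p -> (kappa *: ('X^2 * ('X^2 - (p * p')%:P))).[p] != 0.
Proof.
move=> np'; rewrite hornerZ hornerM hornerD hornerN !hornerXn hornerC.
by rewrite expr2 -mulrBr !mulf_neq0 // subr_eq0 eq_sym.
Qed.

Lemma num_double_neq0 : (kappa *: ('X^2 * ('X + p%:P))).[p] != 0.
Proof.
rewrite hornerZ hornerM hornerD !hornerXn hornerX hornerC.
by rewrite !mulf_neq0 ?expf_neq0 // -mulr2n mulrn_eq0.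
Qed.

Lemma orbit_disjoint_ptF x : orbit_disjoint x -> (x == p) = false.
Proof. by move/(orbit_disjoint_posF 0); rewrite expr0 mul1r. Qed.

Let orbitF := (orbit_p_posF, orbit_p_negF,
  orbit_disjoint_ptF, orbit_disjoint_posF, orbit_disjoint_negF).

(** The generic case: p is a simple pole, and no other pole lies in its orbit. *)
Lemma dominant_pole_disjoint : orbit_disjoint z -> orbit_disjoint z' ->
  p' = p \/ orbit_disjoint p' -> dominant_pole.
Proof.
move=> hz hz' hp'.
have hzq := orbit_disjoint_div hz; have hzq' := orbit_disjoint_div hz'.
have [Ep'|np'] := eqVneq p' p.
  apply: (@dominant_pole_of _ _ 0%N (telescoped_num_double Ep')).
  - by rewrite /= eqxx !orbitF.
  - exact: num_double_neq0.
  - by move=> k; rewrite /= !orbitF.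
  - by move=> k; rewrite /= !orbitF.
have {}hp' : orbit_disjoint p' by case: hp' => // E; rewrite E eqxx in np'.
apply: (@dominant_pole_of _ _ 0%N telescoped_num).
- by rewrite /= eqxx !orbitF.
- exact: num_neq0.
- by move=> k; rewrite /= !orbitF.
- by move=> k; rewrite /= !orbitF.
Qed.

(** x and y have the pole p in common, so it is a double pole of the product, while the
    rest of its orbit contains only the simple pole p/q. *)
Lemma dominant_pole_shared : z = p -> z' = q * p' -> orbit_disjoint p' -> dominant_pole.
Proof.
move=> Ez Ez' hp'; have hqp' := orbit_disjoint_mul hp'.
have Ezq' : z' / q = p' by rewrite Ez' mulrC mulKf.
have pq x : (p / q == x) = (p == q * x).
  by rewrite -(inj_eq (mulfI q0)) mulrC divfK.
have pqp : (p / q == p) = false.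
  by have := orbit_p_posF 0; rewrite expr1 pq.
apply: (@dominant_pole_of _ _ 1%N telescoped_num); rewrite ?Ezq' ?Ez ?Ez'.
- by rewrite /= eqxx pqp !orbitF.
- by apply: num_neq0; rewrite orbitF.
- by move=> k; rewrite /= pq mulrA -exprS !orbitF.
- move=> k; rewrite /= (orbit_disjoint_negF _ hp') (orbit_disjoint_negF _ hqp').
  by rewrite orbit_p_negF; case: eqP.
Qed.

(** After the cancellation of one factor, p is still a triple pole: from x, y(s) and
    y(q s).  The other poles in its orbit are the simple ones q p and p/q. *)
Lemma dominant_pole_tangent : z = p -> p' = p -> z' = q * p -> dominant_pole.
Proof.
move=> Ez Ep' Ez'.
have Ezq' : z' / q = p by rewrite Ez' mulrC mulKf.
have qpp : (q * p == p) = false.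
  by rewrite eq_sym; have := orbit_p_posF 0; rewrite expr1.
have pq x : (p / q == x) = (p == q * x).
  by rewrite -(inj_eq (mulfI q0)) mulrC divfK.
have pqp : (p / q == p) = false.
  by have := orbit_p_posF 0; rewrite expr1 pq.
apply: (@dominant_pole_of _ _ 2 (telescoped_num_double Ep')); rewrite ?Ezq' ?Ez ?Ez'.
- by rewrite /= eqxx pqp qpp.
- exact: num_double_neq0.
- by move=> k; rewrite /= pq mulrA -exprS !orbit_p_posF; case: eqP.
- have qp k : (q * p == q ^- k.+1 * p) = false.
    rewrite -(inj_eq (mulfI (qn0 k.+1))) mulVKf ?qn0 // mulrA -exprSr eq_sym.
    exact: orbit_p_posF.
  by move=> k; rewrite /= qp orbit_p_negF; case: eqP.
Qed.

End DominantPole.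

Section KernelParametrization.
Variables (C : numFieldType) (a b r c10 c01 c11 m1 m2 u0 v0 k : C).
Hypotheses (bE : b = a * m1 * m2) (rE : r = a * (m1 + m2)).
Hypothesis c10E : c10 = r * u0 - 2 * a * v0.
Hypothesis c01E : c01 = r * v0 - 2 * b * u0.
Hypothesis c11E : c11 = a * k - (c01 * u0 + c10 * v0) / 2.

Definition kernel_form (x y : C) : C :=
  a * x ^+ 2 - r * x * y + b * y ^+ 2 + c01 * x * y ^+ 2 + c10 * x ^+ 2 * y
  + c11 * x ^+ 2 * y ^+ 2.

(** In u = 1/x, v = 1/y the kernel is the conic a v^2 - r u v + b u^2 + c01 u + c10 v + c11 = 0,
    with center (u0, v0) and asymptotic slopes m1, m2.  With U = u - u0 and V = v - v0 it
    reads (V - m1 U) (V - m2 U) = - k, and s is the value of V - m1 U. *)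
Lemma kernel_form_param (s : C) (D := m2 - m1) (X := s ^+ 2 + u0 * D * s + k)
    (Y := m2 * s ^+ 2 + v0 * D * s + m1 * k) :
  X != 0 -> Y != 0 -> kernel_form (D * s / X) (D * s / Y) = 0.
Proof.
move=> X0 Y0; rewrite /kernel_form.
have E : a * Y ^+ 2 - r * X * Y + b * X ^+ 2 + c01 * (D * s) * X
    + c10 * (D * s) * Y + c11 * (D * s) ^+ 2 = 0.
  by rewrite c11E c10E c01E bE rE /X /Y /D; field.
transitivity ((a * Y ^+ 2 - r * X * Y + b * X ^+ 2 + c01 * (D * s) * X
    + c10 * (D * s) * Y + c11 * (D * s) ^+ 2) * (D * s) ^+ 2 / (X ^+ 2 * Y ^+ 2)).
  by clear E; clearbody X Y; clearbody D; field; rewrite X0 Y0.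
by rewrite E !mul0r.
Qed.

End KernelParametrization.

Section Uniformization.
Variables (C : numFieldType) (a b r c10 c01 c11 m1 m2 u0 v0 k : C).
Hypotheses (m10 : m1 != 0) (m20 : m2 != 0) (m12 : m1 != m2).
Hypotheses (bE : b = a * m1 * m2) (rE : r = a * (m1 + m2)).
Hypothesis c10E : c10 = r * u0 - 2 * a * v0.
Hypothesis c01E : c01 = r * v0 - 2 * b * u0.
Hypothesis c11E : c11 = a * k - (c01 * u0 + c10 * v0) / 2.

Local Notation D := (m2 - m1).
Local Notation q := (m1 / m2).
Local Notation kernel := (kernel_form a b r c10 c01 c11).

Variables (K : ratField C) (p p' z z' : C).
Hypotheses (ppE : p * p' = k) (pDE : p + p' = - (u0 * D)).
Hypotheses (zzE : z * z' = q * k) (zDE : z + z' = - (v0 * D / m2)).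
Hypothesis k0 : k != 0.

(** The map s -> k/s leaves curve_x fixed and turns curve_y into its dilate by
    q = m1/m2; so the two points of the curve above x(s) are (x(s), y(s)) and
    (x(s), y(q s)). *)
Definition curve_x : K := rpoly (D *: 'X) / rpoly (lin_prod [:: p; p']).
Definition curve_y : K := rpoly ((D / m2) *: 'X) / rpoly (lin_prod [:: z; z']).

Let D0 : D != 0. Proof. by rewrite subr_eq0 eq_sym. Qed.
Let q0 : q != 0. Proof. by rewrite mulf_neq0 ?invr_eq0. Qed.
Let p0 : p != 0.
Proof. by apply: contra_neq k0 => E; rewrite -ppE E mul0r. Qed.
Let p'0 : p' != 0.
Proof. by apply: contra_neq k0 => E; rewrite -ppE E mulr0. Qed.
Let z0 : z != 0.
Proof. by apply: contra_neq (mulf_neq0 q0 k0) => E; rewrite -zzE E mul0r. Qed.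
Let z'0 : z' != 0.
Proof. by apply: contra_neq (mulf_neq0 q0 k0) => E; rewrite -zzE E mulr0. Qed.

Let x_facE (s : C) : (s - p) * (s - p') = s ^+ 2 + u0 * D * s + k.
Proof.
have -> : (s - p) * (s - p') = s ^+ 2 - (p + p') * s + p * p' by ring.
by rewrite pDE ppE; ring.
Qed.

Let y_facE (s : C) : m2 * ((s - z) * (s - z')) = m2 * s ^+ 2 + v0 * D * s + m1 * k.
Proof.
have -> : (s - z) * (s - z') = s ^+ 2 - (z + z') * s + z * z' by ring.
by rewrite zDE zzE; field; exact: m20.
Qed.

Let y_fac_swap (s : C) :
  q^-1 * (m2 * ((q * s - z) * (q * s - z'))) = m1 * s ^+ 2 + v0 * D * s + m2 * k.
Proof. by rewrite y_facE; field; rewrite m10 m20. Qed.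

Lemma reval_curve_x : \forall s \near 0^',
  reval s curve_x = D * s / ((s - p) * (s - p')).
Proof.
apply: filterS (reval_lin_prod K (D *: 'X) [:: p; p']) => s ->.
by rewrite !big_cons big_nil hornerZ hornerX mulr1.
Qed.

Lemma reval_curve_y : \forall s \near 0^',
  reval s curve_y = D * s / (m2 * ((s - z) * (s - z'))).
Proof.
apply: filterS (reval_lin_prod K ((D / m2) *: 'X) [:: z; z']) => s ->.
rewrite !big_cons big_nil hornerZ hornerX mulr1.
by rewrite (mulrAC D) -[LHS]mulrA -invfM.
Qed.

Lemma near_curve_kernel :
  \forall s \near 0^', kernel (reval s curve_x) (reval s curve_y) = 0.
Proof.
apply: filter_app reval_curve_y; apply: filter_app reval_curve_x.
apply: filter_app (near_lin_neq0 z'); apply: filter_app (near_lin_neq0 z).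
apply: filterS2 (near_lin_neq0 p) (near_lin_neq0 p') => s sp sp' sz sz' -> ->.
have := mulf_neq0 sp sp'; have := mulf_neq0 m20 (mulf_neq0 sz sz').
by rewrite x_facE y_facE => Y0 X0; exact: (kernel_form_param bE rE).
Qed.

(** Exchanging m1 with m2 and s with - s leaves x(s) unchanged and turns y(s) into y(q s). *)
Lemma near_curve_kernel_dilated :
  \forall s \near 0^', kernel (reval s curve_x) (reval (q * s) curve_y) = 0.
Proof.
apply: filter_app (near_dilation q0 reval_curve_y); apply: filter_app reval_curve_x.
apply: filter_app (near_dilation q0 (near_lin_neq0 z')).
apply: filter_app (near_dilation q0 (near_lin_neq0 z)).
apply: filterS2 (near_lin_neq0 p) (near_lin_neq0 p') => s sp sp' sz sz' -> ->.
have := mulf_neq0 sp sp'.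
have := mulf_neq0 (invr_neq0 q0) (mulf_neq0 m20 (mulf_neq0 sz sz')).
rewrite x_facE y_fac_swap => Y0 X0.
have -> : D * (q * s) / (m2 * ((q * s - z) * (q * s - z'))) =
    (m1 - m2) * - s / (m1 * (- s) ^+ 2 + v0 * (m1 - m2) * - s + m2 * k).
  have -> : m1 * (- s) ^+ 2 + v0 * (m1 - m2) * - s + m2 * k
      = m1 * s ^+ 2 + v0 * D * s + m2 * k by ring.
  rewrite -y_fac_swap; move: sz sz'; move: (q * s - z) (q * s - z') => A B A0 B0.
  by field; rewrite A0 B0 m10 m20.
have -> : D * s / (s ^+ 2 + u0 * D * s + k) =
    (m1 - m2) * - s / ((- s) ^+ 2 + u0 * (m1 - m2) * - s + k).
  by congr (_ / _); ring.
apply: kernel_form_param => //.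
- by rewrite bE mulrAC.
- by rewrite rE addrC.
- by apply: contra_neq X0 => <-; ring.
- by apply: contra_neq Y0 => <-; ring.
Qed.

Lemma telescoped_curve : \forall s \near 0^',
  reval s curve_x * (reval (q * s) curve_y - reval s curve_y)
  = telescoped q (D ^+ 3 / (m1 * m2)) p p' z z' s.
Proof.
apply: filter_app reval_curve_y.
apply: filter_app (near_dilation q0 reval_curve_y); apply: filter_app reval_curve_x.
apply: filter_app (near_dilation q0 (near_lin_neq0 z')).
apply: filter_app (near_dilation q0 (near_lin_neq0 z)).
apply: filter_app (near_lin_neq0 z'); apply: filter_app (near_lin_neq0 z).
apply: filterS2 (near_lin_neq0 p) (near_lin_neq0 p') => s sp sp' sz sz' sqz sqz' -> -> ->.
(* The factors of y(q s), up to q, are those with poles z/q and z'/q. *)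
have hq (w : C) : s - w / q = (q * s - w) / q by rewrite mulrBl mulrAC mulfV ?mul1r.
rewrite /telescoped !hq.
have E : (s - z) * (s - z') - q^-1 * ((q * s - z) * (q * s - z'))
    = D / m2 * (s ^+ 2 - p * p').
  have Ez : z * z' / q = p * p' by rewrite zzE ppE mulrC mulKf.
  have -> : (s - z) * (s - z') - q^-1 * ((q * s - z) * (q * s - z'))
    = s ^+ 2 - q * s ^+ 2 + z * z' - z * z' / q by field; rewrite m10 m20.
  by rewrite Ez zzE ppE; field; exact: m20.
have E2 : s ^+ 2 - p * p' = m2 / D * ((s - z) * (s - z') - q^-1 * ((q * s - z) * (q * s - z'))).
  by rewrite E; field; rewrite D0 m20.
rewrite E2; move: sqz sqz'; move: (q * s - z) (q * s - z') => A B A0 B0.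
by field; rewrite A0 B0 sz sz' sp sp' D0 m10 m20.
Qed.

Lemma curve_x_germ : [/\ curve_x != 0, delta curve_x != 0 &
  (fun s : C => reval s curve_x) @ (0 : C)^' --> (0 : C)^'].
Proof.
have L0 : (lin_prod [:: p; p']).[0] != 0.
  by rewrite /lin_prod !big_cons big_nil mulr1 hornerM !hornerXsubC !sub0r mulrNN mulf_neq0.
split.
- by rewrite mulf_neq0 ?invr_eq0 ?rpoly_eq0 ?lin_prod_neq0 // scaler_eq0 polyX_eq0 orbF.
- by apply: delta_frac_neq0 => //; rewrite ?derivZ ?derivX !hornerE ?mulr0 ?mulr1.
- apply: reval_cvg0 => //; first by rewrite !hornerE ?mulr0.
  by rewrite scaler_eq0 polyX_eq0 orbF.
Qed.

Lemma curve_y_germ : [/\ curve_y != 0, delta curve_y != 0 &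
  (fun s : C => reval s curve_y) @ (0 : C)^' --> (0 : C)^'].
Proof.
have L0 : (lin_prod [:: z; z']).[0] != 0.
  by rewrite /lin_prod !big_cons big_nil mulr1 hornerM !hornerXsubC !sub0r mulrNN mulf_neq0.
have Dm0 : D / m2 != 0 by rewrite mulf_neq0 ?invr_eq0.
split.
- by rewrite mulf_neq0 ?invr_eq0 ?rpoly_eq0 ?lin_prod_neq0 // scaler_eq0 polyX_eq0 orbF.
- by apply: delta_frac_neq0 => //; rewrite ?derivZ ?derivX !hornerE ?mulr0 ?mulr1.
- apply: reval_cvg0 => //; first by rewrite !hornerE ?mulr0.
  by rewrite scaler_eq0 polyX_eq0 orbF.
Qed.

(** Both (x(s), y(s)) and (x(s), y(q s)) tend to the origin along the kernel curve; the
    difference of the two functional equations is the equation of the criterion. *)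
Theorem kernel_hypertranscendence (alpha beta : C) (Wx Wy : C -> C) :
  (forall n, q ^+ n.+1 != 1) -> alpha != 0 -> beta != 0 ->
  (forall j, \forall z \near (0 : C), derivable (derive1n j Wx) z 1) ->
  (forall j, \forall z \near (0 : C), derivable (derive1n j Wy) z 1) ->
  (forall x y, `|x| <= 1 -> `|y| <= 1 -> kernel x y = 0 ->
     alpha * x ^+ 2 * Wx x + beta * y ^+ 2 * Wy y = x * y) ->
  dominant_pole K q (D ^+ 3 / (m1 * m2)) p p' z z' ->
  forall (m : nat) (P : mpoly m.+1 K), P != 0 ->
    ~ (\forall z \near 0^',
         mmap (reval z) (fun i : 'I_m.+1 => derive1n i Wx z) P = 0) /\
    ~ (\forall z \near 0^',
         mmap (reval z) (fun i : 'I_m.+1 => derive1n i Wy z) P = 0).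
Proof.
move=> qtf al0 be0 dWx dWy fe [M [B [BE Bp Bpos Bneg]]].
have [x0 dx0 xc] := curve_x_germ; have [y0 dy0 yc] := curve_y_germ.
have n1 : \forall z \near (0 : C)^', `|z| <= 1.
  by apply/dnbhs0P; exists 1 => // s _ /ltW.
have x1 : \forall s \near (0 : C)^', `|reval s curve_x| <= 1 := xc _ n1.
have y1 : \forall s \near (0 : C)^', `|reval s curve_y| <= 1 := yc _ n1.
have y1q := near_dilation q0 y1.
have fe1 : \forall s \near 0^', alpha * reval s curve_x ^+ 2 * Wx (reval s curve_x) +
   beta * reval s curve_y ^+ 2 * Wy (reval s curve_y) = reval s curve_x * reval s curve_y.
  by apply: filter_app near_curve_kernel; apply: filterS2 x1 y1 => s; exact: fe.
have fe2 : \forall s \near 0^', alpha * reval s curve_x ^+ 2 * Wx (reval s curve_x) +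
   beta * reval (q * s) curve_y ^+ 2 * Wy (reval (q * s) curve_y)
   = reval s curve_x * reval (q * s) curve_y.
  by apply: filter_app near_curve_kernel_dilated; apply: filterS2 x1 y1q => s; exact: fe.
apply: (hypertranscendence_criterion q0 qtf p0 al0 be0 x0 y0 dx0 dy0 xc yc dWx dWy fe1 _ Bp Bpos Bneg).
apply: filter_app BE; apply: filter_app telescoped_curve.
apply: filterS2 fe1 fe2 => s E1 E2 <- ->.
by rewrite mulrBr -E2 -E1; ring.
Qed.

End Uniformization.

Section ExistenceOfUniformization.
Variables (C : numFieldType) (K : ratField C) (r : C).
Hypothesis sqrt_ex : forall w : C, exists s, s ^+ 2 = w.
Hypothesis r_tr : forall P : {poly rat}, P != 0 -> (map_poly ratr P).[r] != 0.
Variables (a b c10 c01 c11 : rat).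
Hypotheses (a0 : a != 0) (b0 : b != 0) (c11_or_c01 : c11 != 0 \/ c01 != 0).

Local Notation ra := (@ratr C a).
Local Notation rb := (@ratr C b).
Local Notation r10 := (@ratr C c10).
Local Notation r01 := (@ratr C c01).
Local Notation r11 := (@ratr C c11).
Local Notation ek := (map_poly ratr (prod_poly a b c10 c01 c11)).[r].

Lemma quadratic_roots (S P : C) : exists w w', w + w' = S /\ w * w' = P.
Proof.
have [s sE] := sqrt_ex (S ^+ 2 - 4 * P).
exists ((S + s) / 2), ((S - s) / 2); split; first by field.
transitivity ((S ^+ 2 - s ^+ 2) / 4); first by field.
by rewrite sE; field.
Qed.

Let ra0 : ra != 0. Proof. by rewrite fmorph_eq0. Qed.
Let rb0 : rb != 0. Proof. by rewrite fmorph_eq0. Qed.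

Lemma disc_neq0 : r ^+ 2 - 4 * ra * rb != 0.
Proof.
have P0 : 'X^2 - (4 * a * b)%:P != 0 :> {poly rat}.
  by apply/monic_neq0/monicXnsubC.
by have := r_tr P0; rewrite !evalrE !rmorphM rmorph_nat.
Qed.

Lemma prod_polyE : ek = r11 * (r ^+ 2 - 4 * ra * rb) + r01 * r10 * r
  + ra * r01 ^+ 2 + rb * r10 ^+ 2.
Proof.
rewrite /prod_poly -!mul_polyC !evalrE !(rmorphB, rmorphD, rmorphM, rmorphXn) /=; ring.
Qed.

Local Notation nx := (map_poly ratr (sumx_poly a c10 c01)).[r].
Local Notation ny := (map_poly ratr (sumy_poly b c10 c01)).[r].

Lemma sumx_polyE : nx = (r * r10 + 2 * ra * r01) ^+ 2.
Proof. by rewrite /sumx_poly -!mul_polyC !evalrE !rmorphM /=; ring. Qed.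

Lemma sumy_polyE : ny = (r * r01 + 2 * rb * r10) ^+ 2.
Proof. by rewrite /sumy_poly -!mul_polyC !evalrE !rmorphM /=; ring. Qed.

Lemma prod_poly_neq0 : ek != 0.
Proof.
apply: r_tr; have [c11z|c11n] := eqVneq c11 0; last first.
  by rewrite -size_poly_gt0 size_prod_poly3.
have c01n : c01 != 0 by case: c11_or_c01 => //; rewrite c11z eqxx.
have [c10z|c10n] := eqVneq c10 0; last first.
  by rewrite -size_poly_gt0 size_prod_poly2.
rewrite /prod_poly c11z c10z mulr0 !scale0r !add0r expr0n mulr0 addr0 mulr0 subr0.
by rewrite polyC_eq0 mulf_neq0 // expf_neq0.
Qed.

(** The slopes m1, m2 are the roots of a m^2 - r m + b, distinct because r is transcendental.
    If c11 != 0, the four poles are obtained as roots of quadratic polynomials, and the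
    poles of x and y have disjoint orbits.  If c11 = 0, the conic passes through
    u = v = 0, so x and y have the common pole p = m1 u0 - v0; then p - p' = c10/a, so p is a
    double pole of x exactly when c10 = 0. *)
Lemma uniformization_exists : exists m1 m2 u0 v0 k p p' z z' : C,
  let q := m1 / m2 in let D := m2 - m1 in
  [/\ [/\ m1 != 0, m2 != 0, m1 != m2 & k != 0],
      rb = ra * m1 * m2 /\ r = ra * (m1 + m2),
      [/\ r10 = r * u0 - 2 * ra * v0, r01 = r * v0 - 2 * rb * u0 &
          r11 = ra * k - (r01 * u0 + r10 * v0) / 2],
      [/\ p * p' = k, p + p' = - (u0 * D), z * z' = q * k
         & z + z' = - (v0 * D / m2)] &
      (forall n, q ^+ n.+1 != 1) /\ dominant_pole K q (D ^+ 3 / (m1 * m2)) p p' z z'].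
Proof.
have d0 := disc_neq0; have [S SE] := sqrt_ex (r ^+ 2 - 4 * ra * rb).
have S0 : S != 0 by apply: contra_neq d0 => S0; rewrite -SE S0 expr0n.
pose m1 := (r - S) / (2 * ra); pose m2 := (r + S) / (2 * ra).
have bE : rb = ra * m1 * m2.
  transitivity ((r ^+ 2 - S ^+ 2) / (4 * ra)); last by rewrite /m1 /m2; field.
  by rewrite SE; field.
have rE : r = ra * (m1 + m2) by rewrite /m1 /m2; field.
have DE : m2 - m1 = S / ra by rewrite /m1 /m2; field.
have D0 : m2 - m1 != 0 by rewrite DE mulf_neq0 ?invr_eq0.
have m12 : m1 != m2 by rewrite eq_sym -subr_eq0.
have m10 : m1 != 0 by apply: contra_neq rb0 => E; rewrite bE E mulr0 mul0r.
have m20 : m2 != 0 by apply: contra_neq rb0 => E; rewrite bE E mulr0.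
have q0 : m1 / m2 != 0 by rewrite mulf_neq0 ?invr_eq0.
have qE : m1 / m2 + (m1 / m2)^-1 = r ^+ 2 / ratr (a * b) - 2.
  by rewrite rmorphM /= bE rE; field; rewrite ra0 m10 m20.
have qtf := q_not_root_of_unity r_tr a0 b0 q0 qE.
pose disc := r ^+ 2 - 4 * ra * rb.
pose u0 := (r * r10 + 2 * ra * r01) / disc; pose v0 := (r * r01 + 2 * rb * r10) / disc.
have c10E : r10 = r * u0 - 2 * ra * v0 by rewrite /u0 /v0 /disc; field.
have c01E : r01 = r * v0 - 2 * rb * u0 by rewrite /u0 /v0 /disc; field.
pose k := (r11 + (r01 * u0 + r10 * v0) / 2) / ra.
have c11E : r11 = ra * k - (r01 * u0 + r10 * v0) / 2 by rewrite /k; field.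
(* The product k of the poles of x is nonzero as a value at r of a nonzero polynomial. *)
have ekk : ek = ra * k * disc by rewrite prod_polyE /k /u0 /v0 /disc; field; rewrite ra0 d0.
have k0 : k != 0 by apply: contra_neq prod_poly_neq0 => E; rewrite ekk E mulr0 mul0r.
have DD : (m2 - m1) ^+ 2 * ra ^+ 2 = disc by rewrite DE /disc -SE; field.
have nxd : nx = (u0 * disc) ^+ 2 by rewrite sumx_polyE /u0 divfK.
have nyd : ny = (v0 * disc) ^+ 2 by rewrite sumy_polyE /v0 divfK.
pose U := - (u0 * (m2 - m1)); pose V := - (v0 * (m2 - m1) / m2).
have ppH p p' : p * p' = k -> p + p' = U ->
    (p + p') ^+ 2 * (ra * ek) = nx * (p * p').
  move=> -> ->; rewrite nxd ekk /U sqrrN -[X in _ = (_ * X) ^+ 2 * _]DD.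
  by rewrite -[in LHS]DD; ring.
have zzH z z' : z * z' = m1 / m2 * k -> z + z' = V ->
    (z + z') ^+ 2 * (rb * ek) = ny * (z * z').
  move=> -> ->; rewrite nyd ekk /V sqrrN -[X in _ = (_ * X) ^+ 2 * _]DD -[in LHS]DD bE.
  by field.
have kappa0 : (m2 - m1) ^+ 3 / (m1 * m2) != 0.
  by rewrite mulf_neq0 ?invr_eq0 ?expf_neq0 // mulf_neq0.
suff [p [p' [z [z' [pzE hpole]]]]] : exists p p' z z', [/\ p * p' = k, p + p' = U,
    z * z' = m1 / m2 * k & z + z' = V] /\
    dominant_pole K (m1 / m2) ((m2 - m1) ^+ 3 / (m1 * m2)) p p' z z'.
  by exists m1, m2, u0, v0, k, p, p', z, z'.
have nz2 (w w' l : C) : w * w' = l -> l != 0 -> w != 0 /\ w' != 0.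
  by move=> <-; rewrite mulf_eq0 negb_or => /andP.
have [c11z|c11n] := eqVneq c11 0; last first.
  have ek3 : (2 <= size (prod_poly a b c10 c01 c11))%N by rewrite size_prod_poly3.
  have [p [p' [pD pM]]] := quadratic_roots U k.
  have [z [z' [zD zM]]] := quadratic_roots V (m1 / m2 * k).
  have [p0 p'0] := nz2 _ _ _ pM k0.
  have [z0 z'0] := nz2 _ _ _ zM (mulf_neq0 q0 k0).
  exists p, p', z, z'; split=> //.
  have hp := ppH _ _ pM pD; have hz := zzH _ _ zM zD.
  have hz' : (z' + z) ^+ 2 * (rb * ek) =
      ny * (z' * z).
    by rewrite addrC (mulrC z').
  have zzpp : z * z' = m1 / m2 * (p * p') by rewrite pM.
  apply: dominant_pole_disjoint => //.
  - exact: (xy_poles_not_dilated r_tr a0 b0 q0 qE c11n p0 p'0 z0 z'0 zzpp hp hz).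
  - rewrite mulrC in zzpp.
    exact: (xy_poles_not_dilated r_tr a0 b0 q0 qE c11n p0 p'0 z'0 z0 zzpp hp hz').
  - have [->|np] := eqVneq p' p; [by left|right=> -[|n]].
      by rewrite expr0 !mul1r; split; apply/eqP; rewrite // eq_sym.
    exact: (x_poles_not_dilated r_tr a0 b0 q0 qE n ek3 p0 p'0 hp).
have c01n : c01 != 0 by case: c11_or_c01 => //; rewrite c11z eqxx.
have kE : ra * k = (r01 * u0 + r10 * v0) / 2.
  by apply/eqP; rewrite -subr_eq0 -c11E c11z rmorph0.
pose p := m1 * u0 - v0; pose p' := v0 - m2 * u0.
have pD : p + p' = U by rewrite /p /p' /U; ring.
have pM : p * p' = k.
  by apply: (mulfI ra0); rewrite kE c10E c01E bE rE /p /p'; field.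
have pB : p - p' = r10 / ra by rewrite c10E rE /p /p'; field.
have zM : p * (m1 / m2 * p') = m1 / m2 * k by rewrite mulrCA pM.
have zD : p + m1 / m2 * p' = V by rewrite /p /p' /V; field.
have [p0 p'0] := nz2 _ _ _ pM k0.
exists p, p', p, (m1 / m2 * p'); split=> //.
have [c10z|c10n] := eqVneq c10 0.
  have pp : p' = p.
    by apply/eqP; rewrite eq_sym -subr_eq0 pB c10z rmorph0 mul0r.
  by apply: dominant_pole_tangent; rewrite ?pp.
have ek2 : (2 <= size (prod_poly a b c10 c01 c11))%N by rewrite size_prod_poly2.
apply: dominant_pole_shared => // -[|n].
  rewrite expr0 !mul1r.
  have np : p != p' by rewrite -subr_eq0 pB mulf_neq0 ?invr_eq0 // fmorph_eq0.
  by split; apply/eqP; rewrite // eq_sym.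
exact: (x_poles_not_dilated r_tr a0 b0 q0 qE n ek2 p0 p'0 (ppH _ _ pM pD)).
Qed.

End ExistenceOfUniformization.

(** * Differential transcendence for the models *)

Section FractionField.
Variable C : numFieldType.

Definition fraction_ratField : ratField C :=
  @RatField C {fraction {poly C}} (@FracField.tofrac {poly C})
    (fun r => (frac (repr r)).1) (fun r => (frac (repr r)).2)
    (@tofrac_eq0 {poly C}) (fun r => denom_ratioP (repr r)) (@fracE {poly C}).

(** A differential relation on the unit disc holds near the origin, where the coefficients
    are defined outside 0. *)
Lemma diff_transcendental_near0 (f : C -> C) :
  (forall m (P : mpoly m.+1 fraction_ratField), P != 0 ->
     ~ \forall z \near 0^', mmap (reval z) (fun i : 'I_m.+1 => derive1n i f z) P = 0) ->
  diff_transcendental f.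
Proof.
move=> H [m [P [/eqP P0 PE]]]; apply: (H m P P0).
have n1 : \forall z \near (0 : C)^', `|z| < 1.
  by apply/dnbhs0P; exists 1.
have ndef : \forall z \near (0 : C)^', forall u, u \in msupp P ->
    ratfun_defined (mcoeff u P) z.
  apply: near_all_seq => u; have := near_horner_neq0 (denom_ratioP (repr (mcoeff u P))).
  by apply: filterS => z /eqP.
by apply: filterS2 n1 ndef => z z1 zd; exact: PE.
Qed.

End FractionField.

Section StepSet.
Variable d : int * int -> rat.
Hypothesis d_S : arises_from_S d.

(** What the five step sets have in common. *)
Lemma step_set_cases : [/\ d (-1, -1) = 0, d (-1, 0) = 0 & d (0, -1) = 0] /\
  [/\ d (1, -1) != 0, d (-1, 1) != 0 & d (1, 1) != 0 \/ d (0, 1) != 0].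
Proof.
have [S SS mE] := d_S.
have inS s : s \in S -> d s != 0.
  move=> sS; have : model d s by rewrite mE.
  by case=> _ _ /eqP.
have outS s : small_step s -> s != (0, 0) -> s \notin S -> d s = 0.
  move=> s1 s0 sS; apply: contraNeq sS => ds.
  have : model d s by split=> //; exact/eqP.
  by rewrite mE.
move: SS inS outS; rewrite !inE => SS inS outS.
split; split.
- by apply: outS => //; do 4? case/orP: SS => [/eqP-> //|SS]; rewrite (eqP SS).
- by apply: outS => //; do 4? case/orP: SS => [/eqP-> //|SS]; rewrite (eqP SS).
- by apply: outS => //; do 4? case/orP: SS => [/eqP-> //|SS]; rewrite (eqP SS).
- by apply: inS; do 4? case/orP: SS => [/eqP-> //|SS]; rewrite (eqP SS).
- by apply: inS; do 4? case/orP: SS => [/eqP-> //|SS]; rewrite (eqP SS).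
have : ((1, 1) \in S) || ((0, 1) \in S).
  by do 4? case/orP: SS => [/eqP-> //|SS]; rewrite (eqP SS).
by case/orP => /inS; [left|right].
Qed.

End StepSet.

(** t = 1/((1/t - c) + c) would be algebraic if 1/t - c were. *)
Lemma transcendental_shifted_inverse (R : realType) (t : R) (c : rat) :
  ~ algebraicOver (ratr : rat -> R) t ->
  forall P : {poly rat}, P != 0 ->
    (map_poly ratr P).[(t%:C)%C^-1 - ratr c] != 0 :> R[i].
Proof.
move=> t_tr P P0; apply/eqP => E; apply: t_tr.
have tE : t = (t^-1 - ratr c + ratr c)^-1 by rewrite subrK invrK.
rewrite tE; apply/algebraic_inv/algebraic_add; last exact: algebraic_id.
exists P => //; apply/eqP.
have cinj : injective (real_complex R) by exact: fmorph_inj.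
apply: cinj; rewrite -horner_map /= rmorph0 -[RHS]E -map_poly_comp.
rewrite rmorphB fmorphV /= fmorph_rat; congr (_.[_]).
by apply: eq_map_poly => x /=; rewrite fmorph_rat.
Qed.

Theorem theorem3p1 (R : realType) (t : R) (d : int * int -> rat)
    (t_gt0 : 0 < t) (t_lt1 : t < 1)
    (t_transcendental : ~ algebraicOver (ratr : rat -> R) t)
    (d_weight : is_weight d) (d_S : arises_from_S d) :
  diff_transcendental (fun x : R[i] => walk_gf d x 0 (t%:C)%C) /\
  diff_transcendental (fun y : R[i] => walk_gf d 0 y (t%:C)%C).
Proof.
pose C := (R[i] : numFieldType).
pose tC : C := (t%:C)%C.
have tC0 : 0 <= tC by rewrite ler0c ltW.
have tC1 : tC < 1 by rewrite -(rmorph1 (real_complex R)) ltcR.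
have tn0 : tC != 0 by rewrite (inj_eq (@fmorph_inj _ _ (real_complex R))) gt_eqF.
have [[dmm dm0 d0m] [a0 b0 c11_c01]] := step_set_cases d_S.
have r_tr := @transcendental_shifted_inverse R t (d (0, 0)) t_transcendental.
have sqrt_ex (w : C) : exists s : C, s ^+ 2 = w by exists (sqrtc w); exact: sqr_sqrtc.
have [m1 [m2 [u0 [v0 [k [p [p' [z [z' H]]]]]]]]] :=
  @uniformization_exists C (fraction_ratField C) _ sqrt_ex r_tr
    _ _ (d (1, 0)) _ _ a0 b0 c11_c01.
have [[m10 m20 m12 k0] [bE rE] [c10E c01E c11E] [ppE pDE zzE zDE] [qtf hpole]] := H.
have al0 : tC * ratr (d (1, -1)) != 0 by rewrite mulf_neq0 // fmorph_eq0.
have be0 : tC * ratr (d (-1, 1)) != 0 by rewrite mulf_neq0 // fmorph_eq0.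
have dW (P : nat -> {poly C}) : geometric_polys P ->
    forall j, \forall s \near (0 : C), derivable (derive1n j (polysum P)) s 1.
  move=> gP j; have := @near_norm_lt1 R 0; rewrite normr0 => /(_ ltr01).
  by apply: filterS => s; exact: derivable_derive1n_polysum.
have gx := geometric_xpoly tC0 tC1 d_weight dmm dm0 d0m.
have gy := geometric_ypoly tC0 tC1 d_weight dmm dm0 d0m.
have fe (x y : C) : `|x| <= 1 -> `|y| <= 1 ->
    kernel_form (ratr (d (1, -1))) (ratr (d (-1, 1))) (tC^-1 - ratr (d (0, 0)))
      (ratr (d (1, 0))) (ratr (d (0, 1))) (ratr (d (1, 1))) x y = 0 ->
    tC * ratr (d (1, -1)) * x ^+ 2 * polysum (xpoly d tC) x
    + tC * ratr (d (-1, 1)) * y ^+ 2 * polysum (ypoly d tC) y = x * y.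
  move=> x1 y1 ker; apply: functional_equation => //.
  have -> : kernel_S d x y = x * y / tC.
    rewrite -[RHS]addr0 -[X in _ + X]ker /kernel_form /kernel_S; ring.
  by rewrite mulrC divfK.
have crit := kernel_hypertranscendence m10 m20 m12 bE rE c10E c01E c11E ppE pDE
  zzE zDE k0 qtf al0 be0 (dW _ gx) (dW _ gy) fe hpole.
have tx : @diff_transcendental C (polysum (xpoly d tC)).
  exact: (@diff_transcendental_near0 C _ (fun m P P0 => proj1 (crit m P P0))).
have ty : @diff_transcendental C (polysum (ypoly d tC)).
  exact: (@diff_transcendental_near0 C _ (fun m P P0 => proj2 (crit m P P0))).
rewrite -(walk_gf_x tC dmm dm0 d0m) in tx; rewrite -(walk_gf_y tC dmm dm0 d0m) in ty.
split; [exact: tx|exact: ty].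
Qed.
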